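(* Let $V=\{\nu_1,\dots,\nu_r\}$, $r\ge1$, be a finite set of divisorial valuations of $R$. For any $\underline m\in S_V$ there exist unique $a_1,\dots,a_r\in\mathbb Z_{\ge0}$ and $\underline n\in S_V$ such that (1) $\underline m=\underline n+a_1B^1+\cdots+a_rB^r$; (2) $d_i(\underline n)=1$ for every $i=1,\dots,r$. In fact $a_i=\max\{k\in\mathbb Z_{\ge0}\mid\underline m-kB^i\in S_V\}=d_i(\underline m)-1$ for $i=1,\dots,r$.
   Context: $(R,\mathfrak m)$ is a complete regular local ring of dimension $2$ with an algebraically closed coefficient field $K$. A modification $\pi:X\to\operatorname{Spec}R$ is a nonempty finite composition of point blow-ups, the first one with center $\mathfrak m$ and each following one with center a closed point of the exceptional divisor already created; $E$ is its total exceptional divisor, with irreducible components $E_\alpha$. The $E_\alpha$-valuation sends $f\in R$ to the vanishing order of $f\circ\pi$ along $E_\alpha$. A divisorial valuation is a discrete valuation of the fraction field of $R$, centered at $R$, of rank $1$ and transcendence degree $1$; equivalently, the $E_\alpha$-valuation of some component of some modification. The minimal resolution $\pi:(X,E)\to\operatorname{Spec}R$ of $V$ is the minimal modification such that each $\nu_i$ is the $E_{\alpha(i)}$-valuation for some component $E_{\alpha(i)}$ of $E$. $Q_{\alpha(i)}$ is any irreducible element of $\mathfrak m$ such that the strict transform on $X$ of the curve $Q_{\alpha(i)}=0$ is smooth and meets $E_{\alpha(i)}$ transversely at a nonsingular point of $E$. Put $\underline\nu(h)=(\nu_1(h),\dots,\nu_r(h))$, $S_V=\{\underline\nu(h)\mid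 h\in R\setminus\{0\}\}\subset\mathbb Z^r_{\ge0}$, and $B^i=\underline\nu(Q_{\alpha(i)})$. For $\underline m\in\mathbb Z^r$, $J(\underline m)=\{g\in R\mid\underline\nu(g)\ge\underline m\}$ (componentwise order), $\underline e_i$ is the $i$-th standard basis vector of $\mathbb Z^r$, $D_i(\underline m)=J(\underline m)/J(\underline m+\underline e_i)$ and $d_i(\underline m)=\dim_KD_i(\underline m)$ (which is finite). *)

(* Defs.v *)
(* MathComp, with sets from MathComp-Classical. *)
From mathcomp Require Import all_boot all_order all_algebra.
From mathcomp Require Import mathcomp_extra boolp classical_sets.

Set Implicit Arguments.
Unset Strict Implicit.
Unset Printing Implicit Defensive.

Import Order.TTheory GRing.Theory Num.Theory.
Local Open Scope classical_set_scope.
Local Open Scope ring_scope.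

(* All rings are handled as subsets A of an ambient ring L, so that the same
   definitions apply to R (with A = setT) and to the local rings of the
   surfaces birational to Spec R (with L the fraction field of R). *)
Section Subrings.
Variable L : comNzRingType.
Implicit Types (A I J P : set L) (s : seq L) (n d : nat).

Definition ideal_in A I : Prop :=
  [/\ I `<=` A, I 0, forall x y, I x -> I y -> I (x + y)
    & forall a x, A a -> I x -> I (a * x)].

Definition prime_in A P : Prop :=
  [/\ ideal_in A P, ~ P 1
    & forall x y, A x -> A y -> P (x * y) -> P x \/ P y].

Definition maxideal A : set L :=
  [set x | A x /\ ~ exists2 y, A y & x * y = 1].

Definition local_ring A : Prop := ideal_in A (maxideal A).

(* The ideal of A generated by the ideal I and the entries of s. *)
Definition ideal_span A I s : set L :=
  [set x | exists (y : L) (c : 'I_(size s) -> L),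
     [/\ I y, forall j, A (c j) & x = y + \sum_j c j * s`_j]].

Definition noetherian A : Prop :=
  forall J, ideal_in A J -> exists s, J = ideal_span A [set 0] s.

Definition ideal_mul I J : set L :=
  [set x | exists (n : nat) (a b : 'I_n -> L),
     [/\ forall j, I (a j), forall j, J (b j) & x = \sum_j a j * b j]].

Fixpoint ideal_pow A I n : set L :=
  if n is n'.+1 then ideal_mul I (ideal_pow A I n') else A.

(* P_0 < ... < P_n is a chain of primes of A / I, seen as primes of A. *)
Definition prime_chain A I n (P : 'I_n.+1 -> set L) : Prop :=
  (forall i, prime_in A (P i) /\ I `<=` P i) /\
  (forall i j : 'I_n.+1, (i < j)%N -> P i `<` P j).

Definition quotient_krull_dim A I d : Prop :=
  (exists P : 'I_d.+1 -> set L, prime_chain A I P) /\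
  (forall n (P : 'I_n.+1 -> set L), prime_chain A I P -> (n <= d)%N).

(* A is a Noetherian local ring and A / I is a regular local ring of
   dimension d: it has Krull dimension d and its maximal ideal is generated
   by d elements. *)
Definition regular_quotient A I d : Prop :=
  [/\ noetherian A, local_ring A, ideal_in A I, quotient_krull_dim A I d
    & exists s, size s = d /\ maxideal A = ideal_span A I s].

Definition regular_local A d : Prop := regular_quotient A [set 0] d.

(* Bijectivity of A -> lim A / m^n: surjectivity, then injectivity. *)
Definition adically_complete A : Prop :=
  (forall u : nat -> L, (forall n, A (u n)) ->
     (forall n, ideal_pow A (maxideal A) n (u n.+1 - u n)) ->
     exists2 x, A x & forall n, ideal_pow A (maxideal A) n (x - u n)) /\
  (forall x, (forall n, ideal_pow A (maxideal A) n x) -> x = 0).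

End Subrings.

Definition coefficient_field (K : fieldType) (R : comNzRingType)
    (iota : {rmorphism K -> R}) : Prop :=
  forall x : R, exists c : K, maxideal [set: R] (x - iota c).

Definition complete_regular_local_ring (K : fieldType) (R : comNzRingType)
    (iota : {rmorphism K -> R}) (d : nat) : Prop :=
  [/\ regular_local [set: R] d, adically_complete [set: R]
    & coefficient_field iota].

(* An integral separated scheme with function field F is determined by the
   set of its local rings, as subrings of F (Chevalley, Zariski); schemes are
   represented by such sets of subrings below.  A point y is a specialization
   of a point x iff the local ring of y is contained in that of x. *)
Section Models.
Variable F : fieldType.
Implicit Types (A P S T : set F) (X Y : set (set F)).

Definition localization A P : set F :=
  [set z | exists x y, [/\ A x, A y, ~ P y & z = x / y]].

Definition spec A : set (set F) :=
  [set T | exists2 P, prime_in A P & T = localization A P].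

Definition dominates S T : Prop :=
  T `<=` S /\ maxideal T `<=` maxideal S.

Definition closed_point X S : Prop :=
  X S /\ forall T, X T -> T `<=` S -> T = S.

(* The affine chart of the blow-up of Spec S at its closed point given by
   u in m_S: the degree-0 part of the localization at u, in degree 1, of the
   Rees algebra of m_S. *)
Definition blowup_chart S (u : F) : set F :=
  [set z | exists n x, ideal_pow S (maxideal S) n x /\ z = x / u ^+ n].

Definition blowup_local S : set (set F) :=
  [set T | exists u, [/\ maxideal S u, u != 0 & spec (blowup_chart S u) T]].

(* The blow-up of X at the closed point S: the points other than S are kept,
   and S is replaced with the points of the blow-up of Spec S lying over it. *)
Definition blowup X S : set (set F) :=
  [set T | (X T /\ T <> S) \/ (blowup_local S T /\ dominates T S)].

Definition model_dominates Y X : Prop :=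
  forall T, Y T -> exists2 S, X S & dominates T S.

End Models.

Section Modifications.
Variable R : idomainType.
Local Notation F := {fraction R}.
Implicit Types (X : set (set F)) (S T C : set F) (Q : R) (nu : F -> int).

Definition base_ring : set F := range (@tofrac R).

Inductive modification : set (set F) -> Prop :=
| modification_first :
    modification (blowup (spec base_ring) base_ring)
| modification_next X S :
    modification X -> closed_point X S -> dominates S base_ring ->
    modification (blowup X S).

Definition exceptional X : set (set F) :=
  [set T | X T /\ dominates T base_ring].

(* C is (the local ring at the generic point of) an irreducible component of
   the exceptional divisor of X. *)
Definition component X C : Prop :=
  exceptional X C /\ forall T, exceptional X T -> C `<=` T -> T = C.

(* nu restricts to R as the vanishing order along C, which is the order with
   respect to the powers of the maximal ideal of the local ring C. *)
Definition component_valuation C nu : Prop :=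
  forall f : R, f != 0 -> exists k : nat,
    [/\ nu (tofrac f) = k%:Z, ideal_pow C (maxideal C) k (tofrac f)
      & ~ ideal_pow C (maxideal C) k.+1 (tofrac f)].

(* The value of a valuation at 0 is +oo; here nu 0 is a junk value, never
   used.  Discrete valuations of rank 1 are normalized to have value group
   all of Z. *)
Definition discrete_valuation nu : Prop :=
  [/\ forall x y, x != 0 -> y != 0 -> nu (x * y) = nu x + nu y,
      forall x y, x != 0 -> y != 0 -> x + y != 0 ->
        Num.min (nu x) (nu y) <= nu (x + y)
    & forall k : int, exists2 x, x != 0 & nu x = k].

Definition valuation_ring nu : set F := [set x | x = 0 \/ 0 <= nu x].
Definition valuation_ideal nu : set F := [set x | x = 0 \/ 0 < nu x].

Definition centered nu : Prop :=
  base_ring `<=` valuation_ring nu /\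
  forall f : R, valuation_ideal nu (tofrac f) <-> maxideal [set: R] f.

(* The residue field of nu has a transcendence basis over K consisting of the
   residue of one element t: that residue is transcendental over K, and every
   residue is algebraic over the field it generates (a nonzero relation over
   K(t), after clearing denominators). *)
Definition residue_trdeg1 (K : fieldType) (iota : {rmorphism K -> R}) nu :
    Prop :=
  let ev (t : F) (p : {poly K}) : F :=
    (map_poly (fun c => tofrac (iota c)) p).[t] in
  exists t, [/\ valuation_ring nu t,
    forall p : {poly K}, p != 0 -> ~ valuation_ideal nu (ev t p)
  & forall s, valuation_ring nu s ->
      exists2 q : {poly {poly K}}, q != 0
        & valuation_ideal nu (map_poly (ev t) q).[s]].

Definition divisorial (K : fieldType) (iota : {rmorphism K -> R}) nu : Prop :=
  [/\ discrete_valuation nu, centered nu & residue_trdeg1 iota nu].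

Definition pairwise_distinct r (nu : 'I_r -> F -> int) : Prop :=
  forall i j, i != j -> exists2 x, x != 0 & nu i x <> nu j x.

Definition resolution r (nu : 'I_r -> F -> int) X : Prop :=
  modification X /\
  forall i, exists2 C, component X C & component_valuation C (nu i).

Definition minimal_resolution r (nu : 'I_r -> F -> int) X : Prop :=
  resolution nu X /\ forall Y, resolution nu Y -> model_dominates Y X.

Definition irreducible_elt Q : Prop :=
  [/\ Q != 0, Q \isn't a GRing.unit
    & forall a b, Q = a * b -> a \is a GRing.unit \/ b \is a GRing.unit].

(* The local ring R_(Q): the generic point of the curve Q = 0, hence also of
   its strict transform on any modification. *)
Definition curve_generic_point Q : set F :=
  localization base_ring [set x | exists h, x = tofrac (Q * h)].

Definition strict_transform X Q : set (set F) :=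
  [set T | X T /\ T `<=` curve_generic_point Q].

(* The ideal, in the local ring T, of the integral curve with generic point
   C. *)
Definition curve_ideal C T : set F := T `&` maxideal C.

(* The ideal in T of the reduced exceptional divisor. *)
Definition exceptional_ideal X T : set F :=
  [set x | T x /\ forall C, component X C -> T `<=` C -> maxideal C x].

Definition curve_smooth X Q : Prop :=
  forall T, strict_transform X Q T -> closed_point X T ->
    regular_quotient T (curve_ideal (curve_generic_point Q) T) 1.

(* T is a closed point of the strict transform and of the component C, it is
   a nonsingular point of the reduced divisor E, and the two curves are
   transverse there: their ideals generate the maximal ideal of T. *)
Definition transverse_at X Q C T : Prop :=
  [/\ strict_transform X Q T, closed_point X T, T `<=` C,
      regular_quotient T (exceptional_ideal X T) 1
    & maxideal T = [set z | exists x y,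
        [/\ curve_ideal (curve_generic_point Q) T x, curve_ideal C T y
          & z = x + y]]].

Definition curvette X C Q : Prop :=
  [/\ maxideal [set: R] Q, irreducible_elt Q, curve_smooth X Q
    & exists T, transverse_at X Q C T].

Section Values.
Variables (r : nat) (nu : 'I_r -> F -> int).

Definition value (h : R) : 'rV[int]_r := \row_i nu i (tofrac h).

Definition value_semigroup : set 'rV[int]_r :=
  [set m | exists2 h, h != 0 & m = value h].

Definition valuation_filtration (m : 'rV[int]_r) : set R :=
  [set g | g = 0 \/ forall i, m 0 i <= value g 0 i].

End Values.

(* dim_K (U / W) = d, for K-subspaces W of U of R: U / W has a basis of d
   elements. *)
Definition quotient_dim (K : fieldType) (iota : {rmorphism K -> R})
    (U W : set R) (d : nat) : Prop :=
  exists b : 'I_d -> R, (forall j, U (b j)) /\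
    forall g, U g ->
      exists! c : 'rV[K]_d, W (g - \sum_j iota (c 0 j) * b j).

(* d_i(m) = d, for d_i(m) = dim_K J(m) / J(m + e_i). *)
Definition graded_dim (K : fieldType) (iota : {rmorphism K -> R}) r
    (nu : 'I_r -> F -> int) (i : 'I_r) (m : 'rV[int]_r) (d : nat) : Prop :=
  quotient_dim iota (valuation_filtration nu m)
    (valuation_filtration nu (m + delta_mx 0 i)) d.

End Modifications.

(* Main.v *)
Require Import Defs.
From mathcomp Require Import all_boot all_order all_algebra.
From mathcomp Require Import mathcomp_extra boolp classical_sets.
From mathcomp Require Import zify ring.

Set Implicit Arguments.
Unset Strict Implicit.
Unset Printing Implicit Defensive.

Import Order.TTheory GRing.Theory Num.Theory.
Local Open Scope classical_set_scope.
Local Open Scope ring_scope.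

(** By induction on the blow-ups, every component of E has an affine chart in
   which it is the line x = 0 with coordinate t.  If f has value at least m_i
   along E_i, then f = x^(m_i) a and the restriction of a to E_i is a
   polynomial p_i(f) in t; the class of f in D_i(m) is determined by p_i(f),
   and the strict transform of f = 0 meets E_i where p_i(f) vanishes.

   For an irreducible q whose strict transform meets E_i at a general point
   with multiplicity b, computing the intersection number (q, Q_j) once at
   that point and once on E_j gives nu_j(q) = b nu_i(Q_j) = b nu_j(Q_i).
   Hence an element of value m whose strict transform passes through k general
   points of E_i is divisible by k such curves, so that m - k B^i is a value.

   - If m = nu(h) + k B^i, multiplying h by curves through all but one of k + 1
     general points of E_i gives k + 1 independent classes in D_i(m).
   - If D_i(m) contains k + 1 independent classes, some combination of
     representatives has value m and passes through k general points of E_i,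
     so that m - k B^i is a value.
   - If m - B^i and m - B^j are values, then so is m - B^i - B^j: a combination
     of elements of value m passes through general points of both E_i and E_j.

   By the first two points d_i(m) - 1 is the largest k with m - k B^i in S_V;
   by the third these multiples can be subtracted for all i independently. *)

(** * Dimensions of quotients *)

(** Schemes are sets of local rings inside the fraction field, so every geometric step is a
    statement about elements of these rings. The intersection number of q and f is the colength of
    (q, f) in R, which involves no modification. If q is irreducible and its strict transform has
    ideal I at a point T, completeness of R makes T / I a finite module over R / (q) inside its
    fraction field. The same number is therefore the colength of f in T / I, where the equation x of
    E splits off. Comparing two separated points in this way shows that an irreducible curve meets E
    in one point only, which is why elements are split into irreducible factors before they are
    measured. The delicate step is to subtract B^i and B^j together. Passing through general points
    of both E_i and E_j needs a pencil that is not constant along E_j, whereas pencils of curves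
    through E_i are constant there; so elements built from curves through E_j have to be mixed in.
    Distinctness of the valuations is what keeps general points of two components from lying on a
    common irreducible curve. *)

Section QuotientDim.
Variables (K : fieldType) (L : comNzRingType) (k : {rmorphism K -> L}).
Implicit Types U V W : set L.

Definition subsp U : Prop :=
  [/\ U 0, forall x y, U x -> U y -> U (x + y) & forall c x, U x -> U (k c * x)].

Definition comb n (b : 'I_n -> L) (c : 'rV[K]_n) : L := \sum_j k (c 0 j) * b j.
Definition lind W n (b : 'I_n -> L) : Prop := forall c, W (comb b c) -> c = 0.
Definition spans U W n (b : 'I_n -> L) : Prop :=
  forall g, U g -> exists c, W (g - comb b c).
(** Independence and generation are kept apart so that exchange arguments apply; [quotient_dimE]
    matches this with the unique coordinates of [quotient_dim]. *)
Definition qdim U W n : Prop :=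
  exists b : 'I_n -> L, [/\ forall j, U (b j), lind W b & spans U W b].

Lemma subspN U x : subsp U -> U x -> U (- x).
Proof. by case=> _ _ UZ Ux; have := UZ (-1) x Ux; rewrite rmorphN1 mulN1r. Qed.

Lemma subspB U x y : subsp U -> U x -> U y -> U (x - y).
Proof. by move=> sU Ux Uy; case: (sU) => _ UD _; apply: UD => //; exact: subspN. Qed.

Lemma subsp_sum U (I : finType) (f : I -> L) :
  subsp U -> (forall i, U (f i)) -> U (\sum_i f i).
Proof. by case=> U0 UD _ Uf; apply: big_ind => // i _; apply: Uf. Qed.

Lemma subsp_comb U n (b : 'I_n -> L) c :
  subsp U -> (forall j, U (b j)) -> U (comb b c).
Proof. by move=> sU Ub; apply: subsp_sum => // j; case: sU => _ _; apply. Qed.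

Lemma combD n (b : 'I_n -> L) c d : comb b (c + d) = comb b c + comb b d.
Proof. by rewrite -big_split; apply: eq_bigr => j _; rewrite mxE rmorphD mulrDl. Qed.

Lemma combZ n (b : 'I_n -> L) a c : comb b (a *: c) = k a * comb b c.
Proof. by rewrite mulr_sumr; apply: eq_bigr => j _; rewrite mxE rmorphM mulrA. Qed.

Lemma combN n (b : 'I_n -> L) c : comb b (- c) = - comb b c.
Proof. by rewrite -scaleN1r combZ rmorphN1 mulN1r. Qed.

Lemma comb0 n (b : 'I_n -> L) : comb b 0 = 0.
Proof. by rewrite /comb big1 // => j _; rewrite mxE rmorph0 mul0r. Qed.

(** With more independent vectors than generators, the coordinate matrix has a nonzero vector in its
    left kernel, and this vector is a relation modulo [W]. *)
Lemma steinitz U W n m (b : 'I_n -> L) (e : 'I_m -> L) : subsp W ->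
  (forall j, U (b j)) -> lind W b -> spans U W e -> (n <= m)%N.
Proof.
move=> sW Ub bfree espan; case: leqP => // m_lt_n.
have [c cP] := choice (fun i => espan _ (Ub i)).
pose M : 'M[K]_(n, m) := \matrix_(i, j) c i 0 j.
have /rowV0Pn[v /sub_kermxP vM v0] : kermx M != 0.
  by rewrite -mxrank_eq0 mxrank_ker -lt0n subn_gt0 (leq_ltn_trans (rank_leq_col _)).
suff /bfree v_eq0 : W (comb b v) by rewrite v_eq0 eqxx in v0.
have -> : comb b v = \sum_i k (v 0 i) * (b i - comb e (c i)).
  rewrite (eq_bigr (fun i => k (v 0 i) * b i - k (v 0 i) * comb e (c i))); last first.
    by move=> i _; rewrite mulrBr.
  rewrite sumrB -[LHS]subr0; congr (_ - _).
  transitivity (comb e (v *m M)); first by rewrite vM comb0.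
  rewrite /comb; under [RHS]eq_bigr do rewrite mulr_sumr.
  rewrite exchange_big; apply: eq_bigr => j _.
  rewrite mxE rmorph_sum mulr_suml; apply: eq_bigr => i _.
  by rewrite mxE rmorphM mulrA.
by apply: subsp_sum => // i; case: sW => _ _; apply.
Qed.

Definition fcons n (g : L) (b : 'I_n -> L) (i : 'I_n.+1) : L :=
  if unlift ord0 i is Some j then b j else g.

Lemma comb_fcons n g (b : 'I_n -> L) c :
  comb (fcons g b) c = k (c 0 ord0) * g + comb b (\row_j c 0 (lift ord0 j)).
Proof.
rewrite /comb big_ord_recl /fcons unlift_none; congr (_ + _).
by apply: eq_bigr => j _; rewrite liftK mxE.
Qed.

Lemma lind_fcons W n g (b : 'I_n -> L) : subsp W -> lind W b ->
  (~ exists c, W (g - comb b c)) -> lind W (fcons g b).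
Proof.
move=> sW bfree gW c; rewrite comb_fcons; set d := \row_j _ => Wc.
have [c0|c0] := eqVneq (c 0 ord0) 0.
  move: Wc; rewrite c0 rmorph0 mul0r add0r => /bfree/rowP d0.
  apply/rowP => i; rewrite mxE; case: (unliftP ord0 i) => [j|] -> //.
  by have := d0 j; rewrite !mxE.
case: gW; exists (- ((c 0 ord0)^-1 *: d)).
rewrite combN combZ opprK.
have -> : g + k (c 0 ord0)^-1 * comb b d =
    k (c 0 ord0)^-1 * (k (c 0 ord0) * g + comb b d).
  by rewrite mulrDr mulrA -rmorphM mulVf // rmorph1 mul1r.
by case: sW => _ _; apply.
Qed.

(** A longest independent family generates, since otherwise [fcons] would lengthen it. Finiteness of
    a dimension thus follows from a bound alone. *)
Lemma qdim_bounded U W N : subsp W ->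
  (forall n (b : 'I_n -> L), (forall j, U (b j)) -> lind W b -> (n <= N)%N) ->
  exists2 n, (n <= N)%N & qdim U W n.
Proof.
move=> sW bnd.
pose P n := `[< exists b : 'I_n -> L, (forall j, U (b j)) /\ lind W b >].
have exP : exists n, P n.
  exists 0; apply/asboolP; exists (fun=> 0); split; first by case.
  by move=> c _; apply/rowP; case.
have Pbnd n : P n -> (n <= N)%N by case/asboolP => b [? ?]; apply: (bnd n b).
case: (ex_maxnP exP Pbnd) => n Pn nmax.
exists n; first exact: Pbnd.
have /asboolP[b [Ub bfree]] := Pn; exists b; split=> // g Ug.
apply: contrapT => gW; suff /nmax : P n.+1 by rewrite ltnn.
apply/asboolP; exists (fcons g b); split; last exact: lind_fcons.
by move=> j; rewrite /fcons; case: unliftP.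
Qed.

Lemma qdim_spans U W m (e : 'I_m -> L) : subsp W -> spans U W e ->
  exists n, qdim U W n.
Proof.
move=> sW espan; have [|n _ ?] := @qdim_bounded U W m sW; last by exists n.
by move=> n b Ub bfree; apply: (steinitz sW Ub bfree espan).
Qed.

Lemma qdim_uniq U W n m : subsp W -> qdim U W n -> qdim U W m -> n = m.
Proof.
move=> sW [b [Ub bfree bspan]] [e [Ue efree espan]].
by apply/eqP; rewrite eqn_leq (steinitz sW Ub bfree espan) (steinitz sW Ue efree bspan).
Qed.

Lemma qdim0 U W : subsp W -> qdim U W 0 <-> U `<=` W.
Proof.
move=> sW; split=> [[b [_ _ bspan]] g /bspan[c]|UW].
  by rewrite /comb big_ord0 subr0.
exists (fun=> 0); split; first by case.
  by move=> c _; apply/rowP; case.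
by move=> g /UW Wg; exists 0; rewrite comb0 subr0.
Qed.

Lemma qdim_add U V W n m : subsp W -> subsp V -> subsp U -> W `<=` V -> V `<=` U ->
  qdim U V n -> qdim V W m -> qdim U W (n + m).
Proof.
move=> sW sV sU WV VU [b [Ub bfree bspan]] [e [Ve efree espan]].
pose f (i : 'I_(n + m)) := match split i with inl j => b j | inr j => e j end.
have fE (c : 'rV_n) (d : 'rV_m) : comb f (row_mx c d) = comb b c + comb e d.
  rewrite /comb big_split_ord; congr (_ + _); apply: eq_bigr => j _.
    by rewrite row_mxEl /f (unsplitK (inl j)).
  by rewrite row_mxEr /f (unsplitK (inr j)).
exists f; split.
- by move=> j; rewrite /f; case: split => i //; exact: (VU _ (Ve i)).
- move=> c; rewrite -[c]hsubmxK fE => Wc.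
  have c0 : lsubmx c = 0.
    apply: bfree; rewrite -[comb b _](addrK (comb e (rsubmx c))).
    by apply: subspB => //; [exact: WV | exact: subsp_comb].
  move: Wc; rewrite c0 comb0 add0r => /efree ->; exact: row_mx0.
- move=> g /bspan[c /espan[d Wd]]; exists (row_mx c d).
  by rewrite fE opprD addrA.
Qed.

Lemma qdim_sub U V W n : subsp W -> V `<=` U -> qdim U W n -> exists m, qdim V W m.
Proof.
move=> sW VU [e [_ _ espan]]; have [|m _ ?] := @qdim_bounded V W n sW; last by exists m.
by move=> m b Vb bfree; apply: (steinitz sW _ bfree espan) => j; exact: (VU _ (Vb j)).
Qed.

Lemma qdim_quo U V W n : subsp V -> W `<=` V -> qdim U W n -> exists m, qdim U V m.
Proof.
move=> sV WV [e [_ _ espan]]; apply: (qdim_spans (e := e)) => // g /espan[c Wc].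
by exists c; apply: WV.
Qed.

End QuotientDim.

Section QuotientDimTransport.
Variables (K : fieldType) (L L' : comNzRingType).
Variables (k : {rmorphism K -> L}) (k' : {rmorphism K -> L'}).
Variables (phi : L -> L').
Hypothesis phiD : forall x y, phi (x + y) = phi x + phi y.
Hypothesis phiZ : forall c x, phi (k c * x) = k' c * phi x.
Variables (U W : set L) (U' W' : set L').
Hypothesis UU' : forall u, U u -> U' (phi u).

Let phi0 : phi 0 = 0.
Proof. by apply: (addrI (phi 0)); rewrite -phiD !addr0. Qed.

Let phi_comb n (b : 'I_n -> L) c : phi (comb k b c) = comb k' (phi \o b) c.
Proof.
apply: (big_ind2 (fun x y => phi x = y)) => [|x1 x2 y1 y2 <- <-|j _].
- exact: phi0.
- exact: phiD.
- exact: phiZ.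
Qed.

Let phiN x : phi (- x) = - phi x.
Proof. by have := phiZ (-1) x; rewrite !rmorphN1 !mulN1r. Qed.

Lemma qdim_embed n : subsp k U -> subsp k W -> subsp k' W' ->
  (forall u, U u -> W' (phi u) -> W u) -> qdim k' U' W' n -> exists m, qdim k U W m.
Proof.
move=> sU sW sW' inj [e [_ _ espan]].
have [|m _ ?] := @qdim_bounded _ _ k U W n sW; last by exists m.
move=> m b Ub bfree; apply: (steinitz (U := U') (b := phi \o b)) espan => //.
  by move=> j; apply: UU'.
move=> c; rewrite -phi_comb => /inj Wc; apply: bfree; apply: Wc; exact: subsp_comb.
Qed.

(** [phi] itself may be neither injective nor surjective: only the induced map of quotients is
    bijective. *)
Lemma qdim_iso n : subsp k U -> subsp k' W' ->
  (forall u, U u -> W' (phi u) <-> W u) ->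
  (forall v, U' v -> exists2 u, U u & W' (v - phi u)) ->
  qdim k U W n -> qdim k' U' W' n.
Proof.
move=> sU sW' WW' surj [b [Ub bfree bspan]]; exists (phi \o b); split.
- by move=> j; apply: UU'.
- by move=> c; rewrite -phi_comb => /WW' Wc; apply/bfree/Wc; exact: subsp_comb.
- move=> v /surj[u Uu Wvu]; have [c Wc] := bspan u Uu; exists c.
  rewrite -phi_comb; have -> : v - phi (comb k b c) = (v - phi u) + phi (u - comb k b c).
    by rewrite phiD phiN addrA subrK.
  have Uuc : U (u - comb k b c) by apply: (subspB sU Uu); exact: subsp_comb.
  by case: (sW') => _ W'D _; apply: W'D => //; apply/(WW' _ Uuc).
Qed.

End QuotientDimTransport.

(** * The base ring *)

Lemma spans_fin (K : fieldType) (L : comNzRingType) (k : {rmorphism K -> L})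
    (U W : set L) (T : finType) (g : T -> L) :
  (forall z, U z -> exists c : T -> K, W (z - \sum_t k (c t) * g t)) ->
  spans k U W (fun i : 'I_#|T| => g (enum_val i)).
Proof.
move=> gspan z /gspan[c Wc]; exists (\row_j c (enum_val j)).
rewrite /comb; under eq_bigr do rewrite mxE.
by rewrite -(big_enum_val (fun t => k (c t) * g t)).
Qed.

Lemma proper_witness (T : Type) (A B : set T) : A `<` B -> exists z, B z /\ ~ A z.
Proof.
move=> [_ nBA]; apply: contrapT => nex; apply: nBA => z Bz.
by apply: contrapT => Az; apply: nex; exists z.
Qed.

Section IdealPowers.
Variable L : comNzRingType.
Implicit Types (A I J : set L).

Lemma ideal_mulr I J a b : I a -> J b -> ideal_mul I J (a * b).
Proof.
by move=> Ia Jb; exists 1, (fun=> a), (fun=> b); split=> //; rewrite big_ord1.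
Qed.

Lemma ideal_mulD I J x y :
  ideal_mul I J x -> ideal_mul I J y -> ideal_mul I J (x + y).
Proof.
move=> [n [a [b [Ia Jb ->]]]] [m [c [d [Ic Jd ->]]]].
pose f T (u : 'I_n -> T) (v : 'I_m -> T) (i : 'I_(n + m)) :=
  match split i with inl j => u j | inr j => v j end.
exists (n + m)%N, (f _ a c), (f _ b d); split.
- by move=> j; rewrite /f; case: split.
- by move=> j; rewrite /f; case: split.
- rewrite big_split_ord /=; congr (_ + _); apply: eq_bigr => j _.
    by rewrite /f (unsplitK (inl j)).
  by rewrite /f (unsplitK (inr j)).
Qed.

Lemma ideal_powX A I n a r : I a -> A r -> ideal_pow A I n (a ^+ n * r).
Proof.
move=> Ia Ar; elim: n => [|n IHn]; first by rewrite expr0 mul1r.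
by rewrite exprS -mulrA; exact: ideal_mulr.
Qed.

Lemma ideal_pow_ind A I (P : nat -> set L) :
  A `<=` P 0 -> (forall n, P n 0) ->
  (forall n x y, P n x -> P n y -> P n (x + y)) ->
  (forall n a b, I a -> P n b -> P n.+1 (a * b)) ->
  forall n, ideal_pow A I n `<=` P n.
Proof.
move=> AP P0 PD PM; elim=> [//|n IHn] x [m [a [b [Ia Jb ->]]]].
by apply: big_ind => [||j _]; [exact: P0 | exact: PD | exact: PM (Ia j) (IHn _ (Jb j))].
Qed.

Lemma ideal_powD A I n x y : ideal_in A A ->
  ideal_pow A I n x -> ideal_pow A I n y -> ideal_pow A I n (x + y).
Proof. by case: n => [[_ _ AD _]|n _]; [exact: AD | exact: ideal_mulD]. Qed.

Lemma ideal_powM A I n r x : ideal_in A A -> ideal_in A I -> A r ->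
  ideal_pow A I n x -> ideal_pow A I n (r * x).
Proof.
case: n => [[_ _ _ AM] _ Ar|n _ [_ _ _ IM] Ar [m [a [b [Ia Jb ->]]]]].
  exact: AM.
exists m, (fun j => r * a j), b; split=> //; first by move=> j; exact: IM.
by rewrite mulr_sumr; apply: eq_bigr => j _; rewrite mulrA.
Qed.

End IdealPowers.

Section RegularLocalRing.
Variables (K : fieldType) (R : idomainType) (iota : {rmorphism K -> R}).
Hypothesis HR : complete_regular_local_ring iota 2.
Local Notation mR := (maxideal [set: R]).
Implicit Types (f g q z : R) (I J : set R).

Lemma mRE f : mR f <-> f \isn't a GRing.unit.
Proof.
split=> [[_ nU]|/negP nU]; last first.
  by split=> // -[y _ fy]; apply: nU; apply/unitrPr; exists y.
by apply/negP => /unitrPr[y fy]; apply: nU; exists y.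
Qed.

Definition ideal I : Prop :=
  [/\ I 0, forall x y, I x -> I y -> I (x + y) & forall a x, I x -> I (a * x)].

Let full_ideal : ideal_in [set: R] [set: R].
Proof. by split. Qed.

Let mR_ideal_in : ideal_in [set: R] mR.
Proof. by case: HR => -[]. Qed.

Lemma mR_ideal : ideal mR.
Proof. by case: mR_ideal_in => _ ? ? mM; split=> // a x; apply: mM. Qed.

Lemma mR1 : ~ mR 1.
Proof. by move/mRE; rewrite unitr1. Qed.

Lemma mR_gen : exists x y, forall f, mR f <-> exists a b, f = a * x + b * y.
Proof.
case: HR => -[_ _ _ _ [s [s2 mE]]] _ _.
exists s`_0, s`_1 => f; rewrite mE; split.
  move=> [y [c [-> _ ->]]]; rewrite add0r.
  have c2 : exists c' : nat -> R, forall j : 'I_(size s), c j = c' j.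
    exists (fun n => if insub n is Some i then c i else 0) => j.
    by rewrite valK.
  have [c' c'E] := c2; exists (c' 0), (c' 1).
  under eq_bigr do rewrite c'E.
  by rewrite -(big_mkord xpredT (fun j => c' j * s`_j)) s2 big_ltn // big_nat1.
move=> [a [b ->]]; exists 0, (fun j => if (j : nat) == 0 then a else b); split=> //.
rewrite add0r -(big_mkord xpredT (fun j => (if j == 0 then a else b) * s`_j)).
by rewrite s2 big_ltn // big_nat1.
Qed.

Lemma residue_field f : exists c, mR (f - iota c).
Proof. by case: HR => _ _; apply. Qed.

Lemma adic_limit (u : nat -> R) : (forall n, ideal_pow [set: R] mR n (u n.+1 - u n)) ->
  exists l, forall n, ideal_pow [set: R] mR n (l - u n).
Proof. by move=> uP; case: HR => _ [/(_ u (fun=> I) uP)[l _ lP] _] _; exists l. Qed.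

Lemma adic_sep f : (forall n, ideal_pow [set: R] mR n f) -> f = 0.
Proof. by case: HR => _ [_ sep] _; exact: sep. Qed.

Lemma mRpowD n f g : ideal_pow [set: R] mR n f -> ideal_pow [set: R] mR n g ->
  ideal_pow [set: R] mR n (f + g).
Proof. exact: ideal_powD. Qed.

Lemma mRpowM n f g : ideal_pow [set: R] mR n g -> ideal_pow [set: R] mR n (f * g).
Proof. exact: ideal_powM. Qed.

Lemma mRpowX n f g : mR f -> ideal_pow [set: R] mR n (f ^+ n * g).
Proof. by move=> mf; exact: ideal_powX. Qed.

Variables x y : R.
Hypothesis xyP : forall f, mR f <-> exists a b, f = a * x + b * y.

Let mx : mR x. Proof. by apply/xyP; exists 1, 0; rewrite mul1r mul0r addr0. Qed.
Let my : mR y. Proof. by apply/xyP; exists 0, 1; rewrite mul1r mul0r add0r. Qed.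

Lemma unit1B f : mR f -> 1 - f \is a GRing.unit.
Proof.
move=> mf; apply: contrapT => /negP /mRE m1f; apply: mR1.
by rewrite -(subrK f 1); case: mR_ideal => _ mD _; exact: mD.
Qed.

Lemma idealN I f : ideal I -> I f -> I (- f).
Proof. by case=> _ _ IM If; have := IM (-1) f If; rewrite mulN1r. Qed.

Lemma idealB I f g : ideal I -> I f -> I g -> I (f - g).
Proof. by move=> iI If Ig; case: (iI) => _ ID _; apply: ID => //; exact: idealN. Qed.

(* Krull's intersection theorem in R / xR, by the usual ascending chain
   generated by the cofactors of the powers of y. *)
Lemma sep_mod_x f : (forall n, exists a b, f = a * x + b * y ^+ n) ->
  exists a, f = a * x.
Proof.
move=> fP; have [a aP] := choice fP; have {aP}[b abP] := choice aP.
pose Jn n := [set z | exists c : nat -> R, z = \sum_(0 <= k < n) c k * b k].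
have Jn_mono n m : (n <= m)%N -> Jn n `<=` Jn m.
  move=> nm z [c ->]; exists (fun k => if (k < n)%N then c k else 0).
  rewrite [RHS](big_cat_nat (n := n)) //= [X in _ + X]big_nat_cond.
  rewrite [X in _ + X]big1 ?addr0 => [|i /andP[/andP[ni _] _]]; last first.
    by rewrite ltnNge ni mul0r.
  by apply: eq_big_nat => i /andP[_ ->].
have JnD n z z' : Jn n z -> Jn n z' -> Jn n (z + z').
  move=> [c ->] [c' ->]; exists (fun k => c k + c' k).
  by rewrite -big_split /=; apply: eq_bigr => i _; rewrite mulrDl.
have JnM n r z : Jn n z -> Jn n (r * z).
  move=> [c ->]; exists (fun k => r * c k); rewrite mulr_sumr.
  by apply: eq_bigr => i _; rewrite mulrA.
have Jn0 n : Jn n 0.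
  by exists (fun=> 0); rewrite big1 // => i _; rewrite mul0r.
pose J := [set z | exists n, Jn n z].
have Jb n : Jn n.+1 (b n).
  exists (fun k => (k == n)%:R); rewrite big_nat_recr //= eqxx mul1r.
  rewrite big_nat_cond big1 ?add0r // => i /andP[/andP[_ /ltn_eqF ->] _].
  by rewrite mul0r.
have [s sE] : exists s, J = ideal_span [set: R] [set 0] s.
  case: HR => -[noeth _ _ _ _] _ _; apply: noeth; split=> //.
  - by exists 0; exact: Jn0.
  - move=> z z' [n Jz] [n' Jz']; exists (maxn n n').
    by apply: JnD; [apply: Jn_mono Jz|apply: Jn_mono Jz']; rewrite ?leq_maxl ?leq_maxr.
  - by move=> r z _ [n Jz]; exists n; exact: JnM.
have sJ (j : 'I_(size s)) : exists n, Jn n s`_j.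
  suff : J s`_j by [].
  rewrite sE; exists 0, (fun i => (i == j)%:R); split=> //.
  rewrite add0r (bigD1 j) //= eqxx mul1r big1 ?addr0 // => i /negPf ->.
  by rewrite mul0r.
have [n nP] := choice sJ; pose N := \max_j n j.
(* The ascending chain stops at [N], so b_N is a combination of the earlier cofactors. *)
have [c bN] : Jn N (b N).
  have : J (b N) by exists N.+1.
  rewrite sE => -[z [c [-> _ ->]]]; rewrite add0r; apply: big_ind => //.
  - exact: JnD.
  - by move=> j _; apply: JnM; apply: Jn_mono (nP j); exact: leq_bigmax.
pose r := \sum_(0 <= k < N) c k * y ^+ (N - k).-1.
pose r' := \sum_(0 <= k < N) c k * a k * y ^+ (N - k).
(* Each b_k y^k equals f - a_k x, so inserting the relation for b_N makes (1 - y r) f a multiple of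
   x. *)
have key : f = a N * x + y * r * f - r' * x.
  rewrite {1}(abP N) bN -addrA; congr (_ + _).
  rewrite mulr_suml /r /r' mulr_sumr !mulr_suml -sumrB big_nat [RHS]big_nat.
  apply: eq_bigr => k /= kN.
  have -> : y ^+ N = y * y ^+ (N - k).-1 * y ^+ k by rewrite -exprS -exprD; congr (_ ^+ _);
    lia.
  have -> : y ^+ (N - k) = y * y ^+ (N - k).-1 by rewrite -exprS; congr (_ ^+ _); lia.
  by rewrite (abP k) -/(y ^+ _); ring.
have ur : 1 - y * r \is a GRing.unit.
  by apply: unit1B; rewrite mulrC; case: mR_ideal => _ _; apply.
exists ((1 - y * r)^-1 * (a N - r')); apply: (mulrI ur).
rewrite mulrA mulrA mulrV // mul1r.
rewrite mulrBl mul1r {1}key; ring.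
Qed.

(** The exponent is the last n for which f lies in (x, y^n). There the coefficient of y^n is a unit,
    since a coefficient in the maximal ideal would put f into (x, y^(n+1)). *)
Lemma mod_x_cases f :
  (exists a, f = a * x) \/
  exists n a b, b \is a GRing.unit /\ f = a * x + b * y ^+ n.
Proof.
have [fx|fx] := pselect (exists a, f = a * x); first by left.
right; have exn : exists n, `[< ~ exists a b, f = a * x + b * y ^+ n >].
  apply: contrapT => nex; apply: fx; apply: sep_mod_x => n.
  apply: contrapT => nab; apply: nex; exists n; exact/asboolP.
have [[|n] /asboolP nP nmin] := ex_minnP exn.
  by case: nP; exists 0, f; rewrite mul0r add0r mulr1.
have [a [b fE]] : exists a b, f = a * x + b * y ^+ n.
  by apply: contrapT => /asboolP/nmin; rewrite ltnn.
exists n, a, b; split=> //; apply: contrapT => /negP/mRE/xyP[c [d bE]].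
apply: nP; exists (a + c * y ^+ n), d; rewrite fE bE exprS; ring.
Qed.

Lemma xpow_sep f : (forall n, exists a, f = x ^+ n * a) -> f = 0.
Proof. by move=> fP; apply: adic_sep => n; have [a ->] := fP n; exact: mRpowX. Qed.

(* An ideal saturated with respect to x is generated by any element of least
   order in the discrete valuation ring R / xR: completeness sums the
   successive remainders. *)
Lemma saturated_principal I : ideal I -> (forall z, I (x * z) -> I z) ->
  exists2 f, I f & forall z, I z -> exists r, z = r * f.
Proof.
move=> iI Isat; have [I0 ID IM] := iI.
(* If x divides all of [I], saturation gives I = xI, and separatedness leaves only 0. *)
have [Ix|] := pselect (forall z, I z -> exists a, z = a * x).
  exists 0 => // z Iz; exists 0; rewrite mul0r; apply: xpow_sep => n.
  suff [a [_ ->]] : exists a, I a /\ z = x ^+ n * a by exists a.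
  elim: n => [|n [a [Ia ->]]]; first by exists z; rewrite mul1r.
  have [b ab] := Ix a Ia; exists b; split; last by rewrite ab exprSr; ring.
  by apply: Isat; rewrite mulrC -ab.
move=> nIx.
pose P n := `[< exists a b, b \is a GRing.unit /\ I (a * x + b * y ^+ n) >].
have exP : exists n, P n.
  apply: contrapT => nP; apply: nIx => z Iz.
  have [//|[n [a [b [ub zE]]]]] := mod_x_cases z.
  by case: nP; exists n; apply/asboolP; exists a, b; rewrite -zE.
have [n /asboolP[a [b [ub If]]] nmin] := ex_minnP exP.
set f := a * x + _ in If; exists f => //.
(* As [n] is the least order in [I], a multiple of [f] cancels z modulo x, and saturation puts the
   remaining cofactor of x into [I]. *)
have step z : exists rw, I z -> z = rw.1 * f + x * rw.2 /\ I rw.2.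
  have [Iz|] := pselect (I z); last by exists (0, 0).
  suff [r [w zE]] : exists r w, z = r * f + x * w.
    exists (r, w) => _; split=> //; apply: Isat.
    by rewrite -[x * w](addKr (r * f)) -zE addrC; apply: idealB => //; exact: IM.
  have [[c ->]|[k [c [d [ud zE]]]]] := mod_x_cases z.
    by exists 0, c; ring.
  have nk : (n <= k)%N by apply: nmin; apply/asboolP; exists c, d; rewrite -zE.
  exists (d * b^-1 * y ^+ (k - n)), (c - d * b^-1 * y ^+ (k - n) * a).
  have yk : y ^+ k = y ^+ (k - n) * y ^+ n by rewrite -exprD subnK.
  have bb : b^-1 * b = 1 by rewrite mulVr.
  rewrite zE /f yk mulrDr.
  rewrite [_ * (b * _)](_ : _ = (b^-1 * b) * (d * (y ^+ (k - n) * y ^+ n))); last by ring.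
  by rewrite bb; ring.
have [rw rwP] := choice step; move=> z Iz.
pose w n := iter n (fun z => (rw z).2) z.
pose r n := (rw (w n)).1.
have Iw m : I (w m) by elim: m => [//|m Im]; case: (rwP _ Im).
pose u m := \sum_(0 <= k < m) r k * x ^+ k.
have zE m : z = u m * f + x ^+ m * w m.
  elim: m => [|m IHm]; first by rewrite /u big_geq // mul0r add0r mul1r.
  have [wE _] := rwP _ (Iw m).
  by rewrite {1}IHm {1}wE /u big_nat_recr //= -/(r m) exprS; ring.
have [l lP] : exists l, forall m, ideal_pow [set: R] mR m (l - u m).
  apply: adic_limit => m; rewrite /u big_nat_recr //= addrAC subrr add0r mulrC.
  exact: mRpowX.
exists l; apply/eqP; rewrite -subr_eq0; apply/eqP; apply: adic_sep => m.
have -> : z - l * f = x ^+ m * w m + (- f) * (l - u m) by rewrite {1}(zE m); ring.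
by apply: mRpowD; [exact: mRpowX | exact: mRpowM].
Qed.

Lemma ideal_in_ideal I : ideal_in [set: R] I -> ideal I.
Proof. by case=> _ I0 ID IM; split=> // a z; exact: IM. Qed.

Lemma proper_sub_mR I : ideal I -> ~ I 1 -> I `<=` mR.
Proof.
move=> [_ _ IM] I1 z Iz; apply/mRE/negP => uz; apply: I1.
by rewrite -(mulVr uz); exact: IM.
Qed.

(* Krull's principal ideal theorem for x: a nonzero nonmaximal prime is
   principal, and a power of its generator would be divisible by x. *)
Lemma ypow_notin_x N : ~ exists a, y ^+ N = a * x.
Proof.
move=> [a yN]; case: HR => -[_ _ _ [[P [Pprime Plt]] _] _] _ _.
have [[/ideal_in_ideal iP1 P11 P1M] _] := Pprime (inord 1).
have [[/ideal_in_ideal iP2 P21 _] _] := Pprime (inord 2).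
have [z [P1z z0]] : exists z, P (inord 1) z /\ z != 0.
  have [/ideal_in_ideal[P00 _ _] _ _] := (Pprime (inord 0)).1.
  have [z [P1z P0z]] : exists z, P (inord 1) z /\ ~ P (inord 0) z.
    by apply: proper_witness; apply: Plt; rewrite !inordK.
  by exists z; split=> //; apply/eqP => z0; apply: P0z; rewrite z0.
(* Together with x the prime would contain y, hence be maximal, leaving no room for a third prime
   above it. *)
have xP1 : ~ P (inord 1) x.
  move=> P1x; have P1y : P (inord 1) y.
    have : P (inord 1) (y ^+ N) by rewrite yN; case: iP1 => _ _; exact.
    elim: N {yN} => [|n IHn]; first by rewrite expr0.
    by rewrite exprS => /(P1M _ _ I I)[].
  have [w [P2w P1w]] : exists w, P (inord 2) w /\ ~ P (inord 1) w.
    by apply: proper_witness; apply: Plt; rewrite !inordK.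
  apply: P1w; have /xyP[c [d ->]] := proper_sub_mR iP2 P21 P2w.
  by case: iP1 => _ P1D P1mul; apply: P1D; apply: P1mul.
have P1sat w : P (inord 1) (x * w) -> P (inord 1) w by case/(P1M _ _ I I).
have [f P1f fgen] := saturated_principal iP1 P1sat.
have f0 : f != 0.
  by apply: contraNneq z0 => f0; have [r ->] := fgen z P1z; rewrite f0 mulr0.
have [h fN] : exists h, f ^+ N = x * h.
  have /xyP[c [d fE]] := proper_sub_mR iP1 P11 P1f.
  suff H n : exists u v, f ^+ n = u * x + v * y ^+ n.
    have [u [v ->]] := H N; exists (u + v * a); rewrite yN; ring.
  elim: n => [|n [u [v IHn]]]; first by exists 0, 1; rewrite mul0r add0r mulr1.
  exists (c * f ^+ n + d * y * u), (d * v); rewrite exprS {1}fE mulrDl {2}IHn exprS.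
  by ring.
have fdiv n w w' : x * w = f ^+ n * w' -> exists w'', w = f ^+ n * w''.
  elim: n w w' => [|n IHn] w w' xw; first by exists w; rewrite expr0 mul1r.
  have [|v wE] := IHn w (f * w'); first by rewrite xw exprSr mulrA.
  have [|r vE] := fgen v.
    apply: P1sat; have -> : x * v = w' * f.
      by apply: (mulfI (expf_neq0 n f0)); move: xw; rewrite wE exprSr => xw; ring: xw.
    by case: iP1 => _ _; apply.
  by exists r; rewrite wE vE exprSr; ring.
have [|h' hE] := fdiv N h 1; first by rewrite -fN mulr1.
apply: mR1; have -> : 1 = h' * x.
  by apply: (mulfI (expf_neq0 N f0)); rewrite mulr1 {1}fN hE; ring.
by case: mR_ideal => _ _; apply.
Qed.

Lemma y_neq0 : y != 0.
Proof.
by apply/eqP => y0; apply: (@ypow_notin_x 1); exists 0; rewrite y0 mul0r expr1.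
Qed.

Hypothesis x0 : x != 0.

(** Elements not divisible by x are units times powers of y modulo x, and so is their product, which
    [ypow_notin_x] keeps from being divisible by x. *)
Lemma x_prime f g : (exists a, f * g = a * x) ->
  (exists a, f = a * x) \/ (exists a, g = a * x).
Proof.
move=> [h fgE]; have [?|[n [a [b [ub fE]]]]] := mod_x_cases f; first by left.
have [?|[m [c [d [ud gE]]]]] := mod_x_cases g; first by right.
case: (@ypow_notin_x (n + m)).
exists ((b * d)^-1 * (h - a * g - b * y ^+ n * c)).
have u : b * d \is a GRing.unit by rewrite unitrM ub ud.
apply: (mulrI u); rewrite mulrA mulrA mulrV // mul1r.
have -> : (h - a * g - b * y ^+ n * c) * x = h * x - a * x * g - b * y ^+ n * (c * x).
  by ring.
by rewrite -fgE {1}fE gE exprD; ring.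
Qed.

Lemma y_regular f g : f * y = g * x -> exists h, f = h * x.
Proof.
move=> fy; have [//|[a yE]] := @x_prime f y (ex_intro _ g fy).
by case: (@ypow_notin_x 1); exists a; rewrite expr1.
Qed.

Definition divides q f := exists h, f = q * h.

Definition prime_elt q : Prop :=
  [/\ q != 0, mR q & forall f g, divides q (f * g) -> divides q f \/ divides q g].

Definition ideal2 f g : set R := [set z | exists a b, z = f * a + g * b].

Lemma ideal2_ideal f g : ideal (ideal2 f g).
Proof.
split; first by exists 0, 0; ring.
  by move=> _ _ [a [b ->]] [c [d ->]]; exists (a + c), (b + d); ring.
by move=> r _ [a [b ->]]; exists (r * a), (r * b); ring.
Qed.

(** The elements that some power of x multiplies into (q, z) form an ideal saturated with respect to
    x, hence a principal one. Its generator divides q and z, so it is a unit when the irreducible q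
    does not divide z. *)
Lemma irred_coprime q z : irreducible_elt q -> ~ divides q z ->
  exists n, ideal2 q z (x ^+ n).
Proof.
move=> [q0 _ qirr] qz.
pose I := [set w | exists n, ideal2 q z (x ^+ n * w)].
have [_ JD JM] := ideal2_ideal q z.
have Imono n m w : (n <= m)%N -> ideal2 q z (x ^+ n * w) -> ideal2 q z (x ^+ m * w).
  by move=> nm Iw; rewrite -(subnK nm) exprD -mulrA; exact: JM.
have iI : ideal I.
  split; first by exists 0; exists 0, 0; ring.
    move=> v w [n nP] [m mP]; exists (maxn n m); rewrite mulrDr.
    by apply: JD; [apply: Imono nP|apply: Imono mP]; rewrite ?leq_maxl ?leq_maxr.
  by move=> r w [n nP]; exists n; rewrite mulrCA; exact: JM.
have Isat w : I (x * w) -> I w by case=> n nP; exists n.+1; rewrite exprSr -mulrA.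
have [f [n If] fgen] := saturated_principal iI Isat.
have [r qE] : exists r, q = r * f by apply: fgen; exists 0; exists 1, 0; ring.
have [s zE] : exists s, z = s * f by apply: fgen; exists 0; exists 0, 1; ring.
case: (qirr r f qE) => uf; last first.
  exists n; have := JM f^-1 _ If.
  by rewrite mulrCA mulVr // mulr1.
case: qz; exists (r^-1 * s); rewrite qE zE.
rewrite [r * f * _](_ : _ = (r * r^-1) * (s * f)); last by ring.
by rewrite mulrV // mul1r.
Qed.

Lemma irred_dvd_x_or q : irreducible_elt q -> (exists a, q = a * x) -> divides q x.
Proof.
move=> [q0 _ qirr] [a qE]; case: (qirr a x qE) => [ua|ux].
  by exists a^-1; rewrite qE mulrAC mulrV // mul1r.
by have /mRE := mx; rewrite ux.
Qed.

(** If q does not divide f, then x^n lies in (q, f) and q divides x^n g; the powers of x are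
    cancelled by [x_prime]. A q divisible by x is associate to x and is treated apart. *)
Lemma irred_prime q : irreducible_elt q -> prime_elt q.
Proof.
move=> qi; have [q0 qnu qirr] := qi; split=> //; first exact/mRE.
move=> f g qfg; have [?|qf] := pselect (divides q f); [by left|right].
have [[a qE]|qx] := pselect (exists a, q = a * x).
  have [h xE] := irred_dvd_x_or qi (ex_intro _ a qE).
  have [r fgE] := qfg.
  have fgx : exists b, f * g = b * x by exists (r * a); rewrite fgE {1}qE; ring.
  have [[b fE]|[b gE]] := x_prime fgx.
    by case: qf; exists (h * b); rewrite fE xE; ring.
  by exists (h * b); rewrite gE xE; ring.
have [n [u [v xn]]] := irred_coprime qi qf.
suff H : divides q (x ^+ n * g).
  elim: n H {xn} => [|n IHn]; first by rewrite expr0 mul1r.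
  move=> [h xE]; apply: IHn; rewrite exprS -mulrA in xE.
  have qhx : exists b, q * h = b * x by exists (x ^+ n * g); rewrite -xE; ring.
  have [//|[b hE]] := x_prime qhx.
  by exists b; apply: (mulIf x0); rewrite mulrC xE hE; ring.
have [r fgE] := qfg; exists (u * g + v * r).
by rewrite xn mulrDl -!mulrA [v * g]mulrC [f * (g * v)]mulrA fgE; ring.
Qed.

(** One of q, f is not divisible by x and is thus a unit times y^k modulo x. So y^k is a multiple of
    x modulo (q, f), and a power of x is already there. *)
Lemma irred_cofinite q f : irreducible_elt q -> ~ divides q f ->
  exists s, ideal2 q f (x ^+ s) /\ ideal2 q f (y ^+ s).
Proof.
move=> qi qf; have [n xn] := irred_coprime qi qf.
have [_ JD JM] := ideal2_ideal q f.
have [a [k yk]] : exists a k, ideal2 q f (y ^+ k - a * x).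
  have [qx|[k [a [b [ub qE]]]]] := mod_x_cases q; last first.
    exists (- (b^-1 * a)), k.
    exists b^-1, 0; rewrite qE mulr0 addr0.
    apply: (mulrI ub); rewrite [RHS](_ : _ = (b * b^-1) * (a * x + b * y ^+ k)); last by ring.
    rewrite [LHS](_ : _ = b * y ^+ k + (b * b^-1) * a * x); last by ring.
    by rewrite mulrV // !mul1r addrC.
  have [[c fx]|[k [a [b [ub fE]]]]] := mod_x_cases f.
    have [h xE] := irred_dvd_x_or qi qx.
    by case: qf; exists (h * c); rewrite fx xE; ring.
  exists (- (b^-1 * a)), k.
  exists 0, b^-1; rewrite fE mulr0 add0r.
  apply: (mulrI ub); rewrite [RHS](_ : _ = (b * b^-1) * (a * x + b * y ^+ k)); last by ring.
  rewrite [LHS](_ : _ = b * y ^+ k + (b * b^-1) * a * x); last by ring.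
  by rewrite mulrV // !mul1r addrC.
have [m ym] : exists m, ideal2 q f (y ^+ m).
  exists (k * n)%N; rewrite exprM.
  suff H j : exists z, ideal2 q f (y ^+ k ^+ j - x ^+ j * z).
    have [z Hz] := H n; rewrite -[_ ^+ n](subrK (x ^+ n * z)); apply: JD => //.
    by rewrite mulrC; exact: JM.
  elim: j => [|j [z IHj]].
    by exists 1; rewrite !expr0 mulr1 subrr; case: (ideal2_ideal q f).
  exists (a * z).
  rewrite [_ - _](_ : _ = y ^+ k * (y ^+ k ^+ j - x ^+ j * z) +
    x ^+ j * z * (y ^+ k - a * x)); last by rewrite !exprS; ring.
  by apply: JD; exact: JM.
exists (maxn n m); split.
  by rewrite -(subnK (leq_maxl n m)) exprD; exact: JM.
by rewrite -(subnK (leq_maxr n m)) exprD; exact: JM.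
Qed.

Lemma subsp_ideal I : ideal I -> subsp iota I.
Proof. by case=> I0 ID IM; split=> // c z; exact: IM. Qed.

(** Replacing coefficients by their residues in K, one order at a time, leaves a combination of the
    monomials x^i y^j with i, j < s; terms of total degree 2s lie in [I]. *)
Lemma ideal_colength I s : ideal I -> I (x ^+ s) -> I (y ^+ s) ->
  exists n, qdim iota [set: R] I n.
Proof.
move=> iI Ix Iy; have [I0 ID IM] := iI.
pose mon (p : 'I_s * 'I_s) := x ^+ p.1 * y ^+ p.2.
pose U := [set z | exists c, I (z - \sum_p iota (c p) * mon p)].
suff Uall z : U z.
  apply: (@qdim_spans _ _ _ _ _ _ (fun i : 'I_#|{: 'I_s * 'I_s}| => mon (enum_val i))).
    exact: subsp_ideal.
  by apply: spans_fin => z _; exact: Uall.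
have UI w : I w -> U w.
  by move=> Iw; exists (fun=> 0); rewrite big1 ?subr0 // => p _; rewrite rmorph0 mul0r.
have UD v w : U v -> U w -> U (v + w).
  move=> [c Iv] [d Iw]; exists (fun p => c p + d p).
  rewrite [\sum_p _](_ : _ = \sum_p iota (c p) * mon p + \sum_p iota (d p) * mon p).
    by rewrite opprD addrACA; exact: ID.
  by rewrite -big_split /=; apply: eq_bigr => p _; rewrite rmorphD mulrDl.
have Umon i j c : U (x ^+ i * y ^+ j * iota c).
  have [si|si] := leqP s i.
    apply: UI; rewrite -(subnK si) exprD.
    rewrite [_ * iota c](_ : _ = x ^+ (i - s) * y ^+ j * iota c * x ^+ s); last by ring.
    exact: IM.
  have [sj|sj] := leqP s j.
    by apply: UI; rewrite -(subnK sj) exprD mulrA mulrAC; exact: IM.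
  pose p0 := (Ordinal si, Ordinal sj).
  exists (fun p => if p == p0 then c else 0).
  rewrite (bigD1 p0) //= eqxx big1 ?addr0 => [|p /negPf ->].
    by rewrite /mon /= mulrC subrr.
  by rewrite rmorph0 mul0r.
have H d i j w : (s + s <= i + j + d)%N -> U (x ^+ i * y ^+ j * w).
  elim: d i j w => [|d IHd] i j w ijd.
    have [si|si] := leqP s i.
      apply: UI; rewrite -(subnK si) exprD.
      rewrite [_ * w](_ : _ = x ^+ (i - s) * y ^+ j * w * x ^+ s); last by ring.
      exact: IM.
    apply: UI; have sj : (s <= j)%N by lia.
    by rewrite -(subnK sj) exprD mulrA mulrAC; exact: IM.
  have [c /xyP[a [b wE]]] := residue_field w.
  rewrite -[w](subrK (iota c)) wE.
  rewrite [_ * _](_ : _ = x ^+ i.+1 * y ^+ j * a + x ^+ i * y ^+ j.+1 * b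
    + x ^+ i * y ^+ j * iota c); last by rewrite !exprS; ring.
  by apply: (UD _ _ (UD _ _ _ _) (Umon i j c)); apply: IHd; lia.
by rewrite -[z]mul1r -[1]mulr1 -{1}(expr0 x) -(expr0 y); apply: (H (s + s)%N).
Qed.

Lemma irred_colength q f : irreducible_elt q -> ~ divides q f ->
  exists n, qdim iota [set: R] (ideal2 q f) n.
Proof.
by move=> qi qf; have [s [? ?]] := irred_cofinite qi qf;
  apply: (@ideal_colength _ s) => //; exact: ideal2_ideal.
Qed.

End RegularLocalRing.

(** * Intersection numbers on a smooth surface *)

Section Subalgebras.
Variables (K F : fieldType) (k : {rmorphism K -> F}).
Implicit Types A T : set F.

Definition salg A : Prop :=
  [/\ forall c, A (k c), forall a b, A a -> A b -> A (a + b)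
    & forall a b, A a -> A b -> A (a * b)].

Lemma salgK A c : salg A -> A (k c). Proof. by case. Qed.
Lemma salgD A a b : salg A -> A a -> A b -> A (a + b).
Proof. by case=> _ AD _; exact: AD. Qed.
Lemma salgM A a b : salg A -> A a -> A b -> A (a * b).
Proof. by case=> _ _ AM; exact: AM. Qed.
Lemma salg0 A : salg A -> A 0. Proof. by case=> Ak _ _; have := Ak 0; rewrite rmorph0. Qed.
Lemma salg1 A : salg A -> A 1. Proof. by case=> Ak _ _; have := Ak 1; rewrite rmorph1. Qed.
Lemma salgN A a : salg A -> A a -> A (- a).
Proof. by move=> sA Aa; have := salgM sA (salgK (-1) sA) Aa; rewrite rmorphN1 mulN1r. Qed.
Lemma salgB A a b : salg A -> A a -> A b -> A (a - b).
Proof. by move=> sA Aa Ab; apply: salgD => //; exact: salgN. Qed.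
Lemma salgX A a n : salg A -> A a -> A (a ^+ n).
Proof.
move=> sA Aa; elim: n => [|n IHn]; first exact: salg1.
by rewrite exprS; exact: salgM.
Qed.
Lemma salg_sum A (I : Type) (r : seq I) (P : pred I) f :
  salg A -> (forall i, A (f i)) -> A (\sum_(i <- r | P i) f i).
Proof.
move=> sA Af; apply: big_ind => // [|a b]; first exact: salg0.
exact: salgD.
Qed.

Definition mulset (x : F) A : set F := [set z | exists2 a, A a & z = x * a].

Definition mid T (x y : F) : set F :=
  [set z | exists a b, [/\ T a, T b & z = x * a + y * b]].

(** A local ring with residue field K and maximal ideal (x, y), phrased through membership in [mid],
    which [mid_maxideal] identifies with [maxideal]. *)
Record local2 T (x y : F) : Prop := Local2 {
  l_alg : salg T;
  l_x : T x;
  l_y : T y;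
  l_res : forall z, T z -> exists c, mid T x y (z - k c);
  l_unit : forall z, T z -> ~ mid T x y z -> T z^-1;
  l_proper : ~ mid T x y 1 }.

Lemma midx T x y : salg T -> mid T x y x.
Proof. by move=> sT; exists 1, 0; split; [exact: salg1|exact: salg0|ring]. Qed.
Lemma midy T x y : salg T -> mid T x y y.
Proof. by move=> sT; exists 0, 1; split; [exact: salg0|exact: salg1|ring]. Qed.
Lemma mid_sub T x y : salg T -> T x -> T y -> mid T x y `<=` T.
Proof. by move=> sT Tx Ty z [a [b [Ta Tb ->]]]; apply: salgD => //; exact: salgM. Qed.
Lemma midD T x y z w : salg T -> mid T x y z -> mid T x y w -> mid T x y (z + w).
Proof.
move=> sT [a [b [Ta Tb ->]]] [c [d [Tc Td ->]]]; exists (a + c), (b + d).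
by split; [exact: salgD|exact: salgD|ring].
Qed.
Lemma midM T x y a z : salg T -> T a -> mid T x y z -> mid T x y (a * z).
Proof.
move=> sT Ta [c [d [Tc Td ->]]]; exists (a * c), (a * d).
by split; [exact: salgM|exact: salgM|ring].
Qed.
Lemma mulset_subp x T z a : salg T -> T a -> mulset x T z -> mulset x T (a * z).
Proof. by move=> sT Ta [b Tb ->]; exists (a * b); [exact: salgM|ring]. Qed.
Lemma mulsetD x T z w : salg T -> mulset x T z -> mulset x T w -> mulset x T (z + w).
Proof. by move=> sT [b Tb ->] [c Tc ->]; exists (b + c); [exact: salgD|ring]. Qed.
Lemma mulset_mid T x y : salg T -> mulset x T `<=` mid T x y.
Proof. by move=> sT _ [b Tb ->]; exists b, 0; split=> //; [exact: salg0|ring]. Qed.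
Lemma midC T x y : mid T x y = mid T y x.
Proof.
by apply/seteqP; split=> z [a [b [Ta Tb ->]]]; exists b, a; split=> //; rewrite addrC.
Qed.

Lemma mid_maxideal T x y : local2 T x y -> maxideal T = mid T x y.
Proof.
case=> sT Tx Ty _ Tu T1; apply/seteqP; split=> z.
  move=> [Tz nu]; apply: contrapT => nz; apply: nu; exists z^-1; first exact: Tu.
  by rewrite mulfV //; apply/eqP => z0; apply: nz; exists 0, 0; split;
    [exact: salg0|exact: salg0|rewrite z0; ring].
move=> mz; split; first exact: mid_sub mz.
by move=> [w Tw zw]; apply: T1; rewrite -zw mulrC; exact: midM.
Qed.

Lemma subsp_salg A : salg A -> subsp k A.
Proof. by move=> sA; split; [exact: salg0 | move=> ? ?; exact: salgD | move=> c a Aa;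
  apply: salgM => //; exact: salgK]. Qed.

End Subalgebras.

Notation "f %:F" := (@tofrac _ f) : ring_scope.

Lemma fracP (R : idomainType) (z : {fraction R}) :
  exists u v : R, v != 0 /\ z * v%:F = u%:F.
Proof.
elim/quotW: z => r; exists (frac r).1, (frac r).2; split; first exact: denom_ratioP.
case: r => -[a b] /= b0; unlock tofrac; rewrite -[LHS]FracField.pi_mul.
apply/eqmodP; rewrite /= FracField.equivfE /= /FracField.mulf /=.
by rewrite !numden_Ratio ?mulr1 ?oner_neq0 //= mulrC.
Qed.

Lemma tofrac_sum (R : idomainType) (I : finType) (f : I -> R) :
  (\sum_i f i)%:F = \sum_i (f i)%:F.
Proof. exact: rmorph_sum. Qed.

(** * Strict transforms of irreducible curves at a point of E *)

Section Places.
Variables (K : fieldType) (R : idomainType) (iota : {rmorphism K -> R}).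
Local Notation F := {fraction R}.
Local Notation mR := (maxideal [set: R]).

Definition kap : {rmorphism K -> F} := (@tofrac R \o iota)%FUN.

Lemma kapE c : kap c = (iota c)%:F. Proof. by []. Qed.

(* A closed point T of a smooth surface over Spec R at which the exceptional
   divisor is the single curve x = 0, along which v is the order of
   vanishing. *)
Record place (v : R -> nat) (T : set F) (x y : F) : Prop := Place {
  pl_local : local2 kap T x y;
  pl_base : forall f, T f%:F;
  pl_x0 : x != 0;
  pl_prime : forall a b, T a -> T b -> mulset x T (a * b) ->
    mulset x T a \/ mulset x T b;
  pl_fin : forall z, T z -> ~ mulset x T z ->
    exists n a b, [/\ T a, T b & y ^+ n = z * a + x * b];
  pl_gen : exists f a e, [/\ mR f, T e, T e^-1, e != 0 & f%:F = x ^+ a * e];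
  pl_mR : forall f, mR f -> mulset x T f%:F;
  pl_val : forall f, f != 0 ->
    exists z, [/\ T z, ~ mulset x T z & f%:F = x ^+ v f * z] }.

(* The curve of equation f / x^v(f), the strict transform of f = 0, contains T. *)
Definition passes (v : R -> nat) T x y f := mid T x y (f%:F / x ^+ v f).

Definition inter q f n := qdim iota [set: R] (ideal2 q f) n.

Lemma interC q f n : inter q f n -> inter f q n.
Proof.
rewrite /inter (_ : ideal2 q f = ideal2 f q) //.
by apply/seteqP; split=> z [a [b ->]]; exists b, a; rewrite addrC.
Qed.

Hypothesis HR : complete_regular_local_ring iota 2.
Variables x0 y0 : R.
Hypothesis xyP : forall f, mR f <-> exists a b, f = a * x0 + b * y0.
Hypothesis x00 : x0 != 0.

Lemma mpow_in_ideal2 q f g : irreducible_elt q -> ~ divides q f -> mR g ->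
  exists s, ideal2 q f (g ^+ s).
Proof.
move=> qi qf /xyP[a [b ->]]; have [s [Jx Jy]] := irred_cofinite HR xyP qi qf.
have [J0 JD JM] := ideal2_ideal q f.
exists (s + s)%N; rewrite exprDn; apply: big_ind => // i _.
rewrite -mulr_natl; apply: (JM); rewrite !exprMn.
have [si|si] := leqP s i.
  have -> : y0 ^+ i = y0 ^+ (i - s) * y0 ^+ s by rewrite -exprD subnK.
  by rewrite !mulrA; exact: JM.
have -> : x0 ^+ (s + s - i) = x0 ^+ (s + s - i - s) * x0 ^+ s.
  by rewrite -exprD subnK //; lia.
rewrite [X in ideal2 q f X](_ : _ = a ^+ (s + s - i) * x0 ^+ (s + s - i - s) *
    (b ^+ i * y0 ^+ i) * x0 ^+ s); last by ring.
exact: JM.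
Qed.

Lemma divides_pow_bounded q v : mR q -> v != 0 -> exists n, ~ divides (q ^+ n) v.
Proof.
move=> mq /eqP v0; apply: contrapT => nex; apply: v0; apply: (adic_sep HR) => n.
have [[h ->]|nq] := pselect (divides (q ^+ n) v); first exact: mRpowX.
by case: nex; exists n.
Qed.

Variables (v : R -> nat) (T : set F) (x y : F).
Hypothesis pl : place v T x y.
Variable q : R.
Hypothesis qi : irreducible_elt q.
Hypothesis qpass : passes v T x y q.

Let qp : prime_elt q. Proof. exact: (irred_prime HR xyP x00 qi). Qed.
Let sT : salg kap T. Proof. by case: pl => -[]. Qed.
Let TR f : T f%:F. Proof. exact: (pl_base pl). Qed.
Let Tx : T x. Proof. by case: pl => -[]. Qed.
Let Ty : T y. Proof. by case: pl => -[]. Qed.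
Let x_neq0 : x != 0. Proof. exact: (pl_x0 pl). Qed.
Let T1 : ~ mid T x y 1. Proof. by case: pl => -[]. Qed.
Let q0 : q != 0. Proof. by case: qp. Qed.
Let qF0 : q%:F != 0. Proof. by rewrite tofrac_eq0. Qed.
Let z0 := q%:F / x ^+ v q.

Let qE : q%:F = x ^+ v q * z0.
Proof. by rewrite mulrC divfK // expf_neq0. Qed.

Let z0_neq0 : z0 != 0.
Proof. by rewrite mulf_neq0 // invr_eq0 expf_neq0. Qed.

Let Tz0x : T z0 /\ ~ mulset x T z0.
Proof.
have [z [Tz xz qz]] := pl_val pl q0; suff -> : z0 = z by [].
by apply: (mulfI (expf_neq0 (v q) x_neq0)); rewrite -qE.
Qed.
Let Tz0 := Tz0x.1.
Let xz0 := Tz0x.2.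

Ltac inT := repeat first [ assumption | exact: TR | exact: Tx | exact: Ty
  | exact: Tz0 | apply: (salg0 sT) | apply: (salg1 sT) | apply: (salgK _ sT)
  | apply: (salgN sT) | apply: (salgD sT) | apply: (salgM sT) | apply: (salgX _ sT) ].

(** The ideal in [T] of the strict transform of q, whose local equation is [z0]. *)
Definition curve_eq : set F := mulset z0 T.
Local Notation I := curve_eq.

Lemma curve_eqD a b : I a -> I b -> I (a + b).
Proof. exact: (mulsetD sT). Qed.
Lemma curve_eqM a b : T a -> I b -> I (a * b).
Proof. exact: (mulset_subp sT). Qed.
Lemma curve_eq0 : I 0.
Proof. by exists 0; [inT|rewrite mulr0]. Qed.
Lemma curve_eqq a : T a -> I (q%:F * a).
Proof. by move=> Ta; exists (x ^+ v q * a); [inT|rewrite qE; ring]. Qed.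
Lemma curve_eqT a : I a -> T a.
Proof. by case=> b Tb ->; inT. Qed.
Lemma curve_eq_mid a : I a -> mid T x y a.
Proof. by case=> b Tb ->; rewrite mulrC; apply: (midM sT). Qed.
Lemma mid_notunit a : mid T x y a -> T a^-1 -> a != 0 -> False.
Proof. by move=> ma Ta a0; apply: T1; rewrite -(mulVf a0); exact: (midM sT). Qed.

(** The prime ideal xT does not contain [z0], so a factor x of z0 h comes from h. *)
Lemma curve_eq_cancel n w : T w -> I (x ^+ n * w) -> I w.
Proof.
move=> Tw [h Th xw]; elim: n h Th xw => [|n IHn] h Th xw.
  by exists h => //; rewrite -xw mul1r.
have xh : mulset x T (z0 * h).
  by exists (x ^+ n * w); [inT|rewrite -xw exprS mulrA].
have [/xz0//|[h' Th' hE]] := pl_prime pl Tz0 Th xh.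
by apply: (IHn h' Th'); apply: (mulfI x_neq0); rewrite mulrA -exprS xw hE; ring.
Qed.

(** By [pl_gen] the maximal ideal of R contains some x^a e with e a unit of [T], and one of its
    powers lies in (q, f). *)
Let gen_in f : ~ divides q f -> exists n e a b, [/\ T e, T e^-1, e != 0, T a & T b] /\
  x ^+ n * e = q%:F * a + f%:F * b.
Proof.
move=> qf; have [g [a [e [mg Te Tei e0 gE]]]] := pl_gen pl.
have [s [r [t gs]]] := mpow_in_ideal2 qi qf mg.
exists (a * s)%N, (e ^+ s), r%:F, t%:F; split.
  by rewrite -exprVn expf_neq0 //; split=> //; inT.
by rewrite exprM -exprMn -gE -!rmorphM -rmorphD -gs rmorphXn.
Qed.

(** Otherwise [gen_in] and cancellation of x would put a unit of [T] into [I]. So R / (q) embeds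
    into T / I. *)
Lemma curve_eq_base f : I f%:F -> divides q f.
Proof.
move=> If; apply: contrapT => qf.
have [n [e [a [b [[Te Tei e0 Ta Tb] xe]]]]] := gen_in qf.
have /curve_eq_cancel Ie : I (x ^+ n * e).
  by rewrite xe; apply: curve_eqD; [exact: curve_eqq|rewrite mulrC; exact: curve_eqM].
exact: mid_notunit (curve_eq_mid (Ie Te)) Tei e0.
Qed.

Lemma base_curve_eq f : divides q f -> I f%:F.
Proof. by move=> [h ->]; rewrite tofracM; exact: (curve_eqq (TR h)). Qed.

(** Common factors q of numerator and denominator are removed one by one, which ends because high
    powers of q do not divide the denominator. Thus T / I lies in the fraction field of R / (q). *)
Lemma frac_denom z : T z -> exists u w : R, ~ divides q w /\ z * w%:F = u%:F.
Proof.
move=> Tz; have [u [w [w0 zw]]] := fracP z.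
have [n nq] : exists n, ~ divides (q ^+ n) w by have [_ mq _] := qp;
  exact: (divides_pow_bounded mq w0).
elim: n u w nq w0 zw => [|n IHn] u w nq w0 zw.
  by case: nq; exists w; rewrite mul1r.
have [[w' wE]|qw] := pselect (divides q w); last by exists u, w.
have [u' uE] : divides q u.
  apply: curve_eq_base; rewrite -zw; apply: curve_eqM => //.
  by apply: base_curve_eq; exists w'.
apply: (IHn u' w').
- by move=> [h w'E]; apply: nq; exists h; rewrite wE w'E exprS mulrA.
- by apply: contraNneq w0 => w'0; rewrite wE w'0 mulr0.
- apply: (mulfI qF0); rewrite -[RHS]tofracM -uE -zw wE tofracM; ring.
Qed.

Lemma curve_eq_torsionfree w z : ~ divides q w -> T z -> I (w%:F * z) -> I z.
Proof.
move=> qw Tz Iwz; have [n [e [a [b [[Te Tei e0 Ta Tb] xe]]]]] := gen_in qw.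
have /curve_eq_cancel Iez : I (x ^+ n * (e * z)).
  rewrite mulrA xe mulrDl; apply: curve_eqD; last by rewrite [_ * b]mulrC -mulrA;
    exact: curve_eqM.
  by rewrite -mulrA; apply: curve_eqq; inT.
by rewrite -[z](mulKf e0); apply: curve_eqM => //; apply: Iez; inT.
Qed.

Lemma curve_eq_prime z z' : T z -> T z' -> I (z * z') -> I z \/ I z'.
Proof.
move=> Tz Tz' Izz'; have [u [w [qw zw]]] := frac_denom Tz.
have [u' [w' [qw' zw']]] := frac_denom Tz'.
have /curve_eq_base : I (u * u')%:F.
  rewrite tofracM -zw -zw'; rewrite [X in I X](_ : _ = w%:F * w'%:F * (z * z')); last by ring.
  by apply: curve_eqM => //; inT.
case: qp => _ _ qprime /qprime[] /base_curve_eq.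
  by rewrite -zw mulrC => /(curve_eq_torsionfree qw Tz); left.
by rewrite -zw' mulrC => /(curve_eq_torsionfree qw' Tz'); right.
Qed.

Lemma curve_eq_local z u w : T z -> ~ divides q w -> divides q u -> z * w%:F = u%:F -> I z.
Proof.
move=> Tz qw /base_curve_eq Iu zw; apply: (curve_eq_torsionfree qw Tz).
by rewrite mulrC zw.
Qed.

(** For z outside [I], with numerator u, some x^n e with e a unit lies in qT + uT, hence in I + zT.
    If z were divisible by x^(n+1) modulo [I], cancelling x^n would make e vanish at the closed
    point. *)
Lemma curve_eq_sep z : T z -> (forall n, exists2 w, T w & I (z - x ^+ n * w)) -> I z.
Proof.
move=> Tz zsep; have [u [w [qw zw]]] := frac_denom Tz.
have [qu|qu] := pselect (divides q u); first exact: curve_eq_local zw.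
have [n [e [a [b [[Te Tei e0 Ta Tb] xe]]]]] := gen_in qu.
have [t Tt It] := zsep n.+1.
have /curve_eq_cancel Iet : I (x ^+ n * (e - x * (b * w%:F * t))).
  rewrite mulrBr xe -zw.
  rewrite [X in I X](_ : _ = q%:F * a + (w%:F * b) * (z - x ^+ n.+1 * t)); last first.
    by rewrite exprS; ring.
  by apply: curve_eqD; [exact: curve_eqq|apply: curve_eqM => //; inT].
exfalso; apply: (@mid_notunit e) => //.
set c := x * _ in Iet; have Tc : T c by rewrite /c; inT.
rewrite -(subrK c e); apply: (midD sT).
  by apply: curve_eq_mid; apply: Iet; inT.
by rewrite /c mulrC; apply: (midM sT); [inT|exact: (midx _ _ sT)].
Qed.

(** [pl_fin] puts y^n into z0 T + xT, so 1, y, ..., y^(n-1) generate modulo I + xT. *)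
Let mod_x_gens : exists n, forall z, T z -> exists (c : nat -> K) w,
  T w /\ I (z - \sum_(j < n) kap (c j) * y ^+ j - x * w).
Proof.
have [n [a [b [Ta Tb yE]]]] := pl_fin pl Tz0 xz0; exists n => z Tz.
suff [c [w [w' [Tw Tw' zE]]]] : exists (c : nat -> K) w w', [/\ T w, T w' &
    z = \sum_(j < n) kap (c j) * y ^+ j + x * w + y ^+ n * w'].
  exists c, (w + b * w'); split; first by inT.
  exists (a * w'); first by inT.
  by rewrite zE yE; ring.
elim: n {yE} => [|n [c [w [w' [Tw Tw' zE]]]]].
  exists (fun=> 0), 0, z; split=> //; first by inT.
  by rewrite big_ord0; ring.
have [_ _ _ res _ _] := pl_local pl; have [c' [a' [b' [Ta' Tb' w'E]]]] := res _ Tw'.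
exists (fun j => if (j < n)%N then c j else c'), (w + y ^+ n * a'), b'.
split; [by inT|by []|]; rewrite big_ord_recr /= ltnn.
rewrite (eq_bigr (fun j : 'I_n => kap (c j) * y ^+ j)) => [|i _]; last by rewrite ltn_ord.
by rewrite zE -[w'](subrK (kap c')) w'E exprS; ring.
Qed.

(** Iterating [mod_x_gens] along the powers of x up to f = x^a e yields the generators x^i y^j of T
    / (I + fT). *)
Let residue_gens : exists (P : finType) (g : P -> F) f, [/\ mR f, forall p, T (g p)
  & forall z, T z -> exists (c : P -> K) w,
    T w /\ I (z - \sum_p kap (c p) * g p - f%:F * w)].
Proof.
have [n nP] := mod_x_gens; have [f [a [e [mf Te Tei e0 fE]]]] := pl_gen pl.
exists ('I_a * 'I_n)%type, (fun p : 'I_a * 'I_n => x ^+ p.1 * y ^+ p.2), f.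
split=> // [p|z Tz]; first by inT.
suff H m : exists (c : nat -> nat -> K) w, T w /\
    I (z - \sum_(i < m) \sum_(j < n) kap (c i j) * (x ^+ i * y ^+ j) - x ^+ m * w).
  have [c [w [Tw Iw]]] := H a; exists (fun p : 'I_a * 'I_n => c p.1 p.2), (e^-1 * w).
  split; first by inT.
  rewrite -(pair_bigA _ (fun i j => kap (c (i : 'I_a) (j : 'I_n)) * (x ^+ i * y ^+ j))) /=.
  by rewrite fE -mulrA mulVKf.
elim: m => [|m [c [w [Tw Iw]]]].
  exists (fun _ _ => 0), z; split=> //; rewrite big_ord0 expr0.
  by rewrite [X in I X](_ : _ = 0); [exact: curve_eq0 | ring].
have [c' [w' [Tw' Iw']]] := nP w Tw.
exists (fun i => if (i < m)%N then c i else c'), w'; split=> //.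
rewrite big_ord_recr /= ltnn.
rewrite (eq_bigr (fun i : 'I_m => \sum_(j < n) kap (c i j) * (x ^+ i * y ^+ j))); last first.
  by move=> i _; rewrite ltn_ord.
rewrite [X in _ - (_ + X) - _](_ : _ = x ^+ m * \sum_(j < n) kap (c' j) * y ^+ j); last first.
  by rewrite mulr_sumr; apply: eq_bigr => j _; ring.
set A := \sum_(i < m) _ in Iw *; set B := \sum_(j < n) _ in Iw' *.
rewrite [X in I X](_ : _ = (z - A - x ^+ m * w) + x ^+ m * (w - B - x * w')); last first.
  by rewrite exprS; ring.
by apply: curve_eqD => //; apply: curve_eqM => //; inT.
Qed.

Let mRpow_x n f : ideal_pow [set: R] mR n f -> mulset (x ^+ n) T f%:F.
Proof.
apply: (ideal_pow_ind (P := fun n => [set f : R | mulset (x ^+ n) T f%:F])) => {n f}.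
- by move=> f _; exists f%:F; [inT|rewrite mul1r].
- by move=> n; exists 0; [inT|rewrite mulr0 rmorph0].
- move=> n f g [a Ta fE] [b Tb gE]; exists (a + b); first by inT.
  by rewrite tofracD fE gE mulrDr.
- move=> n f g /(pl_mR pl)[a Ta fE] [b Tb gE]; exists (a * b); first by inT.
  by rewrite tofracM fE gE exprS; ring.
Qed.

(** Generators modulo f generate T / I over R, as in Nakayama's lemma for complete rings: successive
    remainders give coefficients that are power series in f, which converge in R, and the total
    error lies in [I] by [curve_eq_sep]. *)
Lemma curve_finite : exists (P : finType) (g : P -> F), (forall p, T (g p)) /\
  forall z, T z -> exists r : P -> R, I (z - \sum_p (r p)%:F * g p).
Proof.
have [P [g [f [mf Tg gP]]]] := residue_gens; exists P, g; split=> // z Tz.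
have step w : exists cw : (P -> K) * F, T w ->
    T cw.2 /\ I (w - \sum_p kap (cw.1 p) * g p - f%:F * cw.2).
  have [/gP[c [w' ?]]|Tw] := pselect (T w); first by exists (c, w').
  by exists (fun=> 0, 0).
have [cw cwP] := choice step.
pose w n := iter n (fun w => (cw w).2) z.
have Tw n : T (w n) by elim: n => [//|n Tn]; case: (cwP _ Tn).
pose u n p := \sum_(0 <= j < n) iota ((cw (w j)).1 p) * f ^+ j.
have uP n : I (z - \sum_p (u n p)%:F * g p - f%:F ^+ n * w n).
  elim: n => [|n IHn].
    rewrite big1 => [|p _]; last by rewrite /u big_geq // tofrac0 mul0r.
    by rewrite [X in I X](_ : _ = 0); [exact: curve_eq0 | rewrite expr0 /w /=; ring].
  have [_ IS] := cwP _ (Tw n).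
  rewrite [\sum_p _](_ : _ = \sum_p (u n p)%:F * g p +
      f%:F ^+ n * \sum_p kap ((cw (w n)).1 p) * g p); last first.
    rewrite mulr_sumr -big_split /=; apply: eq_bigr => p _.
    by rewrite /u big_nat_recr //= tofracD tofracM tofracXn ?kapE; ring.
  set A := \sum_p _ in IHn *; set B := \sum_p _ in IS *.
  rewrite [X in I X](_ : _ = (z - A - f%:F ^+ n * w n) +
    f%:F ^+ n * (w n - B - f%:F * w n.+1)); last by rewrite exprS; ring.
  by apply: curve_eqD => //; apply: curve_eqM => //; inT.
have [r rP] : exists r : P -> R, forall p n, ideal_pow [set: R] mR n (r p - u n p).
  have lim p : exists l, forall n, ideal_pow [set: R] mR n (l - u n p).
    apply: (adic_limit HR) => n; rewrite /u big_nat_recr //= addrAC subrr add0r mulrC.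
    exact: (mRpowX _ _ mf).
  by have [r rP] := choice lim; exists r.
exists r; apply: curve_eq_sep.
  by apply: (salgB sT) => //; apply: (salg_sum _ _ sT) => p; inT.
move=> n; have [f1 Tf1 fE] := pl_mR pl mf.
have hex p : exists h, T h /\ (r p - u n p)%:F = x ^+ n * h.
  by have [h Th hE] := mRpow_x (rP p n); exists h.
have [h hP] := choice hex.
have Th p : T (h p) by case: (hP p).
exists (f1 ^+ n * w n - \sum_p h p * g p).
  by apply: (salgB sT); [inT | apply: (salg_sum _ _ sT) => p; inT].
have := uP n; congr I; rewrite mulrBr mulr_sumr fE exprMn.
have -> : \sum_p (r p)%:F * g p = \sum_p (u n p)%:F * g p + \sum_p x ^+ n * (h p * g p).
  rewrite -big_split /=; apply: eq_bigr => p _.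
  have [_ rE] := hP p; rewrite mulrA -rE tofracB; ring.
ring.
Qed.

(** A common denominator of the finitely many generators carries T / I into R / (q). *)
Lemma curve_conductor : exists d : R, ~ divides q d /\
  forall z, T z -> exists r : R, I (d%:F * z - r%:F).
Proof.
have [P [g [Tg gP]]] := curve_finite.
have [u uP] := choice (fun p => frac_denom (Tg p)).
have {uP}[w uwP] := choice uP.
have [_ mq qprime] := qp.
pose d := \prod_p w p; exists d; split.
  apply: (big_ind (fun d => ~ divides q d)) => [[h q1]|a b qa qb /qprime[]//|p _].
    by have /mRE/negP := mq; apply; apply/unitrPr; exists h.
  by case: (uwP p).
move=> z /gP[r Ir]; exists (\sum_p r p * (u p * \prod_(p' | p' != p) w p')).
have -> : d%:F * z - (\sum_p r p * (u p * \prod_(p' | p' != p) w p'))%:F =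
    d%:F * (z - \sum_p (r p)%:F * g p).
  rewrite mulrBr mulr_sumr tofrac_sum; congr (_ - _); apply: eq_bigr => p _.
  have dE : d = w p * \prod_(p' | p' != p) w p' by rewrite /d (bigD1 p).
  rewrite dE !tofracM; have [_ <-] := uwP p; ring.
by apply: curve_eqM => //; inT.
Qed.

Let base_quo : set F := [set z | exists f : R, I (z - f%:F)].
Let base_mul (w : R) : set F := [set z | exists f : R, I (z - w%:F * f%:F)].
Definition quoI (w : F) : set F := [set z | exists2 a, T a & I (z - w * a)].

Let sub_base_quo : subsp kap base_quo.
Proof.
split.
- by exists 0; rewrite tofrac0 subr0; exact: curve_eq0.
- move=> a b [f If] [g Ig]; exists (f + g); rewrite tofracD opprD addrACA.
  exact: curve_eqD.
- move=> c a [f If]; exists (iota c * f); rewrite tofracM -kapE -mulrBr.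
  by apply: curve_eqM => //; inT.
Qed.

Let sub_base_mul w : subsp kap (base_mul w).
Proof.
split.
- by exists 0; rewrite tofrac0 mulr0 subr0; exact: curve_eq0.
- move=> a b [f If] [g Ig]; exists (f + g); rewrite tofracD mulrDr opprD addrACA.
  exact: curve_eqD.
- move=> c a [f If]; exists (iota c * f); rewrite tofracM -kapE mulrCA -mulrBr.
  by apply: curve_eqM => //; inT.
Qed.

Lemma subsp_quoI w : subsp kap (quoI w).
Proof.
split.
- by exists 0; [inT|rewrite mulr0 subr0; exact: curve_eq0].
- move=> a b [f Tf If] [g Tg Ig]; exists (f + g); first by inT.
  by rewrite mulrDr opprD addrACA; exact: curve_eqD.
- move=> c a [f Tf If]; exists (kap c * f); first by inT.
  by rewrite mulrCA -mulrBr; apply: curve_eqM => //; inT.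
Qed.

Let base_quo_mul f : base_mul f `<=` base_quo.
Proof. by move=> z [g Ig]; exists (f * g); rewrite tofracM. Qed.

Let base_quoT : base_quo `<=` T.
Proof.
by move=> z [f If]; rewrite -(subrK f%:F z); apply: (salgD sT) (TR f); exact: curve_eqT.
Qed.

Let quoI_T w : T w -> quoI w `<=` T.
Proof.
by move=> Tw z [a Ta Ia]; rewrite -(subrK (w * a) z); apply: (salgD sT);
  [exact: curve_eqT | inT].
Qed.

Let inter_base_quo f n : inter q f n -> qdim kap base_quo (base_mul f) n.
Proof.
apply: (@qdim_iso _ _ _ iota kap (@tofrac R)) => //.
- exact: tofracD.
- by move=> c z; rewrite tofracM.
- by move=> u _; exists u; rewrite subrr; exact: curve_eq0.
- move=> u _; split=> [[g]|[a [b ->]]].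
    rewrite -tofracM -tofracB => /curve_eq_base[h hE]; exists h, g.
    by rewrite -hE subrK.
  exists b; rewrite tofracD !tofracM addrK; exact: curve_eqq.
- by move=> z [g Ig]; exists g => //; exists 0; rewrite tofrac0 mulr0 subr0.
Qed.

(** Multiplication by the conductor element d embeds T / (R + I) into R / (q, d), which is
    finite. *)
Let base_quo_finite : exists n, qdim kap T base_quo n.
Proof.
have [d [qd dP]] := curve_conductor.
have [n /inter_base_quo dn] := irred_colength HR xyP x00 qi qd.
apply: (qdim_embed (phi := fun z => d%:F * z)) dn => //.
- exact: mulrDr.
- by move=> c z; rewrite mulrCA.
- exact: subsp_salg.
- move=> z Tz [f If]; exists f; rewrite -mulrBr in If.
  by apply: (curve_eq_torsionfree qd) If; apply: (salgB sT) => //.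
Qed.

(** Let m be the dimension of T / (R + I). Multiplication by f shows that (fT + I) / (fR + I) has
    dimension m as well. Measuring T / (fR + I) once through R + I and once through fT + I, the two
    m cancel. *)
Lemma inter_quoI f n : ~ divides q f -> inter q f n -> qdim kap T (quoI f%:F) n.
Proof.
move=> qf /inter_base_quo fn; have [m Tm] := base_quo_finite.
have mulI w : I (f%:F * w) -> T w -> I w by move=> Iw Tw; exact: curve_eq_torsionfree Iw.
have Tn : qdim kap T (base_mul f) (m + n).
  by apply: (qdim_add _ _ _ _ _ Tm fn) => //; exact: subsp_salg.
have sub : base_mul f `<=` quoI f%:F by move=> z [g Ig]; exists g%:F => //; inT.
have [l Tl] := qdim_quo (subsp_quoI f%:F) sub Tn.
have fm : qdim kap (quoI f%:F) (base_mul f) m.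
  apply: (qdim_iso (k := kap) (phi := fun z => f%:F * z)) Tm => //.
  - exact: mulrDr.
  - by move=> c z; rewrite mulrCA.
  - by move=> z Tz; exists z => //; rewrite subrr; exact: curve_eq0.
  - exact: subsp_salg.
  - move=> z Tz; split=> -[g Ig]; exists g; last by rewrite -mulrBr; apply: curve_eqM => //;
    inT.
    by apply: mulI; [rewrite mulrBr | apply: (salgB sT)].
  - by move=> z [a Ta Ia]; exists a => //; exists 0; rewrite tofrac0 mulr0 subr0.
have Tlm : qdim kap T (base_mul f) (l + m).
  by apply: (qdim_add _ _ _ _ _ Tl fm) => //;
    [exact: subsp_quoI|exact: subsp_salg|apply: quoI_T; inT].
by have := qdim_uniq (sub_base_mul f) Tn Tlm; rewrite addnC => /addIn ->.
Qed.

(** As [I] is prime, multiplication by w identifies T / (I + w'T) with (I + wT) / (I + ww'T). *)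
Lemma quoI_mul w w' n : T w -> T w' -> ~ I w -> qdim kap T (quoI (w * w')) n ->
  exists l l', [/\ qdim kap T (quoI w) l, qdim kap T (quoI w') l' & n = (l + l')%N].
Proof.
move=> Tw Tw' Iw Tn.
have sub : quoI (w * w') `<=` quoI w.
  by move=> z [a Ta Ia]; exists (w' * a); [inT|rewrite mulrA].
have [l Tl] := qdim_quo (subsp_quoI w) sub Tn.
have [m wm] := qdim_sub (subsp_quoI _) (quoI_T Tw) Tn.
have mulD u z : w * (u + z) = w * u + w * z by rewrite mulrDr.
have mulZ c z : w * (kap c * z) = kap c * (w * z) by rewrite mulrCA.
have toq z : T z -> quoI w (w * z).
  by move=> Tz; exists z => //; rewrite subrr; exact: curve_eq0.
have quoE z : T z -> quoI (w * w') (w * z) <-> quoI w' z.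
  move=> Tz; split=> -[a Ta Ia]; exists a => //.
    have Tza : T (z - w' * a) by inT.
    by case: (curve_eq_prime Tw Tza) => //; rewrite mulrBr mulrA.
  by rewrite -mulrA -mulrBr; exact: curve_eqM.
have [l' Tl'] : exists l', qdim kap T (quoI w') l'.
  apply: (qdim_embed (k := kap) mulD mulZ toq) wm => //.
  - exact: subsp_salg.
  - exact: subsp_quoI.
  - exact: subsp_quoI.
  - by move=> z /quoE[].
exists l, l'; split=> //.
have wl' : qdim kap (quoI w) (quoI (w * w')) l'.
  apply: (qdim_iso (k := kap) mulD mulZ toq) Tl' => //.
  - exact: subsp_salg.
  - exact: subsp_quoI.
  - move=> z [a Ta Ia]; exists a => //; exists 0; first by inT.
    by rewrite mulr0 subr0.
apply: (qdim_uniq (subsp_quoI (w * w')) Tn).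
apply: (qdim_add _ _ _ _ _ Tl wl') => //; try exact: subsp_quoI.
- exact: subsp_salg.
- exact: quoI_T.
Qed.

Lemma quoI_proper w l : mid T x y w -> qdim kap T (quoI w) l -> (0 < l)%N.
Proof.
move=> mw; case: l => // /(qdim0 _ (subsp_quoI w))/(_ 1); case; first by inT.
move=> a Ta /curve_eq_mid m1; case: T1; rewrite -(subrK (w * a) 1).
by apply: (midD sT) => //; rewrite mulrC; exact: (midM sT).
Qed.

Let curve_eq_x n w : T w -> I (x ^+ n * w) -> T w^-1 -> w != 0 -> False.
Proof. by move=> Tw /(curve_eq_cancel Tw)/curve_eq_mid; exact: mid_notunit. Qed.

Lemma inter_exists f : ~ divides q f -> exists n, inter q f n.
Proof. exact: (irred_colength HR xyP x00 qi). Qed.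

(** Some x^a e in the maximal ideal of R has a finite intersection number with q, and x is one of
    its factors. *)
Lemma exc_mult : exists2 b, (0 < b)%N & qdim kap T (quoI x) b.
Proof.
have [f [a [e [mf Te Tei e0 fE]]]] := pl_gen pl.
have qf : ~ divides q f.
  by move=> /base_curve_eq; rewrite fE => /curve_eq_x; apply.
have [n fn] := inter_exists qf; have := inter_quoI qf fn.
have mfT : mid T x y f%:F by apply: (mulset_mid _ sT); exact: (pl_mR pl).
case: a fE => [|a] fE.
  by move: mfT; rewrite fE mul1r => me; case: (mid_notunit me Tei e0).
have Ix : ~ I x.
  move=> Ix; apply: (@curve_eq_x 1 1); rewrite ?expr1 ?mulr1 ?invr1 ?oner_neq0 //; inT.
have Txe : T (x ^+ a * e) by inT.
rewrite fE exprS -mulrA => /(quoI_mul Tx Txe Ix)[b [_ [xb _ _]]].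
by exists b => //; apply: quoI_proper xb; exact: (midx _ _ sT).
Qed.

(* The intersection multiplicity at T of the strict transform of q with x = 0. *)
Definition mult b : Prop := qdim kap T (quoI x) b.

(* The divisor of f is v(f) times x = 0 plus its strict transform; l is the
   intersection multiplicity of the latter with the strict transform of q. *)
Lemma inter_place b f n : mult b -> ~ divides q f -> inter q f n ->
  exists l, n = (v f * b + l)%N /\ (l = 0 <-> ~ passes v T x y f).
Proof.
move=> xb qf /(inter_quoI qf).
have Ix : ~ I x.
  move=> Ix; apply: (@curve_eq_x 1 1); rewrite ?expr1 ?mulr1 ?invr1 ?oner_neq0 //; inT.
have f0 : f != 0 by apply/eqP => f0; apply: qf; exists 0; rewrite f0 mulr0.
have [z [Tz _ fE]] := pl_val pl f0.
have passE : passes v T x y f = mid T x y z.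
  by rewrite /passes fE mulrC mulKf // expf_neq0.
rewrite passE fE => fn.
have [l [zl nE]] : exists l, qdim kap T (quoI z) l /\ n = (v f * b + l)%N.
  elim: (v f) n fn => [|k IHk] n; first by rewrite mul1r; exists n.
  have Txz : T (x ^+ k * z) by inT.
  rewrite exprS -mulrA => /(quoI_mul Tx Txz Ix)[b' [l' [xb' /IHk[l [zl ->]] ->]]].
  exists l; split=> //; rewrite (qdim_uniq (subsp_quoI x) xb' xb) mulSn; lia.
exists l; split=> //; split=> [l0 mz|nmz].
  by have := quoI_proper mz zl; rewrite l0.
have Tzi : T z^-1 by have [_ _ _ _ Tu _] := pl_local pl; exact: Tu.
apply: (qdim_uniq (subsp_quoI z) zl); apply/(qdim0 _ (subsp_quoI z)) => t Tt.
exists (z^-1 * t); first by inT.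
rewrite mulVKf ?subrr; first exact: curve_eq0.
by apply/eqP => z_0; apply: nmz; rewrite z_0; exists 0, 0; split; [inT|inT|ring].
Qed.

(** The colength of u = w z in T / I is the sum of those of w and z, and the latter is positive if z
    vanishes at the closed point. *)
Lemma inter_frac u w z n n' : ~ divides q u -> ~ divides q w -> T z ->
  w%:F * z = u%:F -> inter q u n -> inter q w n' ->
  (n' <= n)%N /\ (mid T x y z -> (n' < n)%N).
Proof.
move=> qu qw Tz wz /(inter_quoI qu) un /(inter_quoI qw) wn'.
have Iw : ~ I w%:F by move/curve_eq_base.
move: un; rewrite -wz => /(quoI_mul (TR w) Tz Iw)[l [l' [wl zl' ->]]].
rewrite (qdim_uniq (subsp_quoI _) wl wn'); split; first exact: leq_addr.
by move=> /quoI_proper/(_ zl'); lia.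
Qed.

Lemma mult1 b : mult b -> (forall z, mid T x y z -> exists2 t, T t & I (z - x * t)) ->
  b = 1%N.
Proof.
move=> xb mI; apply: (qdim_uniq (subsp_quoI x) xb).
exists (fun=> 1); split=> [_|c|z Tz]; first by inT.
  rewrite /comb big_ord1 mulr1 => -[a Ta /curve_eq_mid mc].
  have {}mc : mid T x y (kap (c 0 0)).
    rewrite -(subrK (x * a) (kap _)); apply: (midD sT) => //.
    by rewrite mulrC; apply: (midM sT) => //; exact: (midx _ _ sT).
  apply/rowP => j; rewrite ord1 mxE; apply/eqP; apply/negPn/negP => c0.
  apply: (mid_notunit mc); last by rewrite fmorph_eq0.
  by rewrite -fmorphV; inT.
have [_ _ _ res _ _] := pl_local pl; have [c /mI[t Tt It]] := res z Tz.
by exists (\row__ c); exists t => //; rewrite /comb big_ord1 mxE mulr1.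
Qed.

End Places.

Section TwoPlaces.
Variables (K : fieldType) (R : idomainType) (iota : {rmorphism K -> R}).
Local Notation F := {fraction R}.
Local Notation mR := (maxideal [set: R]).
Hypothesis HR : complete_regular_local_ring iota 2.
Variables x0 y0 : R.
Hypothesis xyP : forall f, mR f <-> exists a b, f = a * x0 + b * y0.
Hypothesis x00 : x0 != 0.

(* In a separated model, distinct points satisfy this unless one of them
   specializes to the other. *)
Definition sep (T T' : set F) := exists z, maxideal T z /\ T' z^-1 /\ z != 0.

(** Write the separating z as u / w with u, w in R. Seen from [T], the intersection number of q with
    u exceeds that of q with w; seen from [T'], where the inverse of z is regular, it does not. *)
Lemma sep_passes v v' T T' x y x' y' q : place iota v T x y -> place iota v' T' x' y' ->
  irreducible_elt q -> sep T T' -> passes v T x y q -> passes v' T' x' y' q -> False.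
Proof.
move=> pl pl' qi [z [mz [Tz' z0]]] qT qT'.
have [_ _ qprime] := irred_prime HR xyP x00 qi.
have mz' : mid T x y z by rewrite -(mid_maxideal (pl_local pl)).
have Tz : T z by case: mz.
have [u [w [qw zw]]] := frac_denom HR xyP x00 pl qi qT Tz.
have [u' [w' [qw' zw']]] := frac_denom HR xyP x00 pl' qi qT' Tz'.
have uu' : u * u' = w * w'.
  apply/eqP; rewrite -tofrac_eq !tofracM -zw -zw'; apply/eqP.
  by rewrite mulrACA mulfV // mul1r.
have qu : ~ divides q u.
  by move=> [h uE]; have [||] := qprime w w'; first by exists (h * u'); rewrite -uu' uE mulrA.
have [n un] := inter_exists HR xyP x00 qi qu.
have [m wm] := inter_exists HR xyP x00 qi qw.
have wz : w%:F * z = u%:F by rewrite mulrC.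
have uz : u%:F * z^-1 = w%:F by rewrite -zw mulrAC mulfV // mul1r.
have [_ /(_ mz') h1] := inter_frac HR xyP x00 pl qi qT qu qw Tz wz un wm.
have [h2 _] := inter_frac HR xyP x00 pl' qi qT' qw qu Tz' uz wm un.
by have := leq_trans h1 h2; rewrite ltnn.
Qed.

End TwoPlaces.

(** * Charts and blow-ups *)

Section PolynomialRings.
Variables (K F : fieldType) (k : {rmorphism K -> F}) (S : set F).
Hypothesis sS : salg k S.

Definition polyin (P : {poly F}) : Prop := forall i, S P`_i.

Definition adjoin (t : F) : set F := [set z | exists2 P, polyin P & z = P.[t]].

Lemma polyinD P Q : polyin P -> polyin Q -> polyin (P + Q).
Proof. by move=> PS QS i; rewrite coefD; exact: (salgD sS (PS i) (QS i)). Qed.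

Lemma polyinN P : polyin P -> polyin (- P).
Proof. by move=> PS i; rewrite coefN; exact: (salgN sS (PS i)). Qed.

Lemma polyinM P Q : polyin P -> polyin Q -> polyin (P * Q).
Proof.
by move=> PS QS i; rewrite coefM; apply: (salg_sum _ _ sS) => j; apply: (salgM sS).
Qed.

Lemma polyinC c : S c -> polyin c%:P.
Proof. by move=> Sc i; rewrite coefC; case: eqP => // _; exact: (salg0 sS). Qed.

Lemma polyinX : polyin 'X.
Proof. by move=> i; rewrite coefX; case: eqP => _; [exact: (salg1 sS)|exact: (salg0 sS)]. Qed.

Lemma polyin_map (p : {poly K}) : polyin (map_poly k p).
Proof. by move=> i; rewrite coef_map; exact: (salgK _ sS). Qed.

Lemma adjoin_sub t : S `<=` adjoin t.
Proof. by move=> c Sc; exists c%:P; [exact: polyinC|rewrite hornerC]. Qed.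

Lemma adjoin_gen t : adjoin t t.
Proof. by exists 'X; [exact: polyinX|rewrite hornerX]. Qed.

Lemma adjoin_salg t : salg k (adjoin t).
Proof.
split.
- by move=> c; apply: adjoin_sub; exact: (salgK _ sS).
- by move=> _ _ [P PS ->] [Q QS ->]; exists (P + Q); [exact: polyinD|rewrite hornerD].
- by move=> _ _ [P PS ->] [Q QS ->]; exists (P * Q); [exact: polyinM|rewrite hornerM].
Qed.

Lemma adjoin_ind t (D : set F) : S `<=` D -> D t ->
  (forall a b, D a -> D b -> D (a + b)) -> (forall a b, D a -> D b -> D (a * b)) ->
  adjoin t `<=` D.
Proof.
move=> SD Dt DD DM _ [P PS ->]; rewrite horner_coef.
apply: big_ind => [||i _]; [by apply: SD; exact: (salg0 sS)|exact: DD|].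
apply: (DM); first exact: (SD _ (PS i)).
by elim: (i : nat) => [|n IHn]; [exact: (SD _ (salg1 sS))|rewrite exprS; exact: DM].
Qed.

(** All large exponents are included, so that bounds combine under sums and products. *)
Lemma adjoin_clear t x : S x -> S (x * t) -> forall z, adjoin t z ->
  exists N, forall M, (N <= M)%N -> S (x ^+ M * z).
Proof.
move=> Sx Sxt; apply: adjoin_ind => [c Sc||a b [N aN] [M bM]|a b [N aN] [M bM]].
- by exists 0 => M _; apply: (salgM sS) => //; exact: (salgX _ sS).
- exists 1%N => -[|M] // _; rewrite exprSr -mulrA; apply: (salgM sS) => //;
  exact: (salgX _ sS).
- exists (maxn N M) => m; rewrite geq_max => /andP[Nm Mm]; rewrite mulrDr.
  by apply: (salgD sS) => //; [exact: aN|exact: bM].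
- exists (N + M)%N => m NMm.
  have -> : m = (N + (m - N))%N by lia.
  rewrite exprD mulrACA; apply: (salgM sS) => //; first exact: aN.
  by apply: bM; lia.
Qed.

End PolynomialRings.

(** * The affine chart of the blow-up of a regular point *)

Section RegularPair.
Variables (K F : fieldType) (k : {rmorphism K -> F}) (S : set F) (x y : F).
Hypothesis Sloc : local2 k S x y.
Hypotheses (x0 : x != 0) (y0 : y != 0).
Hypothesis reg : forall a b, S a -> S b -> a * y = b * x -> mulset x S a.

Let sS : salg k S. Proof. by case: Sloc. Qed.
Let Sx : S x. Proof. by case: Sloc. Qed.
Let Sy : S y. Proof. by case: Sloc. Qed.
Let t := y / x.
Let xt : x * t = y. Proof. by rewrite mulrC divfK. Qed.
Let A := adjoin S t.
Let sA : salg k A. Proof. exact: (adjoin_salg sS). Qed.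
Let SA : S `<=` A. Proof. exact: (adjoin_sub sS). Qed.
Let At : A t. Proof. exact: (adjoin_gen sS). Qed.
Let mS := maxideal S.
Let mSE : mS = mid S x y. Proof. exact: (mid_maxideal Sloc). Qed.

Let mid_x c : S c -> mid S x y (x * c).
Proof. by move=> Sc; apply: (mulset_mid _ sS); exists c. Qed.

(** Regularity of the pair makes the constant term divisible by y, say y a = t x a. Dividing the
    relation by t gives one of lower degree, with a coefficient changed by x a, which is in (x,
    y). *)
Lemma regular_root (Q : {poly F}) : polyin S Q -> Q.[t] = 0 -> forall i, mid S x y Q`_i.
Proof.
have [n] := ubnP (size Q).-1; elim: n Q => // n IHn Q; rewrite ltnS => sQ QS Qt.
have S00 : mid S x y 0 by exists 0, 0; split; [exact: salg0 sS|exact: salg0 sS|ring].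
have [Q1|Q1] := leqP (size Q) 1.
  move=> i; suff -> : Q = 0 by rewrite coef0.
  have QE := size1_polyC Q1; have Q0 : Q`_0 = 0 by move: Qt; rewrite {1}QE hornerC.
  by rewrite QE Q0 polyC0.
have {}sQ : (size Q <= n.+1)%N by lia.
have n0 : (0 < n)%N by lia.
pose Q' : {poly F} := \poly_(i < n) Q`_i.+1.
have Q'i i : Q'`_i = Q`_i.+1.
  by rewrite coef_poly; case: ltnP => // ni; rewrite nth_default // (leq_trans sQ).
have QE : Q = Q' * 'X + (Q`_0)%:P.
  by apply/polyP => -[|i]; rewrite coefD coefMX coefC /= ?add0r ?addr0 ?Q'i.
have Q'S : polyin S Q' by move=> i; rewrite Q'i.
have Q't : Q`_0 + t * Q'.[t] = 0 by rewrite -[RHS]Qt {2}QE hornerD hornerMX hornerC; ring.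
have [N NP] : exists N, forall M, (N <= M)%N -> S (x ^+ M * Q'.[t]).
  by apply: (adjoin_clear sS (t := t) Sx); [rewrite xt|exists Q'].
have [a Sa Q0] : mulset y S Q`_0.
  have H M s : S s -> Q`_0 * x ^+ M = y * s -> mulset y S Q`_0.
    elim: M s => [|M IHM] s Ss; first by rewrite mulr1 => ->; exists s.
    move=> eqs; have [||s' Ss' sE] := @reg s (Q`_0 * x ^+ M) Ss.
    - by apply: (salgM sS) => //; exact: (salgX _ sS).
    - by rewrite mulrC -eqs exprSr mulrA.
    by apply: (IHM s') => //; apply: (mulIf x0); rewrite -mulrA -exprSr eqs sE; ring.
  apply: (H N.+1 (- (x ^+ N * Q'.[t]))); first by apply: (salgN sS); exact: NP.
  have -> : Q`_0 = - (t * Q'.[t]) by apply/eqP; rewrite -addr_eq0 Q't.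
  by rewrite -xt exprS; ring.
have t0 : t != 0 by rewrite mulf_neq0 // invr_eq0.
have Q''t : (Q' + (x * a)%:P).[t] = 0.
  rewrite hornerD hornerC; apply: (mulfI t0); rewrite mulr0 -[RHS]Q't Q0 -xt; ring.
have Sxa : S (x * a) by exact: (salgM sS).
have mQ'' : forall i, mid S x y (Q' + (x * a)%:P)`_i.
  apply: IHn => //; last exact: (polyinD sS Q'S (polyinC sS Sxa)).
  have sQ' : (size (Q' + (x * a)%:P)%R <= n)%N.
    rewrite (leq_trans (size_polyD _ _)) // geq_max size_poly.
    by rewrite (leq_trans (size_polyC_leq1 _)).
  by move: sQ'; lia.
move=> [|i]; first by rewrite Q0 midC; apply: (mulset_mid _ sS); exists a.
rewrite -Q'i; have := mQ'' i; rewrite coefD coefC => mi.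
rewrite -[Q'`_i](addrK (if i == 0%N then x * a else 0)); apply: (midD sS) => //.
case: (i == 0%N); last by rewrite oppr0.
by rewrite -mulrN; apply: mid_x; exact: (salgN sS).
Qed.

Lemma ideal_in_self (B : set F) : salg k B -> ideal_in B B.
Proof.
by move=> sB; split=> //; [exact: (salg0 sB)|move=> ? ?; exact: (salgD sB)|move=> ? ?;
  exact: (salgM sB)].
Qed.

Lemma ideal_in_max : ideal_in S mS.
Proof.
rewrite mSE; split; first exact: (mid_sub sS).
- by rewrite -(mulr0 x); apply: mid_x; exact: (salg0 sS).
- by move=> a b; exact: (midD sS).
- by move=> a z Sa; exact: (midM sS).
Qed.

(** A form of degree n in x and y is x^n times a polynomial of degree at most n in t = y / x. *)
Lemma maxpow_poly n z : ideal_pow S mS n z ->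
  exists Q : {poly F}, [/\ polyin S Q, (size Q <= n.+1)%N & z = x ^+ n * Q.[t]].
Proof.
move: n z; apply: ideal_pow_ind.
- move=> z Sz; exists z%:P; split; [exact: (polyinC sS)|exact: size_polyC_leq1|].
  by rewrite hornerC mul1r.
- move=> n; exists 0; rewrite size_poly0 horner0 mulr0; split=> // i.
  by rewrite coef0; exact: (salg0 sS).
- move=> n _ _ [P [PS sP ->]] [Q [QS sQ ->]]; exists (P + Q); split.
  + exact: (polyinD sS).
  + by rewrite (leq_trans (size_polyD _ _)) // geq_max sP.
  + by rewrite hornerD mulrDr.
- move=> n a b; rewrite mSE => -[c [d [Sc Sd ->]]] [Q [QS sQ ->]].
  exists (c%:P * Q + d%:P * Q * 'X); split.
  + by apply: (polyinD sS); [|apply: (polyinM sS); last exact: (polyinX sS)];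
      apply: (polyinM sS) => //; exact: (polyinC sS).
  + rewrite (leq_trans (size_polyD _ _)) // geq_max !mul_polyC.
    rewrite (leq_trans (size_scale_leq _ _)) ?(leqW sQ) //=.
    rewrite (leq_trans (size_polyMleq _ _)) // size_polyX addn2 /= ltnS.
    exact: (leq_trans (size_scale_leq _ _)).
  + by rewrite hornerD hornerMX !hornerM !hornerC -xt exprS; ring.
Qed.

Lemma maxpow_mono i j c : S c -> ideal_pow S mS (i + j) (x ^+ i * y ^+ j * c).
Proof.
move=> Sc; rewrite -mulrA; elim: i => [|i IHi].
  rewrite mul1r; apply: ideal_powX => //; rewrite mSE midC; exact: (midx _ _ sS).
rewrite exprS -mulrA; apply: ideal_mulr => //; rewrite mSE; exact: (midx _ _ sS).
Qed.

Lemma maxpow_sum n (Q : {poly F}) m : (size Q <= n.+1)%N ->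
  (forall i, (i <= n)%N -> ideal_pow S mS m (x ^+ (n - i) * y ^+ i * Q`_i)) ->
  ideal_pow S mS m (x ^+ n * Q.[t]).
Proof.
move=> sQ Qi; rewrite (horner_coef_wide _ sQ) mulr_sumr.
have iS := ideal_in_self sS.
apply: big_ind => [|a b|i _]; first 1 last.
- exact: ideal_powD.
- have -> : x ^+ n * (Q`_i * t ^+ i) = x ^+ (n - i) * y ^+ i * Q`_i.
    have xn : x ^+ n = x ^+ (n - i) * x ^+ i by rewrite -exprD subnK // -ltnS.
    by rewrite xn -xt [(x * t) ^+ i]exprMn; ring.
  by apply: Qi; rewrite -ltnS.
have := ideal_powM iS ideal_in_max (salg0 sS) (Qi 0%N isT).
by rewrite mul0r.
Qed.

Lemma poly_maxpow n (Q : {poly F}) : polyin S Q -> (size Q <= n.+1)%N ->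
  ideal_pow S mS n (x ^+ n * Q.[t]).
Proof.
move=> QS sQ; apply: maxpow_sum => // i ni.
by rewrite -{1}(subnK ni); exact: maxpow_mono.
Qed.

Lemma poly_maxpowS n (Q : {poly F}) : (forall i, mid S x y Q`_i) -> (size Q <= n.+1)%N ->
  ideal_pow S mS n.+1 (x ^+ n * Q.[t]).
Proof.
move=> Qm sQ; apply: maxpow_sum => // i ni.
rewrite mulrC; apply: ideal_mulr; first by rewrite mSE.
by have := maxpow_mono (n - i) i (salg1 sS); rewrite subnK // mulr1.
Qed.

(** This compares the order along the exceptional curve with the order at the point. By induction s
    = x^n Q(t); one more factor x gives Q(t) = x P(t), and [regular_root] puts the coefficients of Q
    into the maximal ideal. *)
Lemma maxpow_chart n s : S s -> mulset (x ^+ n) A s -> ideal_pow S mS n s.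
Proof.
move=> Ss; elim: n => [//|n IHn] [_ [P PS ->] sE].
have /maxpow_poly[Q [QS sQ sE']] : ideal_pow S mS n s.
  apply: IHn; exists (x * P.[t]); last by rewrite sE exprSr mulrA.
  by apply: (salgM sA); [exact: SA|exists P].
have Qt : (Q - x%:P * P).[t] = 0.
  rewrite hornerD hornerN hornerM hornerC; apply/eqP; rewrite subr_eq0; apply/eqP.
  by apply: (mulfI (expf_neq0 n x0)); rewrite -sE' sE exprSr mulrA.
have xPS : polyin S (x%:P * P) by apply: (polyinM sS) => //; exact: (polyinC sS).
have QxPm := regular_root (polyinD sS QS (polyinN sS xPS)) Qt.
rewrite sE'; apply: poly_maxpowS => // i; rewrite -[Q`_i](subrK (x * P`_i)).
apply: (midD sS); last exact: mid_x.
by have := QxPm i; rewrite coefB coefCM.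
Qed.

Lemma adjoin_chart : blowup_chart S x = A.
Proof.
apply/seteqP; split=> z.
  move=> [n [s [/maxpow_poly[Q [QS _ ->]] ->]]].
  by exists Q => //; rewrite mulrC mulKf // expf_neq0.
move=> [P PS ->]; exists (size P), (x ^+ size P * P.[t]); split.
  exact: poly_maxpow.
by rewrite [RHS]mulrC mulKf // expf_neq0.
Qed.

(** Elements of [S] are constants modulo (x, y), and y = x t is divisible by x in the chart. *)
Lemma adjoin_dec a : A a -> exists p : {poly K}, mulset x A (a - (map_poly k p).[t]).
Proof.
move: a; apply: (adjoin_ind sS) => [c Sc||a b [p [u Au aE]] [q [w Aw bE]]
  |a b [p [u Au aE]] [q [w Aw bE]]].
- have [_ _ _ res _ _] := Sloc; have [d [u [w [Su Sw cE]]]] := res c Sc.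
  exists d%:P; rewrite map_polyC hornerC cE; exists (u + t * w).
    by apply: (salgD sA); [exact: SA|apply: (salgM sA) => //; exact: SA].
  by rewrite -xt; ring.
- exists 'X; rewrite map_polyX hornerX subrr.
  by exists 0; [exact: (salg0 sA)|rewrite mulr0].
- exists (p + q); rewrite rmorphD hornerD; exists (u + w); first exact: (salgD sA).
  by rewrite mulrDr -aE -bE; ring.
- exists (p * q); rewrite rmorphM hornerM.
  exists (u * b + (map_poly k p).[t] * w).
    have Apt r : A (map_poly k r).[t] by exists (map_poly k r) => //; exact: (polyin_map sS).
    have Ab : A b by rewrite -[b](subrK (map_poly k q).[t]) bE; apply: (salgD sA) => //;
      apply: (salgM sA) => //; exact: SA.
    by apply: (salgD sA); exact: (salgM sA).
  have -> : b = x * w + (map_poly k q).[t] by rewrite -bE subrK.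
  have -> : a = x * u + (map_poly k p).[t] by rewrite -aE subrK.
  ring.
Qed.

(** [regular_root] applied to p - x P would put a nonzero coefficient of p, which is a unit, into
    (x, y). *)
Lemma adjoin_uniq (p : {poly K}) : mulset x A (map_poly k p).[t] -> p = 0.
Proof.
move=> [_ [P PS ->] pE].
have pt : (map_poly k p - x%:P * P).[t] = 0.
  by rewrite hornerD hornerN hornerM hornerC pE subrr.
have xPS : polyin S (x%:P * P) by apply: (polyinM sS) => //; exact: (polyinC sS).
have pm := regular_root (polyinD sS (polyin_map sS p) (polyinN sS xPS)) pt.
apply/polyP => i; rewrite coef0; apply/eqP/negPn/negP => pi0.
have [_ _ _ _ _ proper] := Sloc; apply: proper.
rewrite -(rmorph1 k) -(mulVf pi0) rmorphM; apply: (midM sS); first exact: (salgK _ sS).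
have := pm i; rewrite coefB coefCM coef_map => mi.
by rewrite -[k _](subrK (x * P`_i)); apply: (midD sS) => //; exact: mid_x.
Qed.

End RegularPair.

Section FieldIdentities.
Variable F : fieldType.
Implicit Types a b x y z : F.

Lemma divf_mul2 x y a b : y != 0 -> b != 0 -> (x * y * a) / (y * b) = x * (a / b).
Proof. by move=> y0 b0; field; rewrite y0 b0. Qed.

Lemma divf_mul2' x y a b : x != 0 -> y != 0 -> b != 0 ->
  (y * a) / (x * y * b) * x = a / b.
Proof. by move=> x0 y0 b0; field; rewrite x0 y0 b0. Qed.

Lemma invf_mul x y z : x != 0 -> y != 0 -> z != 0 -> z * y * (z * (x * y))^-1 = x^-1.
Proof. by move=> x0 y0 z0; field; rewrite x0 y0 z0. Qed.

End FieldIdentities.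

Section Localization.
Variables (K F : fieldType) (k : {rmorphism K -> F}) (A P : set F).
Hypotheses (sA : salg k A) (P0 : P 0) (P1 : ~ P 1).
Hypothesis PM : forall a b, A a -> A b -> ~ P a -> ~ P b -> ~ P (a * b).

Lemma loc_neq0 b : ~ P b -> b != 0.
Proof. by move=> Pb; apply/eqP => b0; apply: Pb; rewrite b0. Qed.

Lemma loc_sub : A `<=` localization A P.
Proof. by move=> a Aa; exists a, 1; split=> //; [exact: (salg1 sA)|rewrite divr1]. Qed.

Lemma loc_inv b : A b -> ~ P b -> localization A P b^-1.
Proof. by move=> Ab Pb; exists 1, b; split=> //; [exact: (salg1 sA)|rewrite mul1r]. Qed.

Lemma loc_salg : salg k (localization A P).
Proof.
split.
- by move=> c; apply: loc_sub; exact: (salgK _ sA).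
- move=> _ _ [a [b [Aa Ab Pb ->]]] [c [d [Ac Ad Pd ->]]].
  exists (a * d + c * b), (b * d); split.
  + by apply: (salgD sA); exact: (salgM sA).
  + exact: (salgM sA).
  + exact: PM.
  + by rewrite addf_div //; exact: loc_neq0.
- move=> _ _ [a [b [Aa Ab Pb ->]]] [c [d [Ac Ad Pd ->]]].
  exists (a * c), (b * d); split; [exact: (salgM sA)|exact: (salgM sA)|exact: PM|].
  by rewrite mulf_div.
Qed.

End Localization.

(** * Charts along an exceptional curve and their local rings *)

Section Charts.
Variables (K : fieldType) (R : idomainType) (iota : {rmorphism K -> R}).
Local Notation F := {fraction R}.
Local Notation mR := (maxideal [set: R]).
Local Notation k := (kap iota).

Definition ev (t : F) (p : {poly K}) : F := (map_poly k p).[t].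

(* An affine chart of a smooth surface over Spec R, containing a dense open
   subset of the exceptional curve x = 0, which has coordinate t. *)
Record chart (A : set F) (x t : F) : Prop := Chart {
  ch_alg : salg k A;
  ch_base : forall f, A f%:F;
  ch_x : A x;
  ch_t : A t;
  ch_x0 : x != 0;
  ch_dec : forall a, A a -> exists p, mulset x A (a - ev t p);
  ch_uniq : forall p, mulset x A (ev t p) -> p = 0;
  ch_sep : forall a, A a -> (forall n, mulset (x ^+ n) A a) -> a = 0;
  ch_mR : forall f, mR f -> mulset x A f%:F }.

(** A two-dimensional regular local ring with residue field K and parameters x, y. The notion is
    symmetric ([reg2_swap]), so both charts of the blow-up are covered by one argument. *)
Record reg2 (S : set F) (x y : F) : Prop := Reg2 {
  r_local : local2 k S x y;
  r_base : forall f, S f%:F;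
  r_x0 : x != 0;
  r_y0 : y != 0;
  r_reg : forall a b, S a -> S b -> a * y = b * x -> mulset x S a;
  r_sep : forall a, S a -> (forall n, ideal_pow S (maxideal S) n a) -> a = 0;
  r_mR : forall f, mR f -> mid S x y f%:F }.

Lemma reg2_swap S x y : reg2 S x y -> reg2 S y x.
Proof.
case=> -[sS Sx Sy res Su S1] Sb x0 y0 reg Ssep SmR; split=> //; try by move=> *;
  rewrite midC; auto.
- split=> //.
  + by move=> z Sz; rewrite midC; exact: res.
  + by move=> z Sz; rewrite midC; exact: Su.
  + by rewrite midC.
- move=> a b Sa Sb' ab; have [b' Sb'' bE] := reg b a Sb' Sa (esym ab).
  by exists b' => //; apply: (mulIf x0); rewrite ab bE; ring.
Qed.

(** For separatedness, a power of x brings an element of the chart into [S], where [maxpow_chart]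
    turns divisibility by all x^n into membership in all powers of the maximal ideal. *)
Lemma reg2_chart S x y : reg2 S x y -> chart (blowup_chart S x) x (y / x).
Proof.
case=> Sloc Sb x0 y0 reg Ssep SmR; have [sS Sx Sy _ _ _] := Sloc.
have xt : x * (y / x) = y by rewrite mulrC divfK.
rewrite (adjoin_chart Sloc x0).
have SA := adjoin_sub sS (y / x).
have sA := adjoin_salg sS (y / x).
have At := adjoin_gen sS (y / x).
split=> //.
- by move=> f; apply: SA.
- exact: SA.
- by move=> a /(adjoin_dec Sloc x0).
- exact: (adjoin_uniq Sloc x0 y0 reg).
- move=> a Aa ax; have [|N NP] := adjoin_clear sS Sx _ Aa; first by rewrite xt.

  apply: (mulfI (expf_neq0 N x0)); rewrite mulr0.
  apply: (Ssep _ (NP N (leqnn N))) => n.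
  apply: (maxpow_chart Sloc x0 y0 reg); first exact: NP.
  have [b Ab ->] := ax n; exists (x ^+ N * b); last by ring.
  by apply: (salgM sA) => //; apply: (salgX _ sA); exact: SA.
- move=> f /SmR[a [b [Sa Sb' ->]]]; exists (a + (y / x) * b); last by rewrite -{1}xt; ring.
  by apply: (salgD sA); [exact: SA|apply: (salgM sA) => //; exact: SA].
Qed.

Section OneChart.
Variables (A : set F) (x t : F).
Hypothesis ch : chart A x t.
Let sA : salg k A. Proof. exact: (ch_alg ch). Qed.
Let Ax : A x. Proof. exact: (ch_x ch). Qed.
Let At : A t. Proof. exact: (ch_t ch). Qed.
Let AR f : A f%:F. Proof. exact: (ch_base ch). Qed.
Let x0 : x != 0. Proof. exact: (ch_x0 ch). Qed.

Definition lead (a : F) (p : {poly K}) : Prop := mulset x A (a - ev t p).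

(* The local rings at the generic point of x = 0 and at its point t = c. *)
Definition chC : set F := localization A (mulset x A).
Definition chT c : set F := localization A (mid A x (t - k c)).

Lemma A_ev p : A (ev t p).
Proof.
rewrite /ev horner_coef; apply: (salg_sum _ _ sA) => i; rewrite coef_map.
by apply: (salgM sA); [exact: (salgK _ sA)|exact: (salgX _ sA)].
Qed.

Lemma lead_ex a : A a -> exists p, lead a p.
Proof. exact: (ch_dec ch). Qed.

Lemma mulsetN a : mulset x A a -> mulset x A (- a).
Proof. by case=> b Ab ->; exists (- b); [exact: (salgN sA)|rewrite mulrN]. Qed.

Lemma lead_uniq a p q : lead a p -> lead a q -> p = q.
Proof.
move=> ap aq; apply/eqP; rewrite -subr_eq0; apply/eqP; apply: (ch_uniq ch).
rewrite /ev rmorphB hornerD hornerN.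
rewrite [X in mulset _ _ X](_ : _ = (a - ev t q) - (a - ev t p)); last by rewrite /ev; ring.
by apply: (mulsetD sA) => //; exact: mulsetN.
Qed.

Lemma leadD a b p q : lead a p -> lead b q -> lead (a + b) (p + q).
Proof.
rewrite /lead /ev rmorphD hornerD opprD addrACA => ap bq; exact: (mulsetD sA).
Qed.

Lemma leadM a b p q : A a -> A b -> lead a p -> lead b q -> lead (a * b) (p * q).
Proof.
move=> Aa Ab ap bq; rewrite /lead /ev rmorphM hornerM.
rewrite [X in mulset _ _ X](_ : _ = b * (a - ev t p) + ev t p * (b - ev t q)); last first.
  by rewrite /ev; ring.
by apply: (mulsetD sA); apply: (mulset_subp sA) => //; exact: A_ev.
Qed.

Lemma leadK c : lead (k c) c%:P.
Proof.
rewrite /lead /ev map_polyC hornerC subrr; exists 0; first exact: (salg0 sA).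
by rewrite mulr0.
Qed.

Lemma leadZ c a p : A a -> lead a p -> lead (k c * a) (c *: p).
Proof.
move=> Aa ap; rewrite -mul_polyC; apply: leadM => //; last exact: leadK.
exact: (salgK _ sA).
Qed.

Lemma lead_t : lead t 'X.
Proof.
rewrite /lead /ev map_polyX hornerX subrr; exists 0; first exact: (salg0 sA).
by rewrite mulr0.
Qed.

Lemma lead_ev p : lead (ev t p) p.
Proof. by exists 0; [exact: (salg0 sA)|rewrite mulr0 subrr]. Qed.

Lemma lead0 a : lead a 0 <-> mulset x A a.
Proof. by rewrite /lead /ev rmorph0 horner0 subr0. Qed.

Lemma mulsetA a b : A a -> A b -> mulset x A (a * b) -> mulset x A a \/ mulset x A b.
Proof.
move=> Aa Ab /lead0 ab0; have [p ap] := lead_ex Aa; have [q bq] := lead_ex Ab.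
have /eqP := lead_uniq ab0 (leadM Aa Ab ap bq).
rewrite eq_sym mulf_eq0 => /orP[]/eqP z.
  by left; apply/lead0; rewrite -z.
by right; apply/lead0; rewrite -z.
Qed.

Lemma mid_lead c a p : A a -> lead a p -> mid A x (t - k c) a <-> p.[c] = 0.
Proof.
move=> Aa ap; split.
  move=> [u [w [Au Aw aE]]]; have [q wq] := lead_ex Aw.
  have tc : lead (t - k c) ('X - c%:P).
    by rewrite -(rmorphN k) -polyCN; apply: leadD; [exact: lead_t|exact: leadK].
  have Atc : A (t - k c) by apply: (salgB sA) => //; exact: (salgK _ sA).
  have := leadM Atc Aw tc wq.
  have xu0 : lead (x * u) 0 by apply/lead0; exists u.
  move/(leadD xu0); rewrite add0r -aE => /(lead_uniq ap) ->.
  by rewrite hornerM hornerXsubC subrr mul0r.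
move=> /eqP/factor_theorem[q pE].
have [w Aw aE] := ap.
exists w, (ev t q); split=> //; first exact: A_ev.
rewrite -[a](subrK (ev t p)) aE pE /ev rmorphM hornerM rmorphB /= map_polyX map_polyC.
by rewrite hornerXsubC; ring.
Qed.

Lemma mulset_midA c a : mulset x A a -> mid A x (t - k c) a.
Proof. exact: (mulset_mid _ sA). Qed.

Lemma x_notunit a : A a -> x * a = 1 -> False.
Proof.
move=> Aa xa; have : lead 1 0 by apply/lead0; exists a.
have := leadK 1; rewrite rmorph1 => /lead_uniq H /H/eqP; rewrite polyC1 => h.
by rewrite oner_eq0 in h.
Qed.

Lemma mulset1 : ~ mulset x A 1.
Proof. by move=> [a Aa /esym]; exact: x_notunit. Qed.

Lemma mulset0 : mulset x A 0.
Proof. by exists 0; [exact: (salg0 sA)|rewrite mulr0]. Qed.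

Lemma lead_neq0 a p : lead a p -> ~ mulset x A a -> p != 0.
Proof. by move=> ap ax; apply/eqP => p0; apply: ax; apply/lead0; rewrite -p0. Qed.

Lemma chart_order a : A a -> a != 0 ->
  exists n b, [/\ A b, ~ mulset x A b & a = x ^+ n * b].
Proof.
move=> Aa /eqP a0; have exn : exists n, `[< ~ mulset (x ^+ n) A a >].
  apply: contrapT => nex; apply: a0; apply: (ch_sep ch) => // n.
  by apply: contrapT => an; apply: nex; exists n; apply/asboolP.
have [[|n] /asboolP nP nmin] := ex_minnP exn.
  by case: nP; exists a => //; rewrite mul1r.
have [b Ab aE] : mulset (x ^+ n) A a.
  by apply: contrapT => /asboolP/nmin; rewrite ltnn.
exists n, b; split=> // -[c Ac bE]; apply: nP; exists c => //.
by rewrite aE bE exprSr mulrA.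
Qed.

Let PMC a b : A a -> A b -> ~ mulset x A a -> ~ mulset x A b -> ~ mulset x A (a * b).
Proof. by move=> Aa Ab xa xb /(mulsetA Aa Ab)[]. Qed.

Lemma chC_salg : salg k chC.
Proof. exact: (loc_salg sA mulset0 mulset1 PMC). Qed.

Lemma A_chC : A `<=` chC.
Proof. exact: (loc_sub sA mulset1). Qed.

Lemma chC_unit b : A b -> ~ mulset x A b -> chC b^-1.
Proof. exact: (loc_inv sA). Qed.

(** Denominators avoid the prime xA, so factors x of a w are factors of a. *)
Lemma loc_mulset (P : set F) a n : P 0 -> mulset x A `<=` P -> A a ->
  mulset (x ^+ n) (localization A P) a -> mulset (x ^+ n) A a.
Proof.
move=> P0 xP; elim: n a => [|n IHn] a Aa; first by move=> _; exists a; rewrite ?mul1r.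
move=> [_ [u [w [Au Aw Pw ->]]] aE].
have w0 := loc_neq0 P0 Pw.
have eq1 : a * w = x * (x ^+ n * u) by rewrite aE mulrA divfK // exprS -!mulrA.
have xaw : mulset x A (a * w).
  by exists (x ^+ n * u) => //; apply: (salgM sA) => //; exact: (salgX _ sA).
have [[b Ab aE']|/xP//] := mulsetA Aa Aw xaw.
have [|c Ac bE] := IHn b Ab.
  exists (u / w); first by exists u, w.
  by apply: (mulfI x0); rewrite -aE' aE exprS -mulrA.
by exists c => //; rewrite aE' bE exprS mulrA.
Qed.

Lemma chC_mulset a n : A a -> mulset (x ^+ n) chC a -> mulset (x ^+ n) A a.
Proof. exact: (loc_mulset mulset0 (fun _ => id)). Qed.

(** [chC] is the valuation ring of the order along x = 0; the two alternatives are a nonnegative and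
    a nonpositive order. *)
Lemma chC_dvr z : z != 0 -> exists n e,
  [/\ chC e, chC e^-1, e != 0 & z = x ^+ n * e \/ z * x ^+ n = e].
Proof.
move=> z0; have [u [w [w0 zw]]] := fracP z.
have wF0 : w%:F != 0 by rewrite tofrac_eq0.
have uF0 : u%:F != 0 by rewrite -zw mulf_neq0.
have [n [a [Aa xa uE]]] := chart_order (AR u) uF0.
have [m [b [Ab xb wE]]] := chart_order (AR w) wF0.
have a0 := loc_neq0 mulset0 xa; have b0 := loc_neq0 mulset0 xb.
have Ce : chC (a / b) by exists a, b.
have Cei : chC (a / b)^-1 by rewrite invf_div; exists b, a.
have e0 : a / b != 0 by rewrite mulf_neq0 // invr_eq0.
have zE : z = (x ^+ n * a) / (x ^+ m * b) by rewrite -uE -wE -zw mulfK.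
have xn0 j : x ^+ j != 0 by rewrite expf_neq0.
have [mn|nm] := leqP m n.
  exists (n - m)%N, (a / b); split=> //; left; rewrite zE.
  have -> : x ^+ n = x ^+ (n - m) * x ^+ m by rewrite -exprD subnK.
  by rewrite divf_mul2.
exists (m - n)%N, (a / b); split=> //; right; rewrite zE.
have -> : x ^+ m = x ^+ (m - n) * x ^+ n by rewrite -exprD subnK // ltnW.
by rewrite divf_mul2'.
Qed.

Lemma chC_x : ~ chC x^-1.
Proof.
move=> [a [b [Aa Ab xb xE]]]; apply: xb; exists a => //.
have b0 : b != 0 by apply/eqP => b0; move: xE; rewrite b0 invr0 mulr0 => /eqP;
  rewrite invr_eq0 (negPf x0).
by by apply: (mulfI (invr_neq0 x0)); rewrite mulKf // xE divfK.
Qed.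

Lemma chC_max : maxideal chC = mulset x chC.
Proof.
apply/seteqP; split=> z.
  move=> [Cz nu]; have [->|z0] := eqVneq z 0.
    by exists 0; [exact: (salg0 chC_salg)|rewrite mulr0].
  have [[|n] [e [Ce Cei e0 [zE|zE]]]] := chC_dvr z0.
  - by case: nu; exists e^-1 => //; rewrite zE mul1r mulfV.
  - by case: nu; exists e^-1 => //; rewrite -zE mulr1 mulfV.
  - exists (x ^+ n * e); last by rewrite zE exprS mulrA.
    by apply: (salgM chC_salg) => //; apply: (salgX _ chC_salg); exact: A_chC.
  - case: chC_x; have -> : x^-1 = z * x ^+ n * e^-1.
      by rewrite -zE exprS invf_mul // expf_neq0.
    apply: (salgM chC_salg) => //; apply: (salgM chC_salg) => //.
    by apply: (salgX _ chC_salg); exact: A_chC.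
move=> [a Ca ->]; split.
  by apply: (salgM chC_salg) => //; exact: A_chC.
move=> [b Cb xab]; apply: chC_x.
rewrite -[x^-1]mulr1 -xab -!mulrA mulKf //; exact: (salgM chC_salg).
Qed.

(** An element outside the discrete valuation ring forces the inverse of x into [T], hence all of
    F. *)
Lemma chC_over (T : set F) : salg k T -> chC `<=` T -> T `<=` chC \/ T = setT.
Proof.
move=> sT CT; have [?|nTC] := pselect (T `<=` chC); [by left|right].
have [z [Tz Cz]] : exists z, T z /\ ~ chC z.
  by apply: contrapT => nex; apply: nTC => z Tz; apply: contrapT => Cz; apply: nex; exists z.
have z0 : z != 0 by apply/eqP => z0; apply: Cz; rewrite z0; exact: (salg0 chC_salg).
have Cx n : chC (x ^+ n) by apply: (salgX _ chC_salg); exact: A_chC.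
have Tx : T x^-1.
  have [[|n] [e [Ce Cei e0 [zE|zE]]]] := chC_dvr z0.
  - by case: Cz; rewrite zE; apply: (salgM chC_salg).
  - by case: Cz; move: zE; rewrite mulr1 => ->.
  - by case: Cz; rewrite zE; apply: (salgM chC_salg).
  - have -> : x^-1 = z * (x ^+ n * e^-1).
      by rewrite -zE exprS mulrA invf_mul // expf_neq0.
    by apply: (salgM sT) => //; apply: CT; apply: (salgM chC_salg).
apply/seteqP; split=> // w _; have [->|w0] := eqVneq w 0; first exact: (salg0 sT).
have [n [e [Ce Cei e0 [wE|wE]]]] := chC_dvr w0.
  by apply: CT; rewrite wE; apply: (salgM chC_salg).
have -> : w = e * x^-1 ^+ n by rewrite -wE exprVn mulfK // expf_neq0.
by apply: (salgM sT); [exact: CT|exact: (salgX _ sT)].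
Qed.

Section ClosedPoint.
Variable c : K.
Local Notation y := (t - k c).
Local Notation T := (chT c).

Let Ay : A y. Proof. by apply: (salgB sA) => //; exact: (salgK _ sA). Qed.

Lemma lead_y : lead y ('X - c%:P).
Proof. by rewrite -(rmorphN k) -polyCN; apply: leadD; [exact: lead_t|exact: leadK]. Qed.

Let mid0 : mid A x y 0.
Proof. by apply: mulset_midA; exact: mulset0. Qed.

Let lead1 : lead 1 1.
Proof. by rewrite -(rmorph1 k) -polyC1; exact: leadK. Qed.

Let mid1 : ~ mid A x y 1.
Proof.
move=> /(mid_lead c (salg1 sA) lead1); rewrite hornerC => /eqP.
by rewrite oner_eq0.
Qed.

Let midPM a b : A a -> A b -> mid A x y (a * b) -> mid A x y a \/ mid A x y b.
Proof.
move=> Aa Ab; have [p ap] := lead_ex Aa; have [q bq] := lead_ex Ab.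
move=> /(mid_lead c (salgM sA Aa Ab) (leadM Aa Ab ap bq))/eqP.
rewrite hornerM mulf_eq0 => /orP[]/eqP pc; [left|right].
  exact/(mid_lead c Aa ap).
exact/(mid_lead c Ab bq).
Qed.

Let PMT a b : A a -> A b -> ~ mid A x y a -> ~ mid A x y b -> ~ mid A x y (a * b).
Proof. by move=> Aa Ab ax bx /(midPM Aa Ab)[]. Qed.

Lemma chT_salg : salg k T.
Proof. exact: (loc_salg sA mid0 mid1 PMT). Qed.

Lemma A_chT : A `<=` T.
Proof. exact: (loc_sub sA mid1). Qed.

Lemma chT_unit b : A b -> ~ mid A x y b -> T b^-1.
Proof. exact: (loc_inv sA). Qed.

Lemma chT_mulset a n : A a -> mulset (x ^+ n) T a -> mulset (x ^+ n) A a.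
Proof. by apply: loc_mulset => // z; exact: mulset_midA. Qed.

Lemma chT_mid a : A a -> mid T x y a -> mid A x y a.
Proof.
move=> Aa [_ [_ [[u [w [Au Aw mw ->]]] [u' [w' [Au' Aw' mw' ->]]] aE]]].
have w0 := loc_neq0 mid0 mw; have w'0 := loc_neq0 mid0 mw'.
have : mid A x y (a * (w * w')).
  exists (u * w'), (u' * w); split; try exact: (salgM sA).
  have wE : u / w * (w * w') = u * w' by rewrite mulrA divfK.
  have w'E : u' / w' * (w * w') = u' * w by rewrite [w * w']mulrC mulrA divfK.
  by rewrite aE mulrDl -(mulrA x) wE -(mulrA y) w'E.
by move=> /(midPM Aa (salgM sA Aw Aw'))[] // /(midPM Aw Aw')[].
Qed.

Lemma mid_chT a : mid A x y a -> mid T x y a.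
Proof. by move=> [u [w [Au Aw ->]]]; exists u, w; split=> //; exact: A_chT. Qed.

Lemma chT_local : local2 k T x y.
Proof.
have sT := chT_salg; split=> //; try exact: A_chT.
- move=> _ [a [b [Aa Ab mb ->]]]; have b0 := loc_neq0 mid0 mb.
  have [p ap] := lead_ex Aa; have [q bq] := lead_ex Ab.
  have qc : q.[c] != 0 by apply/eqP => qc; apply: mb; apply/(mid_lead c Ab bq).
  exists (p.[c] / q.[c]).
  have -> : a / b - k (p.[c] / q.[c]) = b^-1 * (a - k (p.[c] / q.[c]) * b).
    by rewrite mulrBr mulrCA mulVf // mulr1 mulrC.
  apply: (midM sT); first exact: chT_unit.
  apply: mid_chT; have Akb : A (- (k (p.[c] / q.[c]) * b)).
    by apply: (salgN sA); apply: (salgM sA) => //; exact: (salgK _ sA).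
  apply/(mid_lead c (salgD sA Aa Akb) (p := p + (- (p.[c] / q.[c])) *: q)).
    by apply: leadD => //; rewrite -mulNr -rmorphN; exact: leadZ.
  by rewrite hornerD hornerZ mulNr divfK // subrr.
- move=> _ [a [b [Aa Ab mb ->]]] mab; rewrite invf_div; exists b, a; split=> //.
  move=> ma; apply: mab; rewrite mulrC; apply: (midM sT); first exact: chT_unit.
  exact: mid_chT.
- by move=> /(chT_mid (salg1 sA)).
Qed.

Lemma chT_prime a b : T a -> T b -> mulset x T (a * b) -> mulset x T a \/ mulset x T b.
Proof.
have sT := chT_salg.
have num u w : A u -> A w -> ~ mid A x y w -> mulset x T u -> mulset x T (u / w).
  move=> Au Aw mw xu; rewrite mulrC; apply: (mulset_subp sT) => //; exact: chT_unit.
move=> [u [w [Au Aw mw ->]]] [u' [w' [Au' Aw' mw' ->]]] xuu'.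
have w0 := loc_neq0 mid0 mw; have w'0 := loc_neq0 mid0 mw'.
have Auu' := salgM sA Au Au'.
have : mulset (x ^+ 1) A (u * u').
  apply: chT_mulset => //; rewrite expr1.
  have -> : u * u' = (w * w') * (u / w * (u' / w')).
    by rewrite mulf_div [RHS]mulrC divfK // mulf_neq0.
  by apply: (mulset_subp sT) => //; apply: (salgM sT); exact: A_chT.
rewrite expr1 => /(mulsetA Au Au')[[v Av vE]|[v Av vE]]; [left|right]; apply: num => //.
  by exists v => //; exact: A_chT.
by exists v => //; exact: A_chT.
Qed.

(** The numerator of z restricts to (t - c)^n times a polynomial not vanishing at c, and the latter
    is a unit of [T]. *)
Lemma chT_fin z : T z -> ~ mulset x T z ->
  exists n a b, [/\ T a, T b & y ^+ n = z * a + x * b].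
Proof.
have sT := chT_salg; move=> [u [w [Au Aw mw ->]]] xz.
have w0 := loc_neq0 mid0 mw.
have [p up] := lead_ex Au.
have p0 : p != 0.
  apply: (lead_neq0 up) => -[v Av uE]; apply: xz; exists (v / w).
    by apply: (salgM sT); [exact: A_chT|exact: chT_unit].
  by rewrite uE mulrA.
have [n [q]] := multiplicity_XsubC p c; rewrite p0 /= => qc pE.
have Aq := A_ev q.
have mq : ~ mid A x y (ev t q).
  by move=> /(mid_lead c Aq (lead_ev q)) q0; move/rootP: q0; rewrite (negPf qc).
have q0 := loc_neq0 mid0 mq.
have [v Av uE] := up.
exists n, (w / ev t q), (- (v / ev t q)); split.
- by apply: (salgM sT); [exact: A_chT|exact: chT_unit].
- by apply: (salgN sT); apply: (salgM sT); [exact: A_chT|exact: chT_unit].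
have pE' : ev t p = ev t q * y ^+ n.
  rewrite pE /ev rmorphM hornerM rmorphXn horner_exp rmorphB /= map_polyX map_polyC.
  by rewrite hornerXsubC.
have uE' : u = x * v + ev t q * y ^+ n by rewrite -uE -pE' subrK.
rewrite mulrN mulrA [u / w * w]divfK // mulrA -mulrBl uE' addrAC subrr add0r.
by rewrite mulrAC mulfV // mul1r.
Qed.

Lemma chT_y_notin_x : ~ mulset x T y.
Proof.
move=> xy; have := @chT_mulset y 1 Ay; rewrite expr1 => /(_ xy)/lead0/(lead_uniq lead_y)/eqP.
by rewrite polyXsubC_eq0.
Qed.

Lemma chT_ypow_notin_x n : ~ mulset x T (y ^+ n).
Proof.
have sT := chT_salg; elim: n => [|n IHn].
  by move=> /(mulset_mid _ sT) m1; case: chT_local => _ _ _ _ _; apply.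
rewrite exprS => /chT_prime[]; [exact: A_chT|apply: (salgX _ sT); exact: A_chT| |exact: IHn].
exact: chT_y_notin_x.
Qed.

(** Otherwise y^n lies in zT + xT for some n, and with z in xT + y^(n+1) T a unit times y^n would be
    divisible by x. *)
Lemma chT_sep_x z : T z ->
  (forall n, exists a b, [/\ T a, T b & z = x * a + y ^+ n * b]) -> mulset x T z.
Proof.
have sT := chT_salg; have [_ Tx Ty _ _ T1] := chT_local.
move=> Tz zsep; apply: contrapT => xz.
have [n [a [b [Ta Tb yE]]]] := chT_fin Tz xz.
have [u [w [Tu Tw zE]]] := zsep n.+1.
have Tyn : T (y ^+ n) by exact: (salgX _ sT).
have Tv : T (1 - y * (w * a)).
  by apply: (salgB sT); [exact: (salg1 sT)|do 2!apply: (salgM sT) => //].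
have : mulset x T (y ^+ n * (1 - y * (w * a))).
  exists (u * a + b); first by apply: (salgD sT) => //; exact: (salgM sT).
  by rewrite mulrBr mulr1 {1}yE {1}zE exprS; ring.
move=> /(chT_prime Tyn Tv)[]; first exact: chT_ypow_notin_x.
move=> /(mulset_mid _ sT) m; apply: T1; rewrite -(subrK (y * (w * a)) 1).
apply: (midD sT) => //; rewrite mulrC; apply: (midM sT); first exact: (salgM sT).
exact: (midy _ _ sT).
Qed.

(** For separatedness, an element of all powers of the maximal ideal is divisible by x
    ([chT_sep_x]), and its quotient by x lies in all powers again ([maxpow_chart]). So every x^n
    divides it, and its numerator is 0 in the chart. *)
Lemma chT_reg2 : reg2 T x y.
Proof.
have sT := chT_salg; have Tloc := chT_local; have [_ Tx Ty _ _ T1] := Tloc.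
have y0 : y != 0.
  apply/eqP => y0; apply: (@chT_ypow_notin_x 1); rewrite y0 expr0n /=.
  by exists 0; [exact: (salg0 sT)|rewrite mulr0].
have reg a b : T a -> T b -> a * y = b * x -> mulset x T a.
  move=> Ta Tb ab; have xay : mulset x T (a * y) by exists b => //; rewrite ab mulrC.
  by have [//|/chT_y_notin_x] := chT_prime Ta Ty xay.
split=> //.
- by move=> f; apply: A_chT; exact: AR.
- move=> a Ta am.
  have amx n : exists a', [/\ T a', (forall m, ideal_pow T (maxideal T) m a') & a = x ^+ n * a'].
    elim: n => [|n [a' [Ta' a'm aE]]]; first by exists a; split=> //; rewrite mul1r.
    have [b Tb bE] : mulset x T a'.
      apply: chT_sep_x => // m.
      have := a'm m; move: (a') => z; move: m z.
      apply: (ideal_pow_ind (P := fun m => [set z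
        | exists a b, [/\ T a, T b & z = x * a + y ^+ m * b]])).
      - move=> z Tz; exists 0, z; split=> //; first exact: (salg0 sT).
        by rewrite mulr0 add0r mul1r.
      - by move=> m; exists 0, 0; split;
        [exact: (salg0 sT)|exact: (salg0 sT)|rewrite !mulr0 addr0].
      - move=> m _ _ [u [w [Tu Tw ->]]] [u' [w' [Tu' Tw' ->]]].
        by exists (u + u'), (w + w'); split; [exact: (salgD sT)|exact: (salgD sT)|ring].
      - move=> m z z'; rewrite (mid_maxideal Tloc) =>
        -[u [w [Tu Tw ->]]] [u' [w' [Tu' Tw' ->]]].
        exists (u * (x * u' + y ^+ m * w') + y * w * u'), (w * w'); split.
        + apply: (salgD sT); last by do 2!apply: (salgM sT) => //.
          apply: (salgM sT) => //; apply: (salgD sT); apply: (salgM sT) => //.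
          exact: (salgX _ sT).
        + exact: (salgM sT).
        + by rewrite exprS; ring.
    exists b; split=> //; last by rewrite aE bE exprSr mulrA.
    move=> m; apply: (maxpow_chart Tloc x0 y0 reg) => //.
    have [Q [QT _ a'E]] := maxpow_poly Tloc x0 (a'm m.+1).
    exists Q.[y / x]; first by exists Q.
    by apply: (mulfI x0); rewrite -bE a'E exprS mulrA.
  have [u [w [Au Aw mw aE]]] := Ta; have w0 := loc_neq0 mid0 mw.
  rewrite aE (ch_sep ch Au) ?mul0r // => n; apply: chT_mulset => //.
  have [a' [Ta' _ aE']] := amx n; exists (a' * w); first by apply: (salgM sT) => //;
    exact: A_chT.
  by rewrite mulrA -aE' aE divfK.
- move=> f /(ch_mR ch)[b Ab ->]; rewrite mulrC; apply: (midM sT); first exact: A_chT.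
  exact: (midx _ _ sT).
Qed.

Definition chart_val (v : R -> nat) : Prop :=
  forall f, f != 0 -> exists a, [/\ A a, ~ mulset x A a & f%:F = x ^+ v f * a].

(** An element of the maximal ideal of R is x^n times a unit at t = c, so no other exceptional curve
    passes there. *)
Lemma chT_place v f n a p : chart_val v -> mR f -> f%:F = x ^+ n * a -> A a ->
  lead a p -> p.[c] != 0 -> place iota v T x y.
Proof.
move=> vA mf fE Aa ap pc; have sT := chT_salg; split=> //.
- exact: chT_local.
- by move=> g; apply: A_chT; exact: AR.
- exact: chT_prime.
- exact: chT_fin.
- have ma : ~ mid A x y a by move=> /(mid_lead c Aa ap)/eqP; rewrite (negPf pc).
  exists f, n, a; split=> //; [exact: A_chT|exact: chT_unit|exact: (loc_neq0 mid0 ma)].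
- by move=> g /(ch_mR ch)[b Ab ->]; exists b => //; exact: A_chT.
- move=> g /vA[b [Ab xb gE]]; exists b; split=> //; first exact: A_chT.
  by move=> xTb; apply: xb; have := @chT_mulset b 1 Ab; rewrite expr1; apply.
Qed.

Lemma chT_passes v f a p : f%:F = x ^+ v f * a -> A a -> lead a p ->
  passes v T x y f <-> p.[c] = 0.
Proof.
move=> fE Aa ap; rewrite /passes fE [x ^+ _ * a]mulrC mulfK ?expf_neq0 //.
rewrite -(mid_lead c Aa ap); split; first exact: chT_mid.
exact: mid_chT.
Qed.

End ClosedPoint.

End OneChart.
End Charts.

Lemma frac_cross1 (F : fieldType) (s a b x : F) : b != 0 -> x != 0 ->
  s * a / x = s / b * ((a * b) / x).
Proof. by move=> b0 x0; field; rewrite b0 x0. Qed.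

Lemma frac_cross2 (F : fieldType) (a b p q x : F) :
  b != 0 -> p != 0 -> q != 0 -> x != 0 -> a / p / (b / q) = a * q / x / (b * p / x).
Proof. by move=> b0 p0 q0 x0; field; rewrite b0 p0 q0 x0. Qed.

Lemma ideal_pow0 (L : comNzRingType) (A I : set L) n : A 0 -> ideal_pow A I n 0.
Proof.
case: n => //= n _; exists 0, (fun=> 0), (fun=> 0).
by split; [case|case|rewrite big_ord0].
Qed.

Section BlowupCharts.
Variables (K F : fieldType) (k : {rmorphism K -> F}) (S : set F).
Hypotheses (sS : salg k S) (mSid : ideal_in S (maxideal S)).
Local Notation mS := (maxideal S).

Lemma ideal_pow_mul n m a b : ideal_pow S mS n a -> ideal_pow S mS m b ->
  ideal_pow S mS (n + m) (a * b).
Proof.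
have iS := ideal_in_self sS; move=> an bm; move: n a an.
apply: (ideal_pow_ind (P := fun n => [set a | ideal_pow S mS (n + m) (a * b)])).
- by move=> a Sa; exact: ideal_powM.
- by move=> n; rewrite /= mul0r; apply: ideal_pow0; exact: (salg0 sS).
- by move=> n x y xn yn; rewrite /= mulrDl; exact: ideal_powD.
- by move=> n x y mx yn; rewrite /= -mulrA; exact: ideal_mulr.
Qed.

Variable u : F.
Hypotheses (mu : mS u) (u0 : u != 0).

Lemma blowup_chart_salg : salg k (blowup_chart S u).
Proof.
have upow n : ideal_pow S mS n (u ^+ n).
  by rewrite -[_ ^+ _]mulr1; apply: ideal_powX => //; exact: (salg1 sS).
have iS := ideal_in_self sS; have un n : u ^+ n != 0 by rewrite expf_neq0.
split.
- by move=> c; exists 0%N, (k c); split; [exact: (salgK _ sS)|rewrite divr1].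
- move=> _ _ [n [a [an ->]]] [m [b [bm ->]]].
  exists (n + m)%N, (a * u ^+ m + b * u ^+ n); split.
    apply: ideal_powD => //; first exact: ideal_pow_mul.
    by rewrite addnC; exact: ideal_pow_mul.
  by rewrite addf_div // exprD.
- move=> _ _ [n [a [an ->]]] [m [b [bm ->]]]; exists (n + m)%N, (a * b); split.
    exact: ideal_pow_mul.
  by rewrite mulf_div exprD.
Qed.

Lemma blowup_chart_sub : S `<=` blowup_chart S u.
Proof. by move=> a Sa; exists 0%N, a; split=> //; rewrite divr1. Qed.

Lemma blowup_chart_frac a : mS a -> blowup_chart S u (a / u).
Proof.
move=> ma; exists 1%N, a; split=> //.
by rewrite -[a]mulr1; apply: ideal_mulr => //; exact: (salg1 sS).
Qed.

End BlowupCharts.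

Section PrimeLocalization.
Variables (K F : fieldType) (k : {rmorphism K -> F}) (A P : set F).
Hypotheses (sA : salg k A) (Pp : prime_in A P).

Let P0 : P 0. Proof. by case: Pp => -[]. Qed.
Let P1 : ~ P 1. Proof. by case: Pp. Qed.
Let PA : P `<=` A. Proof. by case: Pp => -[]. Qed.
Let PMid a b : A a -> P b -> P (a * b).
Proof. by case: Pp => -[_ _ _ PM] _ _; exact: PM. Qed.
Let PM a b : A a -> A b -> ~ P a -> ~ P b -> ~ P (a * b).
Proof. by case: Pp => _ _ Pprime Aa Ab Pa Pb /(Pprime _ _ Aa Ab)[]. Qed.

Lemma ploc_salg : salg k (localization A P).
Proof. exact: (loc_salg sA P0 P1 PM). Qed.

Lemma ploc_sub : A `<=` localization A P.
Proof. exact: (loc_sub sA P1). Qed.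

Lemma ploc_max a b : A a -> A b -> ~ P b -> maxideal (localization A P) (a / b) <-> P a.
Proof.
move=> Aa Ab Pb; have b0 := loc_neq0 P0 Pb; split=> [[_ nu]|Pa].
  apply: contrapT => Pa; apply: nu; exists (b / a); first by exists b, a.
  by rewrite mulf_div [b * a]mulrC divff // mulf_neq0 // (loc_neq0 P0 Pa).
split; first by exists a, b.
move=> [_ [c [d [Ac Ad Pd ->]]]]; rewrite mulf_div => acE.
have bd0 : b * d != 0 by rewrite mulf_neq0 // (loc_neq0 P0 Pd).
have ac : a * c = b * d by rewrite -[LHS](divfK bd0) acE mul1r.
by have := PM Ab Ad Pb Pd; apply; rewrite -ac mulrC; exact: PMid.
Qed.

Lemma ploc_maxA a : A a -> maxideal (localization A P) a <-> P a.
Proof. by move=> Aa; rewrite -(@ploc_max a 1) ?divr1 //; exact: (salg1 sA). Qed.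

Lemma ploc_local_unit z : localization A P z -> ~ maxideal (localization A P) z ->
  localization A P z^-1.
Proof.
move=> [a [b [Aa Ab Pb ->]]] nm; rewrite invf_div; exists b, a; split=> //.
by move=> Pa; apply: nm; apply/ploc_max.
Qed.

Lemma ploc_maxD z w : maxideal (localization A P) z -> maxideal (localization A P) w ->
  maxideal (localization A P) (z + w).
Proof.
move=> mz mw; have [a [b [Aa Ab Pb zE]]] := mz.1; have [c [d [Ac Ad Pd wE]]] := mw.1.
move: mz mw; rewrite zE wE => /(ploc_max Aa Ab Pb) Pa /(ploc_max Ac Ad Pd) Pc.
rewrite addf_div ?(loc_neq0 P0 Pb) ?(loc_neq0 P0 Pd) //.
apply/ploc_max; [by apply: (salgD sA); exact: (salgM sA)|exact: (salgM sA)|exact: PM|].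
have [[_ _ PD _] _ _] := Pp; apply: PD; first by rewrite mulrC; exact: PMid.
by rewrite mulrC; exact: PMid.
Qed.

Lemma ploc_maxM z w : localization A P z -> maxideal (localization A P) w ->
  maxideal (localization A P) (z * w).
Proof.
move=> [a [b [Aa Ab Pb ->]]] mw; have [c [d [Ac Ad Pd wE]]] := mw.1.
move: mw; rewrite wE => /(ploc_max Ac Ad Pd) Pc; rewrite mulf_div.
by apply/ploc_max; [exact: (salgM sA)|exact: (salgM sA)|exact: PM|exact: PMid].
Qed.

Lemma ploc_max1 : ~ maxideal (localization A P) 1.
Proof. by move/(ploc_maxA (salg1 sA)). Qed.

End PrimeLocalization.

(** * Points of the blow-up over a regular point *)

Section BlowupPoint.
Variables (K : closedFieldType) (R : idomainType) (iota : {rmorphism K -> R}).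
Local Notation F := {fraction R}.
Local Notation k := (kap iota).
Local Notation chart := (chart iota).
Local Notation chT := (@chT K R iota).
Local Notation reg2 := (reg2 iota).
Implicit Types (S T A : set F).

Lemma reg2_ideal S x y : reg2 S x y -> ideal_in S (maxideal S).
Proof. by case=> Sloc *; exact: (ideal_in_max Sloc). Qed.

Lemma chart_prime A x t : chart A x t -> prime_in A (mulset x A).
Proof.
move=> ch; have sA := ch_alg ch; split; last exact: (mulsetA ch).
  split; [|exact: (mulset0 ch)|by move=> a b; exact: (mulsetD sA)|].
    by move=> _ [b Ab ->]; apply: (salgM sA) => //; exact: (ch_x ch).
  by move=> a b Aa; exact: (mulset_subp sA).
exact: (mulset1 ch).
Qed.

Lemma chC_in_blowup S x y : reg2 S x y ->
  blowup_local S (chC (blowup_chart S x) x) /\ dominates (chC (blowup_chart S x) x) S.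
Proof.
move=> r2; have ch := reg2_chart r2; have [Sloc _ x0 _ _ _ _] := r2.
have sS := l_alg Sloc; have sA := ch_alg ch.
have mx : maxideal S x by rewrite (mid_maxideal Sloc); exact: (midx _ _ sS).
split.
  by exists x; split=> //; exists (mulset x (blowup_chart S x)) => //; exact: (chart_prime ch).
split.
  by apply: (subset_trans (B := blowup_chart S x));
    [exact: blowup_chart_sub|exact: (A_chC ch)].
rewrite (mid_maxideal Sloc) (chC_max ch) => z [a [b [Sa Sb ->]]].
have -> : x * a + y * b = x * (a + (y / x) * b).
  by rewrite mulrDr mulrA [x * (y / x)]mulrC divfK.
exists (a + y / x * b) => //; apply: (A_chC ch).
have AS : S `<=` blowup_chart S x by exact: blowup_chart_sub.
by apply: (salgD sA); [exact: AS|apply: (salgM sA); [exact: (ch_t ch)|exact: AS]].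
Qed.

Lemma chT_dominates S x y c : reg2 S x y ->
  dominates (chT (blowup_chart S x) x (y / x) c) S.
Proof.
move=> r2; have ch := reg2_chart r2; have [Sloc _ x0 _ _ _ _] := r2.
have sS := l_alg Sloc; have sA := ch_alg ch; have AS := @blowup_chart_sub _ S x.
split; first by move=> s Ss; apply: (A_chT ch); exact: AS.
rewrite (mid_maxideal Sloc) (mid_maxideal (chT_local ch c)) => z [a [b [Sa Sb ->]]].
have -> : x * a + y * b = x * (a + (y / x) * b).
  by rewrite mulrDr mulrA [x * (y / x)]mulrC divfK.
apply: (mulset_mid _ (chT_salg ch c)); exists (a + y / x * b) => //; apply: (A_chT ch).
by apply: (salgD sA); [exact: AS|apply: (salgM sA); [exact: (ch_t ch)|exact: AS]].
Qed.

(* The chart modulo x is K[t], and K is algebraically closed. *)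
Lemma chart_primes A x t P : chart A x t -> prime_in A P -> P x ->
  P = mulset x A \/ exists c, P = mid A x (t - k c).
Proof.
move=> ch [[PA P0 PD PM] P1 Pprime] Px; have sA := ch_alg ch.
have xP : mulset x A `<=` P by move=> _ [b Ab ->]; rewrite mulrC; exact: PM.
have Pk c : c != 0 -> ~ P (k c).
  move=> c0 Pc; apply: P1; rewrite -(rmorph1 k) -(mulVf c0) rmorphM.
  by apply: PM => //; exact: (salgK _ sA).
have Plead a p : A a -> lead iota A x t a p -> P a <-> P (ev iota t p).
  move=> Aa ap; have /xP Pap := ap; split=> Pz.
    rewrite -(subKr a (ev iota t p)); apply: PD => //.
    rewrite -mulN1r -(rmorph1 k) -rmorphN; apply: PM => //; exact: (salgK _ sA).
  by rewrite -(subrK (ev iota t p) a); exact: PD.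
have Aev p : A (ev iota t p) := A_ev ch p.
have [Px'|] := pselect (P `<=` mulset x A); first by left; apply/seteqP.
move=> nPx; right.
have [z [Pz xz]] : exists z, P z /\ ~ mulset x A z.
  by apply: contrapT => nex; apply: nPx => z Pz; apply: contrapT => xz; apply: nex; exists z.
have [p zp] := lead_ex ch (PA _ Pz).
have p0 := lead_neq0 zp xz.
have Pp : P (ev iota t p) by apply/(Plead z p) => //; exact: PA.
have Atc c : A (t - k c) by apply: (salgB sA); [exact: (ch_t ch)|exact: (salgK _ sA)].
have evM p' q' : ev iota t (p' * q') = ev iota t p' * ev iota t q'.
  by rewrite /ev rmorphM hornerM.
have evXc c : ev iota t ('X - c%:P) = t - k c.
  by rewrite /ev rmorphB /= map_polyX map_polyC hornerXsubC.
have evC c : ev iota t c%:P = k c by rewrite /ev map_polyC hornerC.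
have [c Ptc] : exists c, P (t - k c).
  have [r pE] := closed_field_poly_normal p; move: Pp; rewrite pE -mul_polyC evM evC.
  have lc0 : lead_coef p != 0 by rewrite lead_coef_eq0.
  move=> /(Pprime _ _ (salgK _ sA) (Aev _))[/(Pk _ lc0)//|].
  elim: r {pE} => [|c r IHr]; first by rewrite big_nil -polyC1 evC rmorph1.
  rewrite big_cons evM evXc => /(Pprime _ _ (Atc c) (Aev _))[Pc|//]; by exists c.
exists c; apply/seteqP; split=> w.
  move=> Pw; have Aw := PA _ Pw; have [q wq] := lead_ex ch Aw.
  apply/(mid_lead ch c Aw wq); apply/eqP/negPn/negP => qc; apply: (Pk _ qc).
  have Pq : P (ev iota t q) by apply/(Plead w q).
  have /factor_theorem[h hE] : root (q - q.[c]%:P) c by rewrite /root hornerD hornerN hornerC subrr.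
  have -> : k q.[c] = ev iota t q + (- ev iota t h) * (t - k c).
    rewrite mulNr -evXc -evM -hE /ev rmorphB hornerD hornerN /= map_polyC hornerC.
    by rewrite opprB addrC subrK.
  by apply: PD => //; apply: PM => //; exact: (salgN sA).
move=> [a [b [Aa Ab ->]]]; apply: PD; first by apply: xP; exists a.
by rewrite mulrC; exact: PM.
Qed.

(** As u / x is a unit at [T], the chart of x is contained in [T], and [T] is its localization at
    the prime of elements vanishing at [T]. This prime contains x, so [chart_primes] applies. *)
Lemma blowup_local_chart S x y u P : reg2 S x y -> maxideal S u -> u != 0 ->
  prime_in (blowup_chart S u) P -> let T := localization (blowup_chart S u) P in
  dominates T S -> T (u / x) ->
  T = chC (blowup_chart S x) x \/ exists c, T = chT (blowup_chart S x) x (y / x) c.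
Proof.
move=> r2 mu u0 Pp T [ST mST] Tux.
have ch := reg2_chart r2; have [Sloc _ x0 _ _ _ _] := r2.
have sS := l_alg Sloc; have mSid := reg2_ideal r2.
have sB : salg k (blowup_chart S u) := blowup_chart_salg sS mSid mu u0.
have sT : salg k T := ploc_salg sB Pp.
have BT : blowup_chart S u `<=` T := ploc_sub sB Pp.
have mx : maxideal S x by rewrite (mid_maxideal Sloc); exact: (midx _ _ sS).
set A := blowup_chart S x in ch *; have sA := ch_alg ch.
have AT : A `<=` T.
  move=> _ [n [s [sn ->]]].
  have -> : s / x ^+ n = (s / u ^+ n) * (u / x) ^+ n.
    by rewrite expr_div_n mulrA divfK // expf_neq0.
  by apply: (salgM sT); [apply: BT; exists n, s|exact: (salgX _ sT)].
have Txu : T (x / u) by apply: BT; exact: (blowup_chart_frac sS).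
pose P' := A `&` maxideal T.
have P'p : prime_in A P'.
  split.
  - split; first by move=> z [].
    + by split; [exact: (salg0 sA)|apply/(ploc_maxA sB Pp);
      [exact: (salg0 sB)|by case: Pp => -[]]].
    + by move=> a b [Aa ma] [Ab mb]; split; [exact: (salgD sA)|exact: (ploc_maxD sB Pp)].
    + move=> a b Aa [Ab mb]; split; first exact: (salgM sA).
      by apply: (ploc_maxM sB Pp) => //; exact: AT.
  - by move=> [_]; exact: (ploc_max1 sB Pp).
  - move=> a b Aa Ab [_ mab]; have [ma|ma] := pselect (maxideal T a); first by left.
    right; split=> //; have Ta := AT _ Aa.
    have a0 : a != 0.
      apply/eqP => a0; apply: ma; rewrite a0; apply/(ploc_maxA sB Pp); first exact: (salg0 sB).
      by case: Pp => -[].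
    rewrite -(mulKf a0 b); apply: (ploc_maxM sB Pp) => //.
    exact: (ploc_local_unit Pp).
have TE : T = localization A P'.
  apply/seteqP; split=> z.
    move=> [_ [_ [[n [s [sn ->]]] [m [s' [sm ->]]] Pb ->]]].
    have un j : u ^+ j != 0 by rewrite expf_neq0.
    have xn j : x ^+ j != 0 by rewrite expf_neq0.
    have upow j : ideal_pow S (maxideal S) j (u ^+ j).
      by rewrite -[_ ^+ _]mulr1; apply: ideal_powX => //; exact: (salg1 sS).
    pose b := s' / u ^+ m; have Bb : blowup_chart S u b by exists m, s'.
    have b0 : b != 0 by apply: (loc_neq0 _ Pb); case: Pp => -[].
    have s'0 : s' != 0 by apply: contraNneq b0 => s'0; rewrite /b s'0 mul0r.
    have b'E : s' * u ^+ n / x ^+ (n + m) = b * (u / x) ^+ (n + m).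
      by rewrite expr_div_n [u ^+ (n + m)]exprD; exact: frac_cross1.
    exists (s * u ^+ m / x ^+ (n + m)), (s' * u ^+ n / x ^+ (n + m)); split.
    - by exists (n + m)%N, (s * u ^+ m); split=> //; exact: (ideal_pow_mul sS mSid).
    - by exists (n + m)%N, (s' * u ^+ n); split=> //; rewrite addnC;
      exact: (ideal_pow_mul sS mSid).
    - rewrite b'E => -[_ [_]]; apply; exists (b^-1 * (x / u) ^+ (n + m)).
        apply: (salgM sT); last exact: (salgX _ sT).
        apply: (ploc_local_unit Pp); first exact: BT.
        by move/(ploc_maxA sB Pp Bb).
      by rewrite mulrACA mulfV // mul1r -exprMn mulrA divfK // mulfV // expr1n.
    - exact: frac_cross2.
  move=> [a [b [Aa Ab Pb ->]]]; apply: (salgM sT); first exact: AT.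
  by apply: (ploc_local_unit Pp); [exact: AT|move=> mb; apply: Pb].
have P'x : P' x by split; [exact: (ch_x ch)|exact: mST].
rewrite {1 2}TE; have [->|[c ->]] := chart_primes ch P'p P'x; first by left.
by right; exists c.
Qed.

Lemma chT_unit_lead A x t c a p : chart A x t -> A a -> lead iota A x t a p ->
  p.[c] != 0 -> chT A x t c a^-1.
Proof.
move=> ch Aa ap pc; apply: (chT_unit ch) => // /(mid_lead ch c Aa ap)/eqP.
by rewrite (negPf pc).
Qed.

(** If x / u is a unit at [T], then [T] is in the chart of x. Otherwise y / u is a unit, since u
    lies in (x, y), and [T] is the point at infinity x / y = 0 of the chart of y. *)
Lemma blowup_local_cases S x y T : reg2 S x y -> blowup_local S T -> dominates T S ->
  [\/ T = chC (blowup_chart S x) x, exists c, T = chT (blowup_chart S x) x (y / x) c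
    | T = chT (blowup_chart S y) y (x / y) 0].
Proof.
move=> r2 [u [mu u0 [P Pp TE]]] dom; have [ST mST] := dom.
have [Sloc _ x0 y0 _ _ _] := r2; have [sS Sx Sy res _ _] := Sloc.
have mSid := reg2_ideal r2; have ch := reg2_chart r2.
have r2' := reg2_swap r2; have ch' := reg2_chart r2'.
have sB : salg k (blowup_chart S u) := blowup_chart_salg sS mSid mu u0.
have sT : salg k T by rewrite TE; exact: (ploc_salg sB Pp).
have BT : blowup_chart S u `<=` T by rewrite TE; exact: (ploc_sub sB Pp).
have mx : maxideal S x by rewrite (mid_maxideal Sloc); exact: (midx _ _ sS).
have my : maxideal S y by rewrite (mid_maxideal Sloc); exact: (midy _ _ sS).
have Txu : T (x / u) by apply: BT; exact: (blowup_chart_frac sS).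
have Tyu : T (y / u) by apply: BT; exact: (blowup_chart_frac sS).
have unit z : T z -> ~ maxideal T z -> T z^-1.
  by rewrite TE; exact: (ploc_local_unit Pp).
have [mxu|mxu] := pselect (maxideal T (x / u)); last first.
  have Tux : T (u / x) by rewrite -invf_div; exact: unit.
  by case: (blowup_local_chart r2 mu u0 Pp); rewrite -?TE // => ?;
    [constructor 1|constructor 2].
have maxM z w : T z -> maxideal T w -> maxideal T (z * w).
  by rewrite TE; exact: (ploc_maxM sB Pp).
have myu : ~ maxideal T (y / u).
  have [a [b [Sa Sb uE]]] : mid S x y u by rewrite -(mid_maxideal Sloc).
  have E1 : 1 = a * (x / u) + b * (y / u).
    by rewrite !mulrA -mulrDl [a * x]mulrC [b * y]mulrC -uE mulfV.
  move=> myu; have : maxideal T 1.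
    rewrite E1; move: (maxM _ _ (ST _ Sa) mxu) (maxM _ _ (ST _ Sb) myu).
    by rewrite TE; exact: (ploc_maxD sB Pp).
  by rewrite TE; exact: (ploc_max1 sB Pp).
have Tuy : T (u / y) by rewrite -invf_div; exact: unit.
have ms : maxideal T (x / y).
  by have -> : x / y = (u / y) * (x / u); [rewrite [RHS]mulrC mulrA divfK|exact: maxM].
have As := ch_t ch'; have leads := lead_t ch'.
case: (blowup_local_chart r2' mu u0 Pp); rewrite -?TE //.
  move=> TE'; move: ms; rewrite TE' (chC_max ch') -(expr1 y) => /(chC_mulset ch' As).
  rewrite expr1 => /lead0/(lead_uniq ch' leads)/eqP; by rewrite polyX_eq0.
move=> [c TE']; move: ms; rewrite TE' (mid_maxideal (chT_local ch' c)).
move=> /(chT_mid ch' As)/(mid_lead ch' c As leads); rewrite hornerX => c0.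
by constructor 3; rewrite c0.
Qed.

End BlowupPoint.

(** * Points of the exceptional divisor *)

Section ExceptionalPoints.
Variables (K : closedFieldType) (R : idomainType) (iota : {rmorphism K -> R}).
Local Notation F := {fraction R}.
Local Notation k := (kap iota).
Local Notation chart := (chart iota).
Local Notation chT := (@chT K R iota).
Local Notation reg2 := (reg2 iota).
Local Notation mR := (maxideal [set: R]).
Local Notation B := (@base_ring R).
Implicit Types (S T A C : set F) (E X : set (set F)).

(* Every component of E is of this form (component_isdiv). *)
Definition isdiv C : Prop := exists A x t, chart A x t /\ C = chC A x.

(* x is an equation at T of the curve with generic point C. *)
Definition curve_at C T x : Prop :=
  T `<=` C /\ forall z, T z -> (maxideal C z <-> mulset x T z).

Definition has_curve E T x : Prop := exists C, [/\ E C, isdiv C & curve_at C T x].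

(* As f vanishes along every exceptional curve, only x = 0 and y = 0 can be
   exceptional at S. *)
Definition exc_eq S x y (a b : nat) : Prop :=
  exists f e, [/\ mR f, S e, S e^-1, e != 0 & f%:F = e * x ^+ a * y ^+ b].

(** Normal crossings at a closed point: x = 0 is always exceptional, hence [a.+1], while b > 0
    signals that y = 0 is exceptional too. *)
Definition closedpt E T : Prop := exists x y a b,
  [/\ reg2 T x y,
      forall u w, T u -> T w -> mulset x T (u * w) -> mulset x T u \/ mulset x T w,
      forall z, T z -> ~ mulset x T z ->
        exists n u w, [/\ T u, T w & y ^+ n = z * u + x * w],
      exc_eq T x y a.+1 b
    & has_curve E T x /\ ((0 < b)%N -> has_curve E T y)].

Definition sepor T T' := sep T T' \/ sep T' T.

(** The chart dates from the blow-up that created [C]. The exception [c0] covers a [T] which is the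
    point t = c0 of this chart or was created over it later. *)
Definition good_div E C : Prop := exists A x t, [/\ chart A x t, C = chC A x &
  forall T, E T -> ~ isdiv T -> exists c0, forall c, c != c0 -> sepor (chT A x t c) T].

Definition pairwise_sep E : Prop :=
  forall T T', E T -> E T' -> ~ isdiv T -> T <> T' -> sep T T'.

Definition Inv E : Prop :=
  [/\ forall T, E T -> isdiv T \/ closedpt E T, pairwise_sep E
    & forall C, E C -> isdiv C -> good_div E C].

(** A valuation ring contains y / x or x / y; a regular local ring with parameters x, y contains
    neither. *)
Lemma reg2_notdiv S x y : reg2 S x y -> ~ isdiv S.
Proof.
move=> r2 [A [u [t [ch SE]]]].
have nodiv x' y' : reg2 S x' y' -> ~ S (y' / x').
  move=> r2' Syx; have [Sloc _ x0 _ reg _ _] := r2'; have [sS _ _ _ _ S1] := Sloc.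
  have [|w Sw E1] := reg 1 (y' / x') (salg1 sS) Syx; first by rewrite mul1r divfK.
  by apply: S1; exists w, 0; split=> //; [exact: (salg0 sS)|rewrite -E1 mulr0 addr0].
have [Sloc _ x0 y0 _ _ _] := r2; have [sS _ _ _ _ _] := Sloc.
have yx0 : y / x != 0 by rewrite mulf_neq0 // invr_eq0.
have un n : S (u ^+ n) by apply: (salgX _ sS); rewrite SE; apply: (A_chC ch); exact: (ch_x ch).
have [n [e []]] := chC_dvr ch yx0; rewrite -SE => Se Sei e0 [yxE|yxE].
  by apply: (nodiv x y r2); rewrite yxE; exact: (salgM sS).
apply: (nodiv y x (reg2_swap r2)).
have -> : x / y = u ^+ n * e^-1.
  by rewrite -yxE invfM mulrCA mulfV ?mulr1 ?invf_div // expf_neq0 // (ch_x0 ch).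
exact: (salgM sS).
Qed.

Lemma sep_dom S S' T : dominates S' S -> sep S T -> sep S' T.
Proof. by move=> [_ mS] [z [mz Tz]]; exists z; split=> //; exact: mS. Qed.

Lemma sep_sub S T T' : T `<=` T' -> sep S T -> sep S T'.
Proof. by move=> TT' [z [mz [Tz z0]]]; exists z; split=> //; split=> //; exact: TT'. Qed.

Lemma sepor_dom S T T' : dominates T' T -> sepor S T -> sepor S T'.
Proof.
move=> dom [ST|TS]; [left|right]; last exact: (sep_dom dom).
by case: dom => TT' _; exact: (sep_sub TT').
Qed.

Lemma salg_A_t A x t c : chart A x t -> A (t - k c).
Proof.
by move=> ch; apply: (salgB (ch_alg ch)); [exact: (ch_t ch)|exact: (salgK _ (ch_alg ch))].
Qed.

Lemma tc_neq0 A x t c : chart A x t -> t - k c != 0.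
Proof.
move=> ch; apply/eqP => tc0; have := lead_y ch c; rewrite tc0 => /(lead_uniq ch).
have l0 : lead iota A x t 0 0 by apply/lead0; exact: (mulset0 ch).
by move=> /(_ _ l0)/eqP; rewrite polyXsubC_eq0.
Qed.

Lemma max_tc A x t c : chart A x t -> maxideal (chT A x t c) (t - k c).
Proof.
by move=> ch; rewrite (mid_maxideal (chT_local ch c)); exact: (midy _ _ (chT_salg ch c)).
Qed.

Lemma sep_chT A x t c c' : chart A x t -> c != c' ->
  sep (chT A x t c) (chT A x t c').
Proof.
move=> ch cc'; exists (t - k c); split; first exact: max_tc.
split; last exact: tc_neq0 ch.
apply: (chT_unit_lead ch (salg_A_t c ch) (lead_y ch c)).
by rewrite hornerXsubC subr_eq0 eq_sym.
Qed.

Lemma sep_chT_chC A x t c : chart A x t -> sep (chT A x t c) (chC A x).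
Proof.
move=> ch; exists (t - k c); split; first exact: max_tc.
split; last exact: tc_neq0 ch.
apply: (chC_unit ch); first exact: (salg_A_t c ch).
by move/lead0/(lead_uniq ch (lead_y ch c))/eqP; rewrite polyXsubC_eq0.
Qed.

(** With s = x / y, the inverse of y / x - c is s / (1 - c s), which is regular at s = 0. *)
Lemma sep_chT_inf S x y c : reg2 S x y ->
  sep (chT (blowup_chart S x) x (y / x) c) (chT (blowup_chart S y) y (x / y) 0).
Proof.
move=> r2; have ch := reg2_chart r2; have ch' := reg2_chart (reg2_swap r2).
have [_ _ x0 y0 _ _ _] := r2; have sA' := ch_alg ch'.
exists (y / x - k c); split; first exact: max_tc.
split; last exact: tc_neq0 ch.
set s := x / y; have s0 : s != 0 by rewrite mulf_neq0 // invr_eq0.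
have As : blowup_chart S y s := ch_t ch'.
have -> : (y / x - k c)^-1 = s * (1 - k c * s)^-1.
  have -> : y / x - k c = s^-1 * (1 - k c * s).
    by rewrite mulrBr mulr1 mulrCA mulVf // mulr1 invf_div.
  by rewrite invfM invrK.
apply: (salgM (chT_salg ch' 0)); first exact: (A_chT ch').
apply: (chT_unit_lead ch' (p := 1 - c *: 'X)).
- by apply: (salgB sA'); [exact: (salg1 sA')|apply: (salgM sA') => //; exact: (salgK _ sA')].
- rewrite -mulNr -rmorphN -(scaleNr c) -(rmorph1 k) -polyC1.
  by apply: (leadD ch'); [exact: leadK|apply: (leadZ ch') => //; exact: lead_t].
- by rewrite hornerD hornerN hornerZ hornerX mulr0 subr0 hornerC oner_neq0.
Qed.

Lemma sep_inf S x y T : reg2 S x y -> blowup_chart S x `<=` T ->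
  sep (chT (blowup_chart S y) y (x / y) 0) T.
Proof.
move=> r2 AT; have ch := reg2_chart r2; have ch' := reg2_chart (reg2_swap r2).
have [_ _ x0 y0 _ _ _] := r2.
exists (x / y); split; first by have := max_tc 0 ch'; rewrite rmorph0 subr0.
by split; [rewrite invf_div; apply: AT; exact: (ch_t ch)|rewrite mulf_neq0 // invr_eq0].
Qed.

Lemma isdiv_salg C : isdiv C -> salg k C.
Proof. by move=> [A [x [t [ch ->]]]]; exact: (chC_salg ch). Qed.

Lemma isdiv_unit C z : isdiv C -> C z -> ~ maxideal C z -> C z^-1.
Proof.
move=> dC Cz nm; have [z0|z0] := eqVneq z 0; first by rewrite z0 invr0 -z0.
have [w Cw zw] : exists2 w, C w & z * w = 1 by apply: contrapT => nw; apply: nm.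
by have -> : z^-1 = w by apply: (mulfI z0); rewrite mulfV.
Qed.

Lemma isdiv_maxM C z w : isdiv C -> C z -> maxideal C w -> maxideal C (z * w).
Proof.
move=> [A [x [t [ch ->]]]] Cz; rewrite (chC_max ch).
exact: (mulset_subp (chC_salg ch)).
Qed.

Lemma isdiv_maxD C z w : isdiv C -> maxideal C z -> maxideal C w -> maxideal C (z + w).
Proof.
move=> [A [x [t [ch ->]]]]; rewrite (chC_max ch); exact: (mulsetD (chC_salg ch)).
Qed.

Lemma isdiv_max1 C : isdiv C -> ~ maxideal C 1.
Proof. by move=> dC [C1 nu]; apply: nu; exists 1; rewrite ?mulr1. Qed.

Lemma isdiv_over C T f : isdiv C -> mR f -> f != 0 -> salg k T -> dominates T B ->
  C `<=` T -> T = C.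
Proof.
move=> [A [x [t [ch ->]]]] mf f0 sT [_ mT] CT.
have [TC|TE] := chC_over ch sT CT; first by apply/seteqP.
have [_ nu] : maxideal T f%:F.
  apply: mT; split; first by exists f.
  move=> [_ [g _ <-]]; rewrite -tofracM -tofrac1 => /eqP; rewrite tofrac_eq => /eqP fg.
  by case: mf => _; apply; exists g.
by case: nu; exists (f%:F)^-1; [rewrite TE|rewrite mulfV // tofrac_eq0].
Qed.

Lemma curve_chC A x t c : chart A x t -> curve_at (chC A x) (chT A x t c) x.
Proof.
move=> ch; have sA := ch_alg ch; have sC := chC_salg ch; have sT := chT_salg ch c.
have TC : chT A x t c `<=` chC A x.
  move=> _ [a [b [Aa Ab mb ->]]]; exists a, b; split=> // xb; apply: mb.
  exact: (mulset_midA ch).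
split=> // z Tz; rewrite (chC_max ch); split; last by move=> [w Tw ->]; exists w => //;
  exact: TC.
have [a [b [Aa Ab mb zE]]] := Tz; have b0 : b != 0.
  by apply/eqP => b0; apply: mb; rewrite b0; apply: (mulset_midA ch); exact: (mulset0 ch).
move=> xz; have : mulset (x ^+ 1) (chC A x) a.
  rewrite expr1; have -> : a = b * z by rewrite zE mulrC divfK.
  by apply: (mulset_subp sC) => //; exact: (A_chC ch).
move=> /(chC_mulset ch Aa); rewrite expr1 => -[u Au aE]; exists (u / b).
  by exists u, b.
by rewrite zE aE mulrA.
Qed.

(** As x does not vanish on [C], the chart of x lies in [C], and the old curve y = x t = 0 becomes t
    = 0. If s + t w vanishes on [C], then y divides s in [S], so t divides the sum. *)
Lemma curve_transform C S x y : reg2 S x y -> isdiv C -> curve_at C S y ->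
  curve_at C (chT (blowup_chart S x) x (y / x) 0) (y / x).
Proof.
move=> r2 dC [SC mC]; have ch := reg2_chart r2; have sC := isdiv_salg dC.
have [Sloc _ x0 y0 reg _ _] := r2; have [sS Sx Sy _ _ S1] := Sloc.
have sA := ch_alg ch; have At := ch_t ch; have sT := chT_salg ch 0.
set A := blowup_chart S x in ch sA At sT *; set t := y / x in ch At sT *.
have xtE : x * t = y by rewrite mulrC divfK.
have mCx : ~ maxideal C x.
  move=> /(mC x Sx)[w Sw xE]; have [|w' Sw' wE] := reg w 1 Sw (salg1 sS);
    first by rewrite mul1r xE mulrC.
  apply: S1; exists 0, w'; split=> //; first exact: (salg0 sS).
  by apply: (mulfI x0); rewrite mulr1 {1}xE wE; ring.
have Cxi : C x^-1 := isdiv_unit dC (SC _ Sx) mCx.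
have my : maxideal C y by apply/(mC y Sy); exists 1; [exact: (salg1 sS)|rewrite mulr1].
have mt : maxideal C t by rewrite /t mulrC; exact: isdiv_maxM.
have AE : A = adjoin S t by rewrite /A (adjoin_chart Sloc x0).
have AC : A `<=` C.
  rewrite AE; apply: (adjoin_ind sS) => //; first by case: mt.
    by move=> a b; exact: (salgD sC).
  by move=> a b; exact: (salgM sC).
have SA : S `<=` A by exact: blowup_chart_sub.
have tA a : A a -> maxideal C a -> mulset t A a.
  move=> Aa ma; have [s [w [Ss Aw aE]]] : exists s w, [/\ S s, A w & a = s + t * w].
    move: Aa; rewrite {1}AE; move: (a); apply: (adjoin_ind sS).
    - by move=> s Ss; exists s, 0; split=> //; [exact: (salg0 sA)|rewrite mulr0 addr0].
    - by exists 0, 1; split; [exact: (salg0 sS)|exact: (salg1 sA)|rewrite add0r mulr1].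
    - move=> _ _ [s [w [Ss Aw ->]]] [s' [w' [Ss' Aw' ->]]]; exists (s + s'), (w + w').
      by split; [exact: (salgD sS)|exact: (salgD sA)|ring].
    - move=> _ _ [s [w [Ss Aw ->]]] [s' [w' [Ss' Aw' ->]]].
      exists (s * s'), (s * w' + w * s' + t * w * w'); split; first exact: (salgM sS).
        have As := SA _ Ss; have As' := SA _ Ss'.
        by apply: (salgD sA); [apply: (salgD sA)|]; do ?apply: (salgM sA) => //.
      ring.
  have /(mC s Ss)[s1 Ss1 sE] : maxideal C s.
    have -> : s = a + (- w) * t by rewrite aE; ring.
    apply: isdiv_maxD => //; apply: isdiv_maxM => //; apply: (salgN sC); exact: AC.
  exists (x * s1 + w); last by rewrite aE sE -{1}xtE; ring.
  apply: (salgD sA) => //; apply: (salgM sA); exact: SA.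
have Cb b : A b -> ~ mid A x (t - k 0) b -> C b^-1.
  move=> Ab mb; apply: isdiv_unit => //; first exact: AC.
  move=> /(tA b Ab)[w Aw bE]; apply: mb; exists 0, w; split=> //; first exact: (salg0 sA).
  by rewrite bE rmorph0 subr0; ring.
have TC : chT A x t 0 `<=` C.
  by move=> _ [a [b [Aa Ab mb ->]]]; apply: (salgM sC); [exact: AC|exact: Cb].
split=> // z Tz; split; last first.
  by move=> [w Tw ->]; rewrite mulrC; apply: isdiv_maxM => //; exact: TC.
move=> mz; have [a [b [Aa Ab mb zE]]] := Tz.
have b0 : b != 0.
  by apply/eqP => b0; apply: mb; rewrite b0; apply: (mulset_midA ch); exact: (mulset0 ch).
have /(tA a Aa)[w Aw aE] : maxideal C a.
  have -> : a = b * z by rewrite zE mulrC divfK.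
  by apply: isdiv_maxM => //; exact: AC.
exists (w / b); first by exists w, b.
by rewrite zE aE mulrA.
Qed.

Lemma reg2_min S x y s : reg2 S x y -> S s -> S s^-1 -> s != 0 -> ~ mid S x y s.
Proof.
move=> [[sS _ _ _ _ S1] *] ms; apply: S1; rewrite -(@mulVf _ s) //.
exact: (midM sS).
Qed.

(** f = e x^a y^b becomes e x^(a+b) t^b. So x = 0 is the new curve, and the transform t = 0 of the
    old one counts only at c = 0, since t is a unit elsewhere. *)
Lemma closedpt_chT E S x y a b c : reg2 S x y -> exc_eq S x y a b ->
  ((0 < b)%N -> has_curve E S y) -> E (chC (blowup_chart S x) x) ->
  closedpt E (chT (blowup_chart S x) x (y / x) c).
Proof.
move=> r2 [f [e [mf Se Sei e0 fE]]] hb EC; have ch := reg2_chart r2.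
have [Sloc _ x0 y0 reg _ SmR] := r2; have [sS Sx Sy _ _ S1] := Sloc.
have sA := ch_alg ch; have sT := chT_salg ch c.
have xtE : x * (y / x) = y by rewrite mulrC divfK.
(* If a + b were 0, the nonunit f would be a unit of [S]. *)
have [d abE] : exists d, (a + b = d.+1)%N.
  case: a fE => [|a] fE; last by exists (a + b)%N.
  case: b {hb} fE => [|b] fE; last by exists b.
  have := reg2_min r2 Se Sei e0; rewrite -[e]mulr1 -[e * 1]mulr1 -fE.
  by move: (SmR f mf).
have fE' : f%:F = e * x ^+ d.+1 * (y / x) ^+ b.
  by rewrite fE -abE -[in LHS]xtE exprMn exprD; ring.
have AT := A_chT ch c; have SA := @blowup_chart_sub _ S x.
have Te : chT (blowup_chart S x) x (y / x) c e by apply: AT; exact: SA.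
have Tei : chT (blowup_chart S x) x (y / x) c e^-1 by apply: AT; exact: SA.
have hx : has_curve E (chT (blowup_chart S x) x (y / x) c) x.
  exists (chC (blowup_chart S x) x); split=> //;
    first by exists (blowup_chart S x), x, (y / x).
  exact: (curve_chC c ch).
have t0 : y / x != 0 by rewrite mulf_neq0 // invr_eq0.
exists x, (y / x - k c), d, (if c == 0 then b else 0%N); split.
- exact: (chT_reg2 ch c).
- exact: (chT_prime ch).
- exact: (chT_fin ch).
- have [c0|c0] := eqVneq c 0.
    by exists f, e; split=> //; rewrite c0 rmorph0 subr0.
  have Tti : chT (blowup_chart S x) x (y / x) c (y / x)^-1.
    by apply: (chT_unit_lead ch (ch_t ch) (lead_t ch)); rewrite hornerX.
  exists f, (e * (y / x) ^+ b); split=> //.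
  + by apply: (salgM sT) => //; apply: (salgX _ sT); apply: AT; exact: (ch_t ch).
  + by rewrite invfM -exprVn; apply: (salgM sT) => //; exact: (salgX _ sT).
  + by rewrite mulf_neq0 // expf_neq0.
  + by rewrite fE' expr0 mulr1 mulrAC.
- split=> //; have [->|c0] := eqVneq c 0; last by [].
  by move=> /hb[C [EC' dC CS]]; exists C; rewrite rmorph0 subr0; split=> //;
    exact: curve_transform.
Qed.

Definition blowup_exc E S : set (set F) :=
  [set T | (E T /\ T <> S) \/ (blowup_local S T /\ dominates T S)].

Lemma has_curve_blowup E S x y T z : reg2 S x y -> has_curve E T z ->
  has_curve (blowup_exc E S) T z.
Proof.
move=> r2 [C [EC dC CT]]; exists C; split=> //; left; split=> // CS.
by apply: (reg2_notdiv r2); rewrite -CS.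
Qed.

(** The center is not assumed to satisfy [closedpt], because no exceptional curve passes through it
    at the first blow-up. The two versions of the equation serve the chart of x and the origin of
    the chart of y. *)
Lemma Inv_blowup E S x y a b a' b' : reg2 S x y -> E S ->
  exc_eq S x y a b -> ((0 < b)%N -> has_curve E S y) ->
  exc_eq S y x a' b' -> ((0 < b')%N -> has_curve E S x) ->
  (forall T, E T -> T <> S -> isdiv T \/ closedpt E T) ->
  pairwise_sep E -> (forall C, E C -> isdiv C -> good_div E C) ->
  Inv (blowup_exc E S).
Proof.
move=> r2 ES eqx hx eqy hy Ecl Esep Ediv; set E' := blowup_exc E S.
have ndS := reg2_notdiv r2; have r2' := reg2_swap r2.
have ch := reg2_chart r2; have ch' := reg2_chart r2'.
have hx' : (0 < b)%N -> has_curve E' S y by move=> /hx; exact: (has_curve_blowup r2).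
have hy' : (0 < b')%N -> has_curve E' S x by move=> /hy; exact: (has_curve_blowup r2).
have ECx : E' (chC (blowup_chart S x) x) by right; exact: (chC_in_blowup r2).
have ECy : E' (chC (blowup_chart S y) y) by right; exact: (chC_in_blowup r2').
have sepST T : E T -> T <> S -> sep S T by move=> ET TS; apply: Esep => // ST; exact: TS.
have xy_inf T : blowup_local S T -> dominates T S -> T <> chT (blowup_chart S y) y (x / y) 0 ->
    sep (chT (blowup_chart S y) y (x / y) 0) T.
  move=> bT domT nT; apply: (sep_inf r2).
  have [->|[c ->]|//] := blowup_local_cases r2 bT domT; first exact: (A_chC ch).
  exact: (A_chT ch).
have xy_fin c T : blowup_local S T -> dominates T S -> T <> chT (blowup_chart S x) x (y / x) c ->
    sep (chT (blowup_chart S x) x (y / x) c) T.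
  move=> bT domT nT; have [TE|[c' TE]|->] := blowup_local_cases r2 bT domT.
  - by rewrite TE; exact: (sep_chT_chC c ch).
  - by rewrite TE; apply: (sep_chT ch); apply/eqP => cc'; apply: nT; rewrite TE cc'.
  - exact: (sep_chT_inf c r2).
split.
- move=> T [[ET TS]|[bT domT]].
    have [dT|[u [v [n [m [r2T p1 p2 p3 [p4 p5]]]]]]] := Ecl T ET TS; [by left|right].
    exists u, v, n, m; split=> //; split; first exact: (has_curve_blowup r2).
    by move=> /p5; exact: (has_curve_blowup r2).
  have [->|[c ->]|->] := blowup_local_cases r2 bT domT.
  + by left; exists (blowup_chart S x), x, (y / x).
  + by right; exact: (closedpt_chT c r2 eqx hx').
  + by right; exact: (closedpt_chT 0 r2' eqy hy').
- move=> T T' [[ET TS]|[bT domT]] [[ET' TS']|[bT' domT']] ndT TT'.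
  + exact: Esep.
  + by apply: (sep_sub (T := S)); [case: domT'|exact: Esep].
  + by apply: (sep_dom domT); apply: Esep => // /esym.
  + have [TE|[c TE]|TE] := blowup_local_cases r2 bT domT.
    * by case: ndT; exists (blowup_chart S x), x, (y / x).
    * by rewrite TE; apply: xy_fin => // TE'; apply: TT'; rewrite TE TE'.
    * by rewrite TE; apply: xy_inf => // TE'; apply: TT'; rewrite TE TE'.
- move=> C [[EC CS]|[bC domC]] dC.
    have [A [u [v [chA CE Asep]]]] := Ediv C EC dC; exists A, u, v; split=> // T.
    move=> [[ET TS]|[bT domT]] ndT; first exact: Asep.
    have [c0 c0P] := Asep S ES ndS; exists c0 => c /c0P; exact: (sepor_dom domT).
  have [CE|[c CE]|CE] := blowup_local_cases r2 bC domC; first last.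
  + by case: (reg2_notdiv (chT_reg2 ch' 0)); rewrite -CE.
  + by case: (reg2_notdiv (chT_reg2 ch c)); rewrite -CE.
  exists (blowup_chart S x), x, (y / x); split=> // T [[ET TS]|[bT domT]] ndT.
    exists 0 => c _; left; apply: (sep_dom (S := S)); last exact: sepST.
    exact: (chT_dominates c r2).
  have [TE|[c TE]|TE] := blowup_local_cases r2 bT domT.
  + by case: ndT; exists (blowup_chart S x), x, (y / x).
  + by exists c => c' cc'; left; rewrite TE; exact: (sep_chT ch).
  + by exists 0 => c' _; left; rewrite TE; exact: (sep_chT_inf c' r2).
Qed.

Lemma Inv_blowup_closedpt E S : Inv E -> E S -> closedpt E S -> Inv (blowup_exc E S).
Proof.
move=> [E1 E2 E3] ES [x [y [a [b [r2 _ _ eqx [hx hy]]]]]].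
apply: (Inv_blowup r2 ES eqx hy (a' := b) (b' := a.+1)) => //.
  have [f [e [mf Se Sei e0 fE]]] := eqx; exists f, e; split=> //.
  by rewrite fE mulrAC.
by move=> T ET _; exact: E1.
Qed.

(** The maximal ideal of a discrete valuation ring is principal, so blowing it up changes nothing.
    This settles a center that is the generic point of a component without proving that such a point
    is never closed. *)
Lemma blowup_isdiv S T : isdiv S -> blowup_local S T /\ dominates T S <-> T = S.
Proof.
move=> dS; have [A [x [t [ch SE]]]] := dS; have sS := isdiv_salg dS.
have x0 := ch_x0 ch; have mSE : maxideal S = mulset x S by rewrite SE (chC_max ch).
have Sx : S x by rewrite SE; apply: (A_chC ch); exact: (ch_x ch).
have mx : maxideal S x by rewrite mSE; exists 1; [exact: (salg1 sS)|rewrite mulr1].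
have mSid : ideal_in S (maxideal S).
  split; first by move=> z [].
  - by rewrite mSE; exists 0; [exact: (salg0 sS)|rewrite mulr0].
  - by move=> z w; exact: isdiv_maxD.
  - by move=> z w; exact: isdiv_maxM.
split=> [[[u [mu u0 [P Pp TE]]] [ST mT]]|->].
  have sT : salg k T.
    by rewrite TE; apply: ploc_salg Pp; exact: (blowup_chart_salg sS mSid mu u0).
  rewrite SE in ST; have [TS|TT] := chC_over ch sT ST; first by rewrite SE; apply/seteqP.
  by have [_ []] := mT x mx; exists x^-1; rewrite ?mulfV // TT.
split; last by split.
have chS : blowup_chart S x = S.
  apply/seteqP; split=> z; last by move=> Sz; exists 0%N, z; split=> //; rewrite divr1.
  move=> [n [s [sn ->]]].
  have [w Sw ->] : mulset (x ^+ n) S s.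
    move: n s sn; apply: ideal_pow_ind.
    - by move=> s Ss; exists s; rewrite ?mul1r.
    - by move=> n; exists 0; [exact: (salg0 sS)|rewrite mulr0].
    - by move=> n s s'; exact: (mulsetD sS).
    - move=> n s s'; rewrite mSE => -[v Sv ->] [v' Sv' ->]; exists (v * v').
        exact: (salgM sS).
      by rewrite exprS; ring.
  by rewrite mulrC mulKf // expf_neq0.
exists x; split=> //; exists (maxideal S).
  rewrite chS; split=> //; first exact: isdiv_max1.
  move=> z w Sz Sw mzw; have [?|nz] := pselect (maxideal S z); [by left|right].
  have z0 : z != 0 by apply/eqP => z0; apply: nz; rewrite z0; case: mSid.
  by rewrite -(mulKf z0 w); apply: isdiv_maxM => //; exact: isdiv_unit.
rewrite chS; apply/seteqP; split=> z.
  move=> Sz; exists z, 1; split=> //; [exact: (salg1 sS)|exact: isdiv_max1|by rewrite divr1].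
by move=> [a [b [Sa Sb mb ->]]]; apply: (salgM sS) => //; exact: isdiv_unit.
Qed.

Lemma dominates_trans S T U : dominates U T -> dominates T S -> dominates U S.
Proof.
move=> [TU mTU] [ST mST]; split; first by move=> z /ST/TU.
by move=> z /mST/mTU.
Qed.

Lemma exceptional_blowup X S : dominates S B ->
  exceptional (blowup X S) = blowup_exc (exceptional X) S.
Proof.
move=> domS; apply/seteqP; split=> T.
  by move=> [[[XT TS]|[bT domT]] dT]; [left|right].
move=> [[[XT dT] TS]|[bT domT]]; split=> //; [by left|by right|].
exact: (dominates_trans domT).
Qed.

End ExceptionalPoints.

(** * The exceptional divisor of a modification *)

Section Modification.
Variables (K : closedFieldType) (R : idomainType) (iota : {rmorphism K -> R}).
Local Notation F := {fraction R}.
Local Notation k := (kap iota).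
Local Notation chart := (chart iota).
Local Notation chT := (@chT K R iota).
Local Notation reg2 := (reg2 iota).
Local Notation mR := (maxideal [set: R]).
Local Notation B := (@base_ring R).
Local Notation isdiv := (isdiv iota).
Local Notation Inv := (Inv iota).
Implicit Types (S T A C : set F) (E X : set (set F)).

Hypothesis HR : complete_regular_local_ring iota 2.
Variables x0 y0 : R.
Hypothesis xyP : forall f, mR f <-> exists a b, f = a * x0 + b * y0.
Hypotheses (x00 : x0 != 0) (y00 : y0 != 0).

Let mx0 : mR x0. Proof. by apply/xyP; exists 1, 0; ring. Qed.
Let my0 : mR y0. Proof. by apply/xyP; exists 0, 1; ring. Qed.

Lemma baseE f : B f%:F. Proof. by exists f. Qed.

Lemma base_max z : maxideal B z <-> exists2 f, mR f & z = f%:F.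
Proof.
split=> [[[f _ <-] nu]|[f [_ nu] ->]].
  exists f => //; split=> // -[g _ fg]; apply: nu; exists g%:F; first exact: baseE.
  by rewrite -tofracM fg tofrac1.
split; first exact: baseE.
move=> [_ [g _ <-]]; rewrite -tofracM -tofrac1 => /eqP; rewrite tofrac_eq => /eqP fg.
by apply: nu; exists g.
Qed.

Lemma base_salg : salg k B.
Proof.
split; first by move=> c; exact: baseE.
- by move=> _ _ [f _ <-] [g _ <-]; rewrite -tofracD; exact: baseE.
- by move=> _ _ [f _ <-] [g _ <-]; rewrite -tofracM; exact: baseE.
Qed.

Lemma base_mid z : mid B x0%:F y0%:F z <-> exists2 f, mR f & z = f%:F.
Proof.
split=> [[_ [_ [[a _ <-] [b _ <-] ->]]]|[f /xyP[a [b ->]] ->]].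
  exists (a * x0 + b * y0); first by apply/xyP; exists a, b.
  by rewrite tofracD !tofracM; ring.
exists a%:F, b%:F; split; try exact: baseE.
by rewrite tofracD !tofracM; ring.
Qed.

Lemma base_reg2 : reg2 B x0%:F y0%:F.
Proof.
have loc : local2 k B x0%:F y0%:F.
  split; try exact: baseE; first exact: base_salg.
  - move=> _ [f _ <-]; have [c mc] := residue_field HR f.
    by exists c; apply/base_mid; exists (f - iota c) => //; rewrite tofracB.
  - move=> _ [f _ <-] mf; have uf : f \is a GRing.unit.
      apply: contrapT => /negP/mRE uf; apply: mf; apply/base_mid; by exists f.
    have -> : (f%:F)^-1 = (f^-1)%:F; last exact: baseE.
    apply: (mulfI (x := f%:F)); first by rewrite tofrac_eq0; apply: contraTneq uf => ->;
      rewrite unitr0.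
    rewrite mulfV -?tofracM ?mulrV ?tofrac1 // tofrac_eq0.
    by apply: contraTneq uf => ->; rewrite unitr0.
  - move/base_mid => [f mf]; rewrite -tofrac1 => /eqP; rewrite tofrac_eq => /eqP f1.
    by apply: (@mR1 R); rewrite f1.
split=> //.
- exact: baseE.
- by rewrite tofrac_eq0.
- by rewrite tofrac_eq0.
- move=> _ _ [f _ <-] [g _ <-]; rewrite -!tofracM => /eqP; rewrite tofrac_eq => /eqP fg.
  have [h ->] := y_regular HR xyP fg; exists h%:F; first exact: baseE.
  by rewrite tofracM mulrC.
- move=> _ [f _ <-] fm; rewrite (adic_sep HR (f := f)) ?tofrac0 // => n.
  have : exists2 g, g%:F = f%:F & ideal_pow [set: R] mR n g.
    move: (fm n); move: (f%:F) => z; move: n z.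
    apply: (ideal_pow_ind (P := fun n => [set z | exists2 g, g%:F = z & ideal_pow [set:
      R] mR n g])).
    - by move=> _ [g _ <-]; exists g.
    - by move=> n; exists 0; [rewrite tofrac0|exact: ideal_pow0].
    - move=> n _ _ [g <- gn] [h <- hn]; exists (g + h); first by rewrite tofracD.
      exact: (mRpowD gn hn).
    - move=> n _ _ /base_max[g mg ->] [h <- hn]; exists (g * h); first by rewrite tofracM.
      exact: ideal_mulr.
  by move=> [g /eqP]; rewrite tofrac_eq => /eqP ->.
- by move=> f mf; apply/base_mid; exists f.
Qed.

Lemma spec_base T : spec B T -> dominates T B -> T = B.
Proof.
move=> [P Pp TE] [BT mT]; have sB := base_salg; apply/seteqP; split=> // z.
rewrite TE => -[a [b [Ba Bb Pb ->]]]; apply: (salgM sB) => //.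
have loc := r_local base_reg2; apply: (l_unit loc) => // mb; apply: Pb.
by apply/(ploc_maxA sB Pp Bb); rewrite -TE; apply: mT; rewrite (mid_maxideal loc).
Qed.

Lemma dominates_refl S : dominates S S. Proof. by split. Qed.

(** At the first blow-up x0 and y0 themselves serve as the functions of [exc_eq], with exponents 1
    and 0, so that no earlier exceptional curve is asked for. *)
Lemma modification_inv X : modification X -> Inv (exceptional X).
Proof.
elim=> {X} [|X S _ IH [XS _] domS].
  rewrite (exceptional_blowup _ (@dominates_refl B)).
  have -> : blowup_exc (exceptional (spec B)) B = blowup_exc [set B] B.
    apply/seteqP; split=> T [[ET TB]|]; try by right.
      by case: ET => sT dT; case: TB; exact: spec_base.
  have oneB T : [set B] T -> T = B by [].
  have r2 := base_reg2.
  have eq1 x y : mR x -> exc_eq B x%:F y%:F 1 0.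
    move=> mx; exists x, 1; split=> //; [exact: (salg1 base_salg)| |exact: oner_neq0|].
      by rewrite invr1; exact: (salg1 base_salg).
    by rewrite mul1r expr1 expr0 mulr1.
  apply: (Inv_blowup r2 _ (eq1 x0 y0 mx0) _ (eq1 y0 x0 my0)) => //.
  - by move=> T T' /oneB -> /oneB ->.
  - by move=> C /oneB -> /(reg2_notdiv r2).
have ES : exceptional X S by [].
rewrite (exceptional_blowup _ domS); have [I1 _ _] := IH.
have [dS|] := I1 S ES; last exact: Inv_blowup_closedpt.
have -> // : blowup_exc (exceptional X) S = exceptional X.
apply/seteqP; split=> T; first by case=> [[]|/(blowup_isdiv _ dS) ->].
move=> ET; have [->|TS] := pselect (T = S); last by left.
by right; apply/(blowup_isdiv _ dS).
Qed.

Lemma modification_base X T : modification X -> X T -> B `<=` T.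
Proof.
move=> modX; elim: modX T => {X} [|X S _ IH [XS _] domS] T.
  move=> [[[P [_ P1 _] ->] _]|[_ [] //]].
  by move=> z Bz; exists z, 1; split; rewrite ?divr1 //; exact: (salg1 base_salg).
move=> [[XT _]|[_ [ST _]]]; first exact: IH.
by move=> z Bz; apply: ST; exact: IH.
Qed.

Variable X : set (set F).
Hypothesis modX : modification X.
Let InvX : Inv (exceptional X) := modification_inv modX.

Lemma exceptional_salg T : exceptional X T -> salg k T.
Proof.
have [I1 _ _] := InvX; move=> /I1[/isdiv_salg//|[x [y [a [b [r2 _ _ _ _]]]]]].
by case: r2 => -[].
Qed.

Lemma isdiv_component C : exceptional X C -> isdiv C -> component X C.
Proof.
move=> EC dC; split=> // T ET CT.
by apply: (isdiv_over dC mx0 x00) => //; [exact: exceptional_salg|case: ET].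
Qed.

Lemma component_isdiv C : component X C -> isdiv C.
Proof.
move=> [EC Cmin]; have [I1 _ _] := InvX.
have [//|[x [y [a [b [_ _ _ _ [[C' [EC' dC' [CC' _]]] _]]]]]]] := I1 C EC.
by rewrite -(Cmin C' EC' CC').
Qed.

Lemma component_good C : component X C -> good_div iota (exceptional X) C.
Proof.
by move=> cC; have [_ _ I3] := InvX; apply: I3; [case: cC|exact: component_isdiv].
Qed.

(** Otherwise every prime containing [I] contains the maximal ideal, and there is no chain of two
    primes. *)
Lemma dim1_not_max T I : (forall z, T z -> ~ maxideal T z -> T z^-1) ->
  (forall z, T z -> ~ maxideal T z -> z != 0) ->
  regular_quotient T I 1 -> ~ (maxideal T `<=` I).
Proof.
move=> Tu Tn0 [_ _ _ [[P [Pp Plt]] _] _] mI.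
have [z [P1z P0z]] : exists z, P (inord 1) z /\ ~ P (inord 0) z.
  by apply: proper_witness; apply: Plt; rewrite !inordK.
have [[[P1T _ _ PM] P11 _] _] := Pp (inord 1); have Tz := P1T _ P1z.
have nmz : ~ maxideal T z by move=> /mI Iz; apply: P0z; case: (Pp (inord 0)) => _; apply.
apply: P11; rewrite -(mulVf (Tn0 z Tz nmz)).
by apply: PM => //; exact: Tu.
Qed.

Section CurvettePoint.
Variables (C : set F) (Q : R) (T : set F).
Hypothesis cC : component X C.
Hypothesis tr : transverse_at X Q C T.

Let dC : isdiv C := component_isdiv cC.

Lemma transverse_exc : exceptional X T.
Proof.
have [[XT _] _ TC _ _] := tr; have BT := modification_base modX XT.
split=> //; split=> // z /[dup] mz [Bz _]; split; first exact: BT.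
move=> [w Tw zw]; have [[_ [_ mC]] _] := cC.
by have [_] := mC z mz; apply; exists w => //; exact: TC.
Qed.

(** For a discrete valuation ring the exceptional ideal would be the whole maximal ideal, whereas
    its quotient has dimension 1. *)
Lemma transverse_notdiv : ~ isdiv T.
Proof.
move=> dT; have [_ _ _ rq _] := tr.
apply: (dim1_not_max _ _ rq).
- by move=> z; exact: (isdiv_unit dT).
- move=> z Tz nm; apply/eqP => z0; apply: nm; rewrite z0; split.
    exact: (salg0 (isdiv_salg dT)).
  by move=> [w _]; rewrite mul0r => /esym/eqP; rewrite oner_eq0.
move=> z mz; split; first by case: mz.
move=> C' cC' TC'; suff -> : C' = T by [].
by apply: (isdiv_over dT mx0 x00) => //;
  [exact: (isdiv_salg (component_isdiv cC'))|case: cC' => -[]].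
Qed.

(** Smoothness of the reduced E at [T] excludes a crossing. On a component C' through [T], x
    vanishes because a power of it is a unit times an element of the maximal ideal of R; if anything
    outside xT vanished too, so would y, and C' could not be separated from [T]. *)
Lemma transverse_point : exists x y a,
  [/\ reg2 T x y,
      forall u w, T u -> T w -> mulset x T (u * w) -> mulset x T u \/ mulset x T w,
      forall z, T z -> ~ mulset x T z ->
        exists n u w, [/\ T u, T w & y ^+ n = z * u + x * w],
      exc_eq T x y a.+1 0
    & forall C', component X C' -> T `<=` C' -> curve_at C' T x].
Proof.
have ET := transverse_exc; have ndT := transverse_notdiv.
have [I1 I2 _] := InvX.
have [//|[x [y [a [b [r2 prime fin eqT [hx hy]]]]]]] := I1 T ET.
have [Tloc TB x_0 y_0 reg _ _] := r2; have [sT Tx Ty _ _ T1] := Tloc.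
have mTE := mid_maxideal Tloc.
have Tmid z : mid T x y z -> T z := @mid_sub _ _ _ _ _ _ sT Tx Ty z.
have b0 : b = 0%N.
  have [//|b_gt0] := posnP b; have [Cy [ECy dCy Ty_at]] := hy b_gt0.
  have [Cx [ECx dCx Tx_at]] := hx; have [_ _ _ [_ _ _ _ [s [s1 mTs]]] _] := tr.
  exfalso; set I := exceptional_ideal X T in mTs.
  (* If x = 0 and y = 0 are both exceptional, the exceptional ideal lies in xyT. *)
  have Ixy z : I z -> exists2 w, T w & z = x * y * w.
    move=> [Tz Iz].
    have /(Tx_at.2 _ Tz)[z1 Tz1 zE1] := Iz Cx (isdiv_component ECx dCx) Tx_at.1.
    have /(Ty_at.2 _ Tz)[z2 Tz2 zE2] := Iz Cy (isdiv_component ECy dCy) Ty_at.1.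
    have [|w Tw wE] := reg z2 z1 Tz2 Tz1; first by rewrite mulrC -zE2 zE1 mulrC.
    by exists w => //; rewrite zE2 wE; ring.
  pose s0 := s`_0.
  have span z : maxideal T z <-> exists w c, [/\ I w, T c & z = w + c * s0].
    rewrite mTs; split=> [[w [c [Iw Tc ->]]]|[w [c [Iw Tc ->]]]].
      have [c' c'E] : exists c' : nat -> F, forall j : 'I_(size s), c j = c' j.
        by exists (fun n => if insub n is Some i then c i else 0) => j; rewrite valK.
      have i0 : (0 < size s)%N by rewrite s1.
      exists w, (c' 0%N); split=> //; first by rewrite -(c'E (Ordinal i0)).
      under eq_bigr do rewrite c'E.
      by rewrite -(big_mkord xpredT (fun j => c' j * s`_j)) s1 big_nat1.
    exists w, (fun=> c); split=> //.
    by rewrite -(big_mkord xpredT (fun j => c * s`_j)) s1 big_nat1.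
  have I0 : I 0.
    split; first exact: (salg0 sT).
    move=> C' cC' _; have dC' := component_isdiv cC'.
    by split; [exact: (salg0 (isdiv_salg dC'))|move=> [w _]; rewrite mul0r => /esym/eqP;
      rewrite oner_eq0].
  have [s1' [s2' [Ts1 Ts2 sE]]] : mid T x y s0.
    rewrite -mTE; apply/span; exists 0, 1; split=> //; first exact: (salg1 sT).
    by rewrite add0r mul1r.
  have mx : maxideal T x by rewrite mTE; exact: (midx _ _ sT).
  have my : maxideal T y by rewrite mTE; exact: (midy _ _ sT).
  have /span[_ [c [/Ixy[w Tw ->] Tc xE]]] := mx.
  have /span[_ [d [/Ixy[v Tv ->] Td yE]]] := my.
  (* Modulo xy, x and y are c s0 and d s0. Comparing d x with c y shows that x divides c, and then
     that d vanishes at [T]. *)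
  have md : mid T x y d.
    have eqd : (d - y * (d * w - c * v)) * x = c * y.
      have E : d * x - c * y = x * y * (d * w - c * v).
        transitivity (d * (x * y * w + c * s0) - c * (x * y * v + d * s0)); last by ring.
        by rewrite -xE -yE.
      transitivity (d * x - x * y * (d * w - c * v)); first by ring.
      by rewrite -E; ring.
    have Td' : T (d - y * (d * w - c * v)).
      apply: (salgB sT) => //; apply: (salgM sT) => //.
      by apply: (salgB sT); exact: (salgM sT).
    have [u Tu uE] := reg c _ Tc Td' (esym eqd).
    exists 0, (u + (d * w - c * v)); split; first exact: (salg0 sT).
      by apply: (salgD sT) => //; apply: (salgB sT); exact: (salgM sT).
    have dE : d = u * y + y * (d * w - c * v).
      apply/eqP; rewrite -subr_eq; apply/eqP; apply: (mulIf x_0).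
      by rewrite eqd uE; ring.
    by rewrite {1}dE; ring.
  (* As s0 lies in (x, y), inserting it into y = xyv + d s0 makes x divide 1 - xv - d s2', which is
     1 modulo the maximal ideal. *)
  have eq1 : (1 - x * v - d * s2') * y = d * s1' * x.
    have -> : (1 - x * v - d * s2') * y = y - x * y * v - d * (y * s2') by ring.
    by rewrite {1}yE sE; ring.
  have Tl : T (1 - x * v - d * s2').
    by apply: (salgB sT); [apply: (salgB sT);
      [exact: (salg1 sT)|exact: (salgM sT)]|exact: (salgM sT)].
  have [u Tu uE] := reg _ (d * s1') Tl (salgM sT Td Ts1) eq1.
  apply: T1; have -> : 1 = x * (v + u) + d * s2'.
    by apply/eqP; rewrite -subr_eq0; apply/eqP; rewrite -[RHS](subrr (x * u)) -{1}uE; ring.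
  apply: (midD sT).
    exists (v + u), 0; split; [exact: (salgD sT)|exact: (salg0 sT)|ring].
  by rewrite mulrC; exact: (midM sT).
rewrite b0 in eqT; exists x, y, a; split=> // C' cC' TC'; split=> // z Tz.
have dC' := component_isdiv cC'; have sC' := isdiv_salg dC'.
have [f [e [mf Te Tei e0 fE]]] := eqT.
have mx : maxideal C' x.
  apply: contrapT => nmx; have Cxi := isdiv_unit dC' (TC' _ Tx) nmx.
  have [[_ [_ mBC]] _] := cC'.
  have /mBC : maxideal B f%:F by apply/base_max; exists f.
  move=> [_]; apply; exists (e^-1 * x^-1 ^+ a.+1).
    by apply: (salgM sC'); [exact: TC'|exact: (salgX _ sC')].
  by rewrite fE expr0 mulr1 mulrACA mulfV // mul1r -exprMn mulfV // expr1n.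
split; last by move=> [w Tw ->]; rewrite mulrC; exact: (isdiv_maxM dC' (TC' _ Tw) mx).
move=> mz; apply: contrapT => xz; have [n [u [w [Tu Tw yE]]]] := fin z Tz xz.
have my : maxideal C' y.
  apply: contrapT => nmy; have Cyi := isdiv_unit dC' (TC' _ Ty) nmy.
  have : maxideal C' (y ^+ n).
    rewrite yE; apply: (isdiv_maxD dC').
      by rewrite mulrC; exact: (isdiv_maxM dC' (TC' _ Tu) mz).
    by rewrite mulrC; exact: (isdiv_maxM dC' (TC' _ Tw) mx).
  move=> [_]; apply; exists (y^-1 ^+ n); first exact: (salgX _ sC').
  by rewrite -exprMn mulfV // expr1n.
have TC'n : T <> C' by move=> TE; apply: ndT; rewrite TE.
have [z' [mz' [Cz' z'0]]] := I2 T C' ET cC'.1 ndT TC'n.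
move: mz'; rewrite mTE => -[u' [w' [Tu' Tw' z'E]]].
have : maxideal C' z'.
  rewrite z'E [x * _]mulrC [y * _]mulrC.
  exact: (isdiv_maxD dC' (isdiv_maxM dC' (TC' _ Tu') mx) (isdiv_maxM dC' (TC' _ Tw') my)).
by move=> [_]; apply; exists z'^-1 => //; rewrite mulfV.
Qed.

End CurvettePoint.
End Modification.

(** * Component valuations and curvettes *)

(** Component valuations are nonnegative on nonzero elements of R, so there the absolute value only
    changes the type ([ordvE]). *)
Definition ordv (R : idomainType) (nu : {fraction R} -> int) (f : R) : nat :=
  `|nu f%:F|%N.

Section ComponentValuation.
Variables (K : closedFieldType) (R : idomainType) (iota : {rmorphism K -> R}).
Local Notation F := {fraction R}.
Local Notation k := (kap iota).
Local Notation chart := (chart iota).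
Local Notation mR := (maxideal [set: R]).
Local Notation B := (@base_ring R).
Variable nu : F -> int.

Lemma chC_maxpow A u t n z : chart A u t ->
  ideal_pow (chC A u) (maxideal (chC A u)) n z -> mulset (u ^+ n) (chC A u) z.
Proof.
move=> ch; have sC := chC_salg ch; rewrite (chC_max ch); move: n z; apply: ideal_pow_ind.
- by move=> z Cz; exists z; rewrite ?mul1r.
- by move=> n; exists 0; [exact: (salg0 sC)|rewrite mulr0].
- by move=> n z w; exact: (mulsetD sC).
- move=> n _ _ [a Ca ->] [b Cb ->]; exists (a * b); first exact: (salgM sC).
  by rewrite exprS; ring.
Qed.

Lemma component_val_unit A u t f n w : chart A u t -> component_valuation (chC A u) nu ->
  f != 0 -> chC A u w -> chC A u w^-1 -> w != 0 -> f%:F = u ^+ n * w -> nu f%:F = n%:Z.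
Proof.
move=> ch cv f0 Cw Cwi w0 fE; have sC := chC_salg ch; have u0 := ch_x0 ch.
have [m [-> fm fm1]] := cv f f0.
have Cu j : chC A u (u ^+ j) by apply: (salgX _ sC); apply: (A_chC ch); exact: (ch_x ch).
have mu : maxideal (chC A u) u.
  by rewrite (chC_max ch); exists 1; [exact: (salg1 sC)|rewrite mulr1].
congr Posz; apply/eqP; rewrite eqn_leq; apply/andP; split; rewrite leqNgt; apply/negP => mn.
  have [c Cc fE'] := chC_maxpow ch fm; case: (chC_x ch).
  have wE : w = u * (u ^+ (m - n.+1) * c).
    apply: (mulfI (expf_neq0 n u0)); rewrite -fE fE' !mulrA -exprSr -exprD.
    by congr (_ ^+ _ * _); lia.
  have -> : u^-1 = u ^+ (m - n.+1) * c * w^-1.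
    by apply: (mulfI u0); rewrite mulfV // mulrA -wE mulfV.
  by do 2!apply: (salgM sC) => //.
apply: fm1; have -> : f%:F = u ^+ m.+1 * (u ^+ (n - m.+1) * w).
  by rewrite fE mulrA -exprD; congr (_ ^+ _ * _); lia.
by apply: ideal_powX => //; exact: (salgM sC).
Qed.

Lemma component_chart_val A u t : chart A u t -> component_valuation (chC A u) nu ->
  chart_val A u (ordv nu).
Proof.
move=> ch cv f f0; have fF0 : f%:F != 0 by rewrite tofrac_eq0.
have [n [a [Aa ua fE]]] := chart_order ch (ch_base ch f) fF0.
have a0 := loc_neq0 (mulset0 ch) ua; exists a; split=> //.
by rewrite /ordv (component_val_unit ch cv f0 (A_chC ch Aa) (chC_unit ch Aa ua) a0 fE).
Qed.

Lemma ordvE C f : component_valuation C nu -> f != 0 -> nu f%:F = (ordv nu f)%:Z.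
Proof. by move=> cv f0; rewrite /ordv; have [n [-> _ _]] := cv f f0. Qed.

Lemma ordvM f g : discrete_valuation nu -> (forall f, f != 0 -> nu f%:F = (ordv nu f)%:Z) ->
  f != 0 -> g != 0 -> ordv nu (f * g) = (ordv nu f + ordv nu g)%N.
Proof.
move=> [nuM _ _] nuE f0 g0; apply/eqP; rewrite -eqz_nat PoszD -!nuE ?mulf_neq0 //.
by rewrite tofracM nuM // tofrac_eq0.
Qed.

Variables (C T : set F) (x y : F) (a : nat).
Hypotheses (r2 : reg2 iota T x y)
  (primeT : forall u w, T u -> T w -> mulset x T (u * w) -> mulset x T u \/ mulset x T w)
  (finT : forall z, T z -> ~ mulset x T z ->
    exists n u w, [/\ T u, T w & y ^+ n = z * u + x * w])
  (eqT : exc_eq T x y a.+1 0).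
Hypotheses (dC : isdiv iota C) (CT : curve_at C T x) (domC : dominates C B).
Hypotheses (cv : component_valuation C nu) (dv : discrete_valuation nu).

(** In [C], x is a unit times u^j with j > 0, so all values on R are multiples of j. As [nu] takes
    the value 1, j is 1 and the powers of x measure [nu]. *)
Lemma curve_order : forall f, f != 0 ->
  exists z, [/\ T z, ~ mulset x T z & f%:F = x ^+ ordv nu f * z].
Proof.
have [A [u [t [ch CE]]]] := dC; have sC := isdiv_salg dC; have u0 := ch_x0 ch.
have [Tloc TB x0 _ _ _ _] := r2; have [sT Tx _ _ _ _] := Tloc.
have Cx : C x by exact: CT.1.
have nuE f : f != 0 -> nu f%:F = (ordv nu f)%:Z by exact: ordvE cv.
have [j [e [Ce Cei e0 xE]]] : exists j e, [/\ C e, C e^-1, e != 0 & x = u ^+ j * e].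
  rewrite CE; have [[|j] [e [Ce Cei e0 [xE|xE]]]] := chC_dvr ch x0.
  - by exists 0%N, e.
  - by exists 0%N, e; split=> //; rewrite -xE mulr1 mul1r.
  - by exists j.+1, e.
  - case: (chC_x ch); have -> : u^-1 = x * u ^+ j * e^-1.
      by rewrite -xE exprS invf_mul // expf_neq0.
    rewrite -CE; apply: (salgM sC); last by rewrite CE.
    by apply: (salgM sC) => //; apply: (salgX _ sC); rewrite CE; apply: (A_chC ch);
      exact: (ch_x ch).
have j0 : (0 < j)%N.
  have [_ nx] : maxideal C x by apply/(CT.2 x Tx); exists 1; [exact: (salg1 sT)|rewrite mulr1].
  by case: j xE => // xE; case: nx; exists e^-1 => //; rewrite xE mul1r mulfV.
have Cu n : C (u ^+ n) by apply: (salgX _ sC); rewrite CE; apply: (A_chC ch); exact: (ch_x ch).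
have ord f : f != 0 -> exists n z, [/\ T z, ~ mulset x T z, f%:F = x ^+ n * z
    & ordv nu f = (j * n)%N].
  move=> f0; have fF0 : f%:F != 0 by rewrite tofrac_eq0.
  have exn : exists n, `[< ~ mulset (x ^+ n) T f%:F >].
    exists (ordv nu f).+1; apply/asboolP => -[z Tz fE].
    have Cz := CT.1 z Tz.
    have cv' := component_chart_val ch; rewrite -CE in cv'.
    have [b [Ab ub fE']] := cv' cv f f0.
    have b0 := loc_neq0 (mulset0 ch) ub; case: (chC_x ch).
    set m := ordv nu f in fE fE'.
    have [d dE] : exists d, (j * m.+1 = m.+1 + d)%N by exists (j * m.+1 - m.+1)%N; nia.
    have bE : b = u * (u ^+ d * e ^+ m.+1 * z).
      apply: (mulfI (expf_neq0 m u0)); rewrite -fE' fE xE exprMn -exprM dE exprD exprSr.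
      ring.
    have -> : u^-1 = u ^+ d * e ^+ m.+1 * z * b^-1.
      by apply: (mulfI u0); rewrite mulfV // [RHS]mulrA -bE mulfV.
    rewrite -CE; apply: (salgM sC); last by rewrite CE; exact: (chC_unit ch).
    by apply: (salgM sC) => //; apply: (salgM sC) => //; exact: (salgX _ sC).
  have [[|n] /asboolP nP nmin] := ex_minnP exn.
    by case: nP; exists f%:F; [exact: TB|rewrite mul1r].
  have [z Tz fE] : mulset (x ^+ n) T f%:F.
    by apply: contrapT => /asboolP/nmin; rewrite ltnn.
  have xz : ~ mulset x T z.
    move=> [w Tw zE]; apply: nP; exists w => //; by rewrite fE zE exprSr mulrA.
  exists n, z; split=> //.
  have Cz := CT.1 z Tz; have z0 : z != 0 by apply: contraNneq fF0 => z0; rewrite fE z0 mulr0.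
  have Czi : C z^-1 by apply: (isdiv_unit dC) => // mz; apply: xz; apply/(CT.2 z Tz).
  have fE2 : f%:F = u ^+ (j * n) * (e ^+ n * z) by rewrite fE xE exprMn -exprM mulrA.
  have cvu := @component_val_unit A u t f (j * n) (e ^+ n * z) ch.
  rewrite -CE in cvu; rewrite /ordv cvu //.
  - by apply: (salgM sC) => //; exact: (salgX _ sC).
  - by rewrite invfM -exprVn; apply: (salgM sC) => //; exact: (salgX _ sC).
  - by rewrite mulf_neq0 // expf_neq0.
have j1 : j = 1%N.
  have [nuM _ surj] := dv; have [z z0 nz] := surj 1.
  have [p [q [q0 zE]]] := fracP z; have qF0 : q%:F != 0 by rewrite tofrac_eq0.
  have p0 : p != 0 by rewrite -tofrac_eq0 -zE mulf_neq0.
  have := nuM z q%:F z0 qF0; rewrite zE nz !nuE //.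
  have [n [_ [_ _ _ ->]]] := ord p p0; have [m [_ [_ _ _ ->]]] := ord q q0.
  move=> nm; have {}nm : (j * n = j * m + 1)%N by lia.
  apply/eqP; rewrite -dvdn1 -(dvdn_addr _ (dvdn_mulr m (dvdnn j))) -nm.
  exact: dvdn_mulr.
by move=> f /ord[n [z [Tz xz fE ->]]]; exists z; rewrite j1 mul1n.
Qed.

Lemma curve_place : place iota (ordv nu) T x y.
Proof.
have [Tloc TB x0 _ _ _ _] := r2; split=> //.
- have [f [e [mf Te Tei e0 fE]]] := eqT; exists f, a.+1, e; split=> //.
  by rewrite fE expr0 mulr1 mulrC.
- move=> f mf; apply/(CT.2 _ (TB f)); case: domC => _; by apply; apply/base_max; exists f.
- exact: curve_order.
Qed.

End ComponentValuation.

Section CurvettePlace.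
Variables (K : closedFieldType) (R : idomainType) (iota : {rmorphism K -> R}).
Local Notation F := {fraction R}.
Local Notation mR := (maxideal [set: R]).
Local Notation B := (@base_ring R).
Local Notation isdiv := (isdiv iota).
Hypothesis HR : complete_regular_local_ring iota 2.
Variables x0 y0 : R.
Hypothesis xyP : forall f, mR f <-> exists a b, f = a * x0 + b * y0.
Hypotheses (x00 : x0 != 0) (y00 : y0 != 0).
Variable X : set (set F).
Hypothesis modX : modification X.

Lemma component_dominates C : component X C -> dominates C B.
Proof. by case=> -[]. Qed.

(** Both components have the same equation x at [T], and its order in f determines both valuations.
    So curvettes of distinct valuations meet E in distinct points. *)
Lemma transverse_same C C' Q Q' T (nu nu' : F -> int) :
  component X C -> component X C' -> transverse_at X Q C T -> transverse_at X Q' C' T ->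
  component_valuation C nu -> component_valuation C' nu' ->
  discrete_valuation nu -> discrete_valuation nu' ->
  forall f, f != 0 -> ordv nu f = ordv nu' f.
Proof.
move=> cC cC' tr tr' cv cv' dv dv' f f0.
have [x [y [a [r2 pT fT eT curves]]]] := transverse_point HR xyP x00 y00 modX cC tr.
have [_ _ TC _ _] := tr; have [_ _ TC' _ _] := tr'.
have pl := curve_place r2 pT fT eT (component_isdiv HR xyP x00 y00 modX cC)
  (curves _ cC TC) (component_dominates cC) cv dv.
have pl' := curve_place r2 pT fT eT (component_isdiv HR xyP x00 y00 modX cC')
  (curves _ cC' TC') (component_dominates cC') cv' dv'.
have x_0 := pl_x0 pl; have uniq n m z w : T z -> ~ mulset x T w -> (m < n)%N ->
    x ^+ n * z = x ^+ m * w -> False.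
  move=> Tz xw mn xE; apply: xw; exists (x ^+ (n - m.+1) * z).
    have [[sT Tx _ _ _ _] _ _ _ _ _ _ _] := pl.
    by apply: (salgM sT) => //; exact: (salgX _ sT).
  apply: (mulfI (expf_neq0 m x_0)); rewrite -xE !mulrA -exprSr -exprD.
  by congr (_ ^+ _ * _); lia.
have [z [Tz xz fE]] := pl_val pl f0; have [w [Tw xw fE']] := pl_val pl' f0.
apply/eqP; rewrite eqn_leq; apply/andP; split; rewrite leqNgt; apply/negP => nm.
  by apply: (uniq _ _ z w Tz xw nm); rewrite -fE.
by apply: (uniq _ _ w z Tw xz nm); rewrite -fE'.
Qed.

(** The multiplicity is 1 because transversality makes the ideals of the strict transform and of x =
    0 generate the maximal ideal of [T]. *)
Lemma curvette_place C Q (nu : F -> int) : component X C -> component_valuation C nu ->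
  discrete_valuation nu -> curvette X C Q ->
  exists T x y, [/\ transverse_at X Q C T, exceptional X T, ~ isdiv T,
    place iota (ordv nu) T x y
    & passes (ordv nu) T x y Q /\ mult iota (ordv nu) T x Q 1].
Proof.
move=> cC cv dv [mQ irrQ smooth [T tr]]; exists T.
have [x [y [a [r2 pT fT eT curves]]]] := transverse_point HR xyP x00 y00 modX cC tr.
have [strT cpT TC _ mTE] := tr; have curveT := curves _ cC TC.
have pl := curve_place r2 pT fT eT (component_isdiv HR xyP x00 y00 modX cC)
  curveT (component_dominates cC) cv dv.
exists x, y; have [XT TG] := strT.
have Qp := irred_prime HR xyP x00 irrQ; have [Q0 _ Qprime] := Qp.
have Q_1 : ~ divides Q 1 by move=> [h Qh]; case: mQ => _; apply; exists h.
have [Tloc TB x_0 _ _ _ _] := r2; have [sT Tx Ty _ Tu T1] := Tloc.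
pose PQ : set F := [set z | exists h, z = (Q * h)%:F].
have PQE f : PQ f%:F <-> divides Q f.
  by split=> -[h hE]; exists h; [apply/eqP; rewrite -tofrac_eq hE|rewrite hE].
have sB := base_salg iota.
have PQp : prime_in B PQ.
  split.
  - split.
    + by move=> _ [h ->]; exact: baseE.
    + by exists 0; rewrite mulr0 tofrac0.
    + by move=> _ _ [f ->] [g ->]; exists (f + g); rewrite mulrDr tofracD.
    + by move=> _ _ [f _ <-] [g ->]; exists (f * g); rewrite -tofracM; congr (_%:F); ring.
  - by rewrite -tofrac1 => /PQE.
  - move=> _ _ [f _ <-] [g _ <-]; rewrite -tofracM => /PQE/Qprime[] ?; [left|right]; exact/PQE.
set G := curve_generic_point Q in TG.
have GE : G = localization B PQ by [].
have sG : salg (kap iota) G := ploc_salg sB PQp.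
(* The strict transform is one-dimensional at [T], so its ideal is not the maximal one; by
   transversality x then cannot vanish on the curve. *)
have curveI : ~ (maxideal T `<=` curve_ideal G T).
  apply: dim1_not_max; last exact: smooth.
    by rewrite (mid_maxideal Tloc) => z; exact: Tu.
  rewrite (mid_maxideal Tloc) => z Tz nm; apply/eqP => z0; apply: nm; rewrite z0.
  by exists 0, 0; split; [exact: (salg0 sT)|exact: (salg0 sT)|ring].
have sub_x : maxideal G x -> maxideal T `<=` curve_ideal G T.
  move=> mx z; rewrite mTE => -[p [w [[Tp mp] [Tw mw] ->]]].
  have /(curveT.2 w Tw)[v Tv wE] := mw.
  split; first exact: (salgD sT).
  apply: (ploc_maxD sB PQp) => //; rewrite wE mulrC; apply: (ploc_maxM sB PQp) => //.
  exact: TG.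
have QG : maxideal G Q%:F.
  by apply/(ploc_maxA sB PQp (baseE Q)); exists 1; rewrite mulr1.
(* If Q divided by its power of x were a unit, that power would vanish on the curve, and x with
   it. *)
have pass : passes (ordv nu) T x y Q.
  have [z [Tz xz QE]] := pl_val pl Q0.
  rewrite /passes QE mulrC mulKf ?expf_neq0 //; apply: contrapT => mz.
  have z0 : z != 0.
    apply/eqP => z0; apply: mz; rewrite z0.
    by exists 0, 0; split; [exact: (salg0 sT)|exact: (salg0 sT)|ring].
  have Gzi : G z^-1 by apply: TG; exact: Tu.
  have mxn : maxideal G (x ^+ ordv nu Q).
    have -> : x ^+ ordv nu Q = z^-1 * Q%:F by rewrite QE mulrCA mulVf ?mulr1.
    exact: (ploc_maxM sB PQp).
  apply: curveI; apply: sub_x; apply: contrapT => nx.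
  have Gxi : G x^-1 by apply: (ploc_local_unit PQp) => //; exact: TG.
  apply: (ploc_max1 sB PQp).
  have -> : 1 = x^-1 ^+ ordv nu Q * x ^+ ordv nu Q.
    by rewrite -exprMn mulVf // expr1n.
  by apply: (ploc_maxM sB PQp) => //; exact: (salgX _ sG).
have ET := transverse_exc iota modX cC tr.
have ndT := transverse_notdiv HR xyP x00 y00 modX tr.
split=> //.
split=> //; have [b _ Tb] := exc_mult HR xyP x00 pl irrQ pass.
suff b1 : b = 1%N by rewrite -b1.
apply: (mult1 pl pass Tb) => z; rewrite -(mid_maxideal Tloc) mTE.
move=> [p [w [[Tp mp] [Tw mw] ->]]].
have /(curveT.2 w Tw)[v Tv ->] := mw; exists v => //; rewrite addrK.
have [_ [_ [[u _ <-] [d _ <-] Pd pE]]] := mp.1.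
have PQ0 : PQ 0 by exists 0; rewrite mulr0 tofrac0.
have d0 := loc_neq0 PQ0 Pd.
apply: (curve_eq_local HR xyP x00 pl irrQ (u := u) (w := d) Tp).
- by move/PQE.
- apply/PQE; apply/(ploc_max PQp (baseE u) (baseE d) Pd); by rewrite -pE.
- by rewrite pE divfK.
Qed.

End CurvettePlace.

(** * Curves through general points *)

Section ClosedFieldPolynomials.
Variable K : closedFieldType.
Implicit Types (p q : {poly K}) (s : seq K) (c : K).

Lemma poly_roots p : p != 0 -> exists s, forall c, p.[c] = 0 -> c \in s.
Proof.
move=> p0; have [s pE] := closed_field_poly_normal p; exists s => c.
rewrite pE hornerZ => /eqP; rewrite mulf_eq0 lead_coef_eq0 (negPf p0) /=.
by rewrite -root_prod_XsubC.
Qed.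

(** The monic polynomial with roots [s], plus 1, has a root and takes the value 1 on [s]. *)
Lemma notin_ex s : exists c, c \notin s.
Proof.
pose p : {poly K} := \prod_(c <- s) ('X - c%:P) + 1.
have [s0|s0] := eqVneq (size s) 0%N.
  by exists 0; rewrite (size0nil s0).
have sp : size p != 1%N.
  rewrite size_polyDl size_prod_XsubC ?size_poly1 //.
  by case: (size s) s0.
have /closed_rootP[c] := sp; rewrite /root /p hornerD hornerC => pc; exists c.
apply/negP; rewrite -root_prod_XsubC => /rootP pc0.
by move: pc; rewrite pc0 add0r oner_eq0.
Qed.

Lemma distinct_ex n s : exists u : seq K, [/\ size u = n, uniq u & forall c, c \in u -> c \notin s].
Proof.
elim: n => [|n [u [su uu us]]]; first by exists [::].
have [c] := notin_ex (u ++ s); rewrite mem_cat negb_or => /andP[cu cs].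
exists (c :: u); rewrite /= su cu uu; split=> // d.
by rewrite inE => /orP[/eqP ->|/us].
Qed.

(* A nonconstant rational function p'/p on the line takes all but finitely
   many values at points outside any given finite set. *)
Lemma pencil_root p p' s : p != 0 -> (forall a, p' <> a *: p) ->
  exists s', forall a, a \notin s' ->
    exists c, [/\ c \notin s, (p' - a *: p).[c] = 0 & p.[c] != 0].
Proof.
move=> p0 nprop; have [sp spP] := poly_roots p0.
pose d := gcdp p p'; have d0 : d != 0 by rewrite gcdp_eq0 (negPf p0).
pose P : {poly K} := p %/ d; pose P' : {poly K} := p' %/ d.
have pE : p = P * d by rewrite divpK // dvdp_gcdl.
have p'E : p' = P' * d by rewrite divpK // dvdp_gcdr.
have cop : coprimep P P' by rewrite coprimep_div_gcd // p0.
have P0 : P != 0 by apply: contraNneq p0 => P0; rewrite pE P0 mul0r.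
have [s1 s1P] : exists s1, forall a, a \notin s1 -> (1 < size (P' - a *: P)%R)%N.
  have [[a0 sa0]|na] := pselect (exists a, (size (P' - a *: P)%R <= 1)%N); last first.
    by exists [::] => a _; rewrite ltnNge; apply/negP => sa; apply: na; exists a.
  exists [:: a0] => a; rewrite inE => aa0; rewrite ltnNge; apply/negP => sa.
  have sP : (size P <= 1)%N.
    have -> : P = (a - a0)^-1 *: ((P' - a0 *: P) - (P' - a *: P)).
      rewrite opprB addrCA addrAC subrr add0r -scalerBl scalerA mulVf ?scale1r // subr_eq0 //.
    rewrite (leq_trans (size_scale_leq _ _)) // (leq_trans (size_polyD _ _)) //.
    by rewrite size_polyN geq_max sa0 sa.
  have sP' : (size P' <= 1)%N.
    rewrite -(subrK (a *: P) P') (leq_trans (size_polyD _ _)) // geq_max sa.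
    exact: (leq_trans (size_scale_leq _ _)).
  have PC := size1_polyC sP; have PC' := size1_polyC sP'.
  have P00 : P`_0 != 0 by apply: contraNneq P0 => P00; rewrite PC P00.
  apply: (nprop (P'`_0 / P`_0)); rewrite p'E pE PC PC' !mul_polyC.
  by rewrite !coefC /= scalerA divfK.
exists (s1 ++ [seq P'.[c] / P.[c] | c <- s ++ sp]) => a; rewrite mem_cat negb_or.
move=> /andP[/s1P h1 ha].
have /closed_rootP[c /rootP hc] : size (P' - a *: P) != 1%N by rewrite neq_ltn h1 orbT.
have hpc : (p' - a *: p).[c] = 0.
  by rewrite p'E pE scalerAl -mulrBl hornerM hc mul0r.
have Pc : P'.[c] = a * P.[c].
  by apply/eqP; rewrite -subr_eq0 -hornerZ -hornerN -hornerD hc.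
have nc : c \notin s ++ sp.
  apply: contraNN ha => cs; apply/mapP; exists c => //.
  have Pc0 : P.[c] != 0.
    apply/eqP => Pc0; have := coprimep_root cop (p := P) (x := c).
    by rewrite /root Pc0 eqxx Pc Pc0 mulr0 => /(_ isT); rewrite eqxx.
  by rewrite Pc mulfK.
exists c; move: nc; rewrite mem_cat negb_or => /andP[cs cp]; split=> //.
by apply: contraNneq cp => /spP.
Qed.

Lemma pencil_neq p p' : p != 0 -> exists a0, forall a, a != a0 -> p' - a *: p != 0.
Proof.
move=> p0; exists (p'`_(size p).-1 / lead_coef p) => a; apply: contraNneq => e.
have := congr1 (fun q => q`_(size p).-1) e.
rewrite coefB coefZ coef0 -/(lead_coef p) => /eqP; rewrite subr_eq0 => /eqP ->.
by rewrite mulfK // lead_coef_eq0.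
Qed.

End ClosedFieldPolynomials.

Section Cofinite.
Variable K : closedFieldType.
Implicit Types P Q : K -> Prop.

Definition cofin P : Prop := exists s : seq K, forall c, c \notin s -> P c.

Lemma cofinI P Q : cofin P -> cofin Q -> cofin (fun c => P c /\ Q c).
Proof.
move=> [s sP] [s' sQ]; exists (s ++ s') => c; rewrite mem_cat negb_or.
by move=> /andP[/sP ? /sQ].
Qed.

Lemma cofinW P Q : (forall c, P c -> Q c) -> cofin P -> cofin Q.
Proof. by move=> PQ [s sP]; exists s => c /sP/PQ. Qed.

Lemma cofin_all (I : finType) (P : I -> K -> Prop) :
  (forall i, cofin (P i)) -> cofin (fun c => forall i, P i c).
Proof.
move=> /choice[s sP]; exists (flatten [seq s i | i <- enum I]) => c cs i.
apply: sP; apply: contraNN cs => ci; apply/flattenP; exists (s i) => //.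
by apply: map_f; rewrite mem_enum.
Qed.

Lemma cofin_notin (s : seq K) : cofin (fun c => c \notin s). Proof. by exists s. Qed.

Lemma cofin_neq a : cofin (fun c => c != a).
Proof. by exists [:: a] => c; rewrite inE. Qed.

Lemma cofin_ex P : cofin P -> exists c, P c.
Proof. by move=> [s sP]; have [c /sP] := notin_ex s; exists c. Qed.

Lemma cofin_root (p : {poly K}) : p != 0 -> cofin (fun c => p.[c] != 0).
Proof. by move=> /poly_roots[s sP]; exists s => c cs; apply: contraNneq cs => /sP. Qed.

End Cofinite.

Section Passing.
Variables (R : idomainType) (v : R -> nat) (K : fieldType) (iota : {rmorphism K -> R}).
Variables (T : set {fraction R}) (x y : {fraction R}).
Hypothesis pl : place iota v T x y.
Hypothesis vM : forall f g, f != 0 -> g != 0 -> v (f * g) = (v f + v g)%N.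

Lemma strict_in f : f != 0 -> T (f%:F / x ^+ v f).
Proof.
move=> f0; have [z [Tz _ ->]] := pl_val pl f0.
by rewrite mulrC mulKf // expf_neq0 // (pl_x0 pl).
Qed.

Lemma passesM f g : f != 0 -> g != 0 -> passes v T x y f -> passes v T x y (f * g).
Proof.
move=> f0 g0 pf; rewrite /passes vM // tofracM exprD -mulf_div mulrC.
have [[sT _ _ _ _ _] _ _ _ _ _ _ _] := pl.
by apply: (midM sT) => //; exact: strict_in.
Qed.

Lemma passes_nonunit f : passes v T x y f -> f != 0 -> f \isn't a GRing.unit.
Proof.
move=> pf f0; apply/negP => uf.
have [[sT _ _ _ _ T1] _ _ _ _ _ _ _] := pl.
have fi0 : f^-1 != 0 by rewrite invr_eq0.
have := passesM f0 fi0 pf; rewrite mulrV // /passes tofrac1.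
have v1 : v 1 = 0%N.
  have := vM (oner_neq0 R) (oner_neq0 R); rewrite mulr1 => e.
  by apply/eqP; rewrite -(eqn_add2l (v 1)) addn0 -e.
by rewrite v1 expr0 divr1.
Qed.

Lemma nonunit_val f : f != 0 -> f \isn't a GRing.unit -> (0 < v f)%N.
Proof.
move=> f0 /mRE mf; have [w Tw fE] := pl_mR pl mf; have [z [Tz xz fE']] := pl_val pl f0.
rewrite lt0n; apply/eqP => v0; apply: xz; exists w => //.
by rewrite -fE fE' v0 mul1r.
Qed.

End Passing.

(** * Independent classes and the subtraction of curvette values *)

Section ValueSemigroup.
Variables (K : closedFieldType) (R : idomainType) (iota : {rmorphism K -> R}).
Local Notation F := {fraction R}.
Local Notation mR := (maxideal [set: R]).
Variables (r : nat) (N : 'I_r -> R -> nat).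
Variables (A : 'I_r -> set F) (x t : 'I_r -> F).
Hypothesis ch : forall i, chart iota (A i) (x i) (t i).
Hypothesis chv : forall i, chart_val (A i) (x i) (N i).
Local Notation Tc i c := (chT iota (A i) (x i) (t i) c).
Local Notation yc i c := (t i - kap iota c).

(** The order n is fixed rather than exact, which makes the relation linear in f; p is 0 when f
    vanishes to higher order. *)
Definition ld i n f p : Prop :=
  exists a, [/\ A i a, lead iota (A i) (x i) (t i) a p & f%:F = x i ^+ n * a].

Lemma ldD i n f g p q : ld i n f p -> ld i n g q -> ld i n (f + g) (p + q).
Proof.
move=> [a [Aa ap fE]] [b [Ab bq gE]]; exists (a + b); split.
- exact: (salgD (ch_alg (ch i))).
- exact: (leadD (ch i)).
- by rewrite tofracD fE gE mulrDr.
Qed.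

Lemma ldZ i n f p c : ld i n f p -> ld i n (iota c * f) (c *: p).
Proof.
move=> [a [Aa ap fE]]; exists (kap iota c * a); split.
- by apply: (salgM (ch_alg (ch i))) => //; exact: (salgK _ (ch_alg (ch i))).
- exact: (leadZ (ch i)).
- by rewrite tofracM fE kapE mulrCA.
Qed.

Lemma ldM i n m f g p q : ld i n f p -> ld i m g q -> ld i (n + m) (f * g) (p * q).
Proof.
move=> [a [Aa ap fE]] [b [Ab bq gE]]; exists (a * b); split.
- exact: (salgM (ch_alg (ch i))).
- exact: (leadM (ch i)).
- by rewrite tofracM fE gE exprD mulrACA.
Qed.

Lemma ld0 i n : ld i n 0 0.
Proof.
exists 0; split; [exact: (salg0 (ch_alg (ch i)))| |by rewrite tofrac0 mulr0].
by apply/lead0; exact: (mulset0 (ch i)).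
Qed.

Lemma ldB i n f g p q c : ld i n f p -> ld i n g q -> ld i n (f - iota c * g) (p - c *: q).
Proof.
by move=> fp gq; rewrite -mulNr -rmorphN -scaleNr; apply: ldD => //; exact: ldZ.
Qed.

Lemma ld_uniq i n f p q : ld i n f p -> ld i n f q -> p = q.
Proof.
move=> [a [Aa ap fE]] [b [Ab bq fE']].
have ab : a = b by apply: (mulfI (expf_neq0 n (ch_x0 (ch i)))); rewrite -fE.
by rewrite -ab in bq; exact: (lead_uniq (ch i) ap bq).
Qed.

Lemma ld_ex i n f : f = 0 \/ (n <= N i f)%N -> exists p, ld i n f p.
Proof.
have [->|f0] := eqVneq f 0; first by exists 0; exact: ld0.
case=> [/eqP|nf]; first by rewrite (negPf f0).
have [a [Aa xa fE]] := chv i f0; have sA := ch_alg (ch i).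
have Axa : A i (x i ^+ (N i f - n) * a).
  by apply: (salgM sA) => //; apply: (salgX _ sA); exact: (ch_x (ch i)).
have [p ap] := lead_ex (ch i) Axa; exists p, (x i ^+ (N i f - n) * a); split=> //.
by rewrite fE mulrA -exprD subnKC.
Qed.

Lemma ld_cases i n f p : f != 0 -> ld i n f p ->
  (N i f = n /\ p != 0) \/ ((n < N i f)%N /\ p = 0).
Proof.
move=> f0 [a [Aa ap fE]]; have [b [Ab xb fE']] := chv i f0.
have sA := ch_alg (ch i); have xi0 := ch_x0 (ch i); have Ax := ch_x (ch i).
have [lt|gt|eq] := ltngtP (N i f) n.
- case: xb; exists (x i ^+ (n - (N i f).+1) * a).
    by apply: (salgM sA) => //; exact: (salgX _ sA).
  apply: (mulfI (expf_neq0 (N i f) xi0)); rewrite -fE' fE !mulrA -exprSr -exprD.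
  by congr (_ ^+ _ * _); lia.
- right; split=> //; apply: (lead_uniq (ch i) ap); apply/lead0.
  exists (x i ^+ (N i f - n.+1) * b).
    by apply: (salgM sA) => //; exact: (salgX _ sA).
  apply: (mulfI (expf_neq0 n xi0)); rewrite -fE fE' !mulrA -exprSr -exprD.
  by congr (_ ^+ _ * _); lia.
- left; split=> //; apply: (lead_neq0 ap) => xa; apply: xb.
  by have <- : a = b by apply: (mulfI (expf_neq0 n xi0)); rewrite -fE fE' eq.
Qed.

Lemma ld_neq0 i n f p : ld i n f p -> p != 0 -> f != 0 /\ N i f = n.
Proof.
move=> fp p0; have f0 : f != 0.
  by apply: contraNneq p0 => f0; rewrite f0 in fp; rewrite (ld_uniq fp (ld0 i n)).
by split=> //; have [[]|[_ /eqP]] := ld_cases f0 fp; rewrite ?(negPf p0).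
Qed.

Lemma ld_val i f : f != 0 -> exists2 p, ld i (N i f) f p & p != 0.
Proof.
move=> f0; have [|p fp] := @ld_ex i (N i f) f; first by right.
by exists p => //; have [[]|[]] := ld_cases f0 fp; rewrite ?ltnn.
Qed.

Hypothesis NM : forall i f g, f != 0 -> g != 0 -> N i (f * g) = (N i f + N i g)%N.
Hypothesis HR : complete_regular_local_ring iota 2.
Variables x0 y0 : R.
Hypothesis xyP : forall f, mR f <-> exists a b, f = a * x0 + b * y0.
Hypothesis x00 : x0 != 0.

Definition pas i c f : Prop := passes (N i) (Tc i c) (x i) (yc i c) f.

Lemma pas_ld i c f p : ld i (N i f) f p -> pas i c f <-> p.[c] = 0.
Proof. by move=> [a [Aa ap fE]]; exact: (chT_passes (ch i) c fE Aa ap). Qed.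

Lemma pasM i c f g : f != 0 -> g != 0 -> pas i c (f * g) -> pas i c f \/ pas i c g.
Proof.
move=> f0 g0; have [p fp _] := ld_val i f0; have [q gq _] := ld_val i g0.
have := ldM fp gq; rewrite -NM // => /pas_ld => /(_ c)[H _] /H/eqP.
rewrite hornerM mulf_eq0 => /orP[]/eqP pc; [left|right]; first exact/(pas_ld c fp).
exact/(pas_ld c gq).
Qed.

Definition good i c : Prop := place iota (N i) (Tc i c) (x i) (yc i c).

(** Nonunits have positive value, so splitting f lowers [N i], and one of the two factors still
    passes through the point. *)
Lemma extract_irreducible i c f : good i c -> f != 0 -> pas i c f ->
  exists q g, [/\ irreducible_elt q, f = q * g & pas i c q].
Proof.
move=> pl; have [n] := ubnP (N i f); elim: n f => // n IHn f; rewrite ltnS => fn f0 pf.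
have [irr|nirr] := pselect (irreducible_elt f); first by exists f, 1; rewrite mulr1.
have fu := passes_nonunit pl (NM i) pf f0.
have [a [b [fE au bu]]] : exists a b, [/\ f = a * b, a \isn't a GRing.unit & b \isn't a GRing.unit].
  apply: contrapT => nex; apply: nirr; split=> // a b fE.
  have [ua|ua] := boolP (a \is a GRing.unit); [by left|right].
  by apply: contrapT => /negP ub; apply: nex; exists a, b.
have [a0 b0] : a != 0 /\ b != 0 by apply/andP; move: f0; rewrite fE mulf_eq0 negb_or.
have Na := nonunit_val pl a0 au; have Nb := nonunit_val pl b0 bu.
have fN : N i f = (N i a + N i b)%N by rewrite fE NM.
move: pf; rewrite fE => /(pasM a0 b0)[pa|pb].
  have [|q [g [qi aE qp]]] := IHn a _ a0 pa; first by lia.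
  by exists q, (g * b); rewrite aE mulrA.
have [|q [g [qi bE qp]]] := IHn b _ b0 pb; first by lia.
by exists q, (g * a); rewrite bE; split=> //; ring.
Qed.

Variables (Q : 'I_r -> R) (T : 'I_r -> set F) (X Y : 'I_r -> F).
Hypothesis Qirr : forall i, irreducible_elt (Q i).
Hypothesis plT : forall i, place iota (N i) (T i) (X i) (Y i).
Hypothesis Qpass : forall i, passes (N i) (T i) (X i) (Y i) (Q i).
Hypothesis Qmult : forall i, mult iota (N i) (T i) (X i) (Q i) 1.
Hypothesis sepT : forall i j, i != j -> sep (T i) (T j).

Let Q0 i : Q i != 0. Proof. by case: (Qirr i). Qed.
Let QN i : (0 < N i (Q i))%N.
Proof. by case: (Qirr i) => _ Qu _; exact: (nonunit_val (plT i)). Qed.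

Lemma not_both v v' S S' u w u' w' q : place iota v S u w -> place iota v' S' u' w' ->
  sep S S' \/ sep S' S -> irreducible_elt q -> passes v S u w q -> passes v' S' u' w' q -> False.
Proof.
move=> pl pl' [s|s] qi p p'; first exact: (sep_passes HR xyP x00 pl pl' qi s p p').
exact: (sep_passes HR xyP x00 pl' pl qi s p' p).
Qed.

Lemma not_divides v S u w q f : place iota v S u w ->
  (forall f g, f != 0 -> g != 0 -> v (f * g) = (v f + v g)%N) ->
  f != 0 -> passes v S u w q -> ~ passes v S u w f -> ~ divides q f.
Proof.
move=> pl vM f0 pq pf [h fE]; apply: pf; rewrite fE.
have [q_0 h0] : q != 0 /\ h != 0 by apply/andP; move: f0; rewrite fE mulf_eq0 negb_or.
exact: (passesM pl).
Qed.

(** Each curve misses the point of the other, so the intersection number of q and q' is v(q') b at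
    [S] and v'(q) b' at [S']. *)
Lemma inter_eq v v' S S' u w u' w' q q' b b' :
  (forall f g, f != 0 -> g != 0 -> v (f * g) = (v f + v g)%N) ->
  (forall f g, f != 0 -> g != 0 -> v' (f * g) = (v' f + v' g)%N) ->
  place iota v S u w -> place iota v' S' u' w' ->
  irreducible_elt q -> irreducible_elt q' ->
  passes v S u w q -> passes v' S' u' w' q' -> sep S S' \/ sep S' S ->
  mult iota v S u q b -> mult iota v' S' u' q' b' ->
  (v q' * b = v' q * b')%N.
Proof.
move=> vM vM' pl pl' qi qi' p p' s mb mb'; have [q_0 _ _] := qi; have [q_0' _ _] := qi'.
have nq : ~ passes v' S' u' w' q by move=> pq; exact: (not_both pl pl' s qi p pq).
have nq' : ~ passes v S u w q'.
  by move=> pq'; exact: (not_both pl pl' s qi' pq' p').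
have d := not_divides pl vM q_0' p nq'; have d' := not_divides pl' vM' q_0 p' nq.
have [n qn] := inter_exists HR xyP x00 qi d; have q'n := interC qn.
have [l [nE [_ l0]]] := inter_place HR xyP x00 pl qi p mb d qn.
have [l' [nE' [_ l0']]] := inter_place HR xyP x00 pl' qi' p' mb' d' q'n.
by move: nE; rewrite {1}nE' (l0 nq') (l0' nq) !addn0.
Qed.

Lemma Q_sym i j : N i (Q j) = N j (Q i).
Proof.
have [->//|ij] := eqVneq i j.
have := inter_eq (NM i) (NM j) (plT i) (plT j) (Qirr i) (Qirr j) (Qpass i) (Qpass j)
  (or_introl (sepT ij)) (Qmult i) (Qmult j).
by rewrite !muln1.
Qed.

Definition free i c : Prop := good i c /\ forall j, sep (Tc i c) (T j) \/ sep (T j) (Tc i c).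

Lemma pas_value i c q b : free i c -> irreducible_elt q -> pas i c q ->
  mult iota (N i) (Tc i c) (x i) q b -> forall j, N j q = (b * N j (Q i))%N.
Proof.
move=> [pl s] qi pq mb j.
have := inter_eq (NM i) (NM j) pl (plT j) qi (Qirr j) pq (Qpass j) (s j) mb (Qmult j).
by rewrite muln1 Q_sym mulnC.
Qed.

Lemma pas_mult i c q : good i c -> irreducible_elt q -> pas i c q ->
  exists2 b, (0 < b)%N & mult iota (N i) (Tc i c) (x i) q b.
Proof. by move=> pl qi pq; exact: (exc_mult HR xyP x00 pl qi pq). Qed.

Definition apart (p p' : 'I_r * K) : Prop :=
  forall q, irreducible_elt q -> pas p.1 p.2 q -> pas p'.1 p'.2 q -> False.

Lemma apart_same i c c' : good i c -> good i c' -> c != c' -> apart (i, c) (i, c').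
Proof.
move=> pl pl' cc' q qi p p'.
by apply: (not_both pl pl' _ qi p p'); left; exact: (sep_chT (ch i)).
Qed.

Fixpoint all_apart (s : seq ('I_r * K)) : Prop :=
  if s is p :: s' then (forall p', p' \in s' -> apart p p') /\ all_apart s' else True.

(** The irreducible factor q of f through the first point has a positive multiple of B^i as value.
    Replacing it by one power of [Q i] fewer subtracts exactly B^i, and as q misses the other
    points, the cofactor passes through them. *)
Lemma peel (s : seq ('I_r * K)) f : f != 0 -> all_apart s ->
  (forall p, p \in s -> free p.1 p.2 /\ pas p.1 p.2 f) ->
  exists2 g, g != 0 & forall j, N j f = (N j g + \sum_(p <- s) N j (Q p.1))%N.
Proof.
elim: s f => [|[i c] s IHs] f f0 /=; first by exists f => // j; rewrite big_nil addn0.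
move=> [ap aps] sf; have [fr pf] := sf (i, c) (mem_head _ _).
have [q [g [qi fE pq]]] := extract_irreducible fr.1 f0 pf.
have [q_0 g0] : q != 0 /\ g != 0 by apply/andP; move: f0; rewrite fE mulf_eq0 negb_or.
have [h h0 gh] : exists2 h, h != 0 & forall j, N j g = (N j h + \sum_(p <- s) N j (Q p.1))%N.
  apply: IHs => // p ps; have [frp pfp] := sf p (mem_behead (s := _ :: s) ps).
  split=> //; move: pfp; rewrite fE => /(pasM q_0 g0)[pq'|//].
  by case: (ap p ps q qi pq pq').
have [[|b] // _ mb] := pas_mult fr.1 qi pq.
(* The multiplicity of q is [b.+1], so [Q i ^+ b] restores all but one B^i. *)
exists (Q i ^+ b * h) => [|j]; first by rewrite mulf_neq0 // expf_neq0.
have N_exp m : N j (Q i ^+ m) = (m * N j (Q i))%N.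
  elim: m => [|m IHm]; last by rewrite exprS NM ?expf_neq0 // IHm mulSn.
  have := NM j (oner_neq0 R) (oner_neq0 R); rewrite mulr1 => e.
  by apply/eqP; rewrite -(eqn_add2l (N j 1)) mul0n addn0 -e.
rewrite fE !NM ?expf_neq0 // gh (pas_value fr qi pq mb) N_exp big_cons /= mulSn; lia.
Qed.

Lemma cofin_notpas i f : f != 0 -> cofin (fun c => ~ pas i c f).
Proof.
move=> f0; have [p fp p0] := ld_val i f0.
by apply: cofinW (cofin_root p0) => c pc /(pas_ld c fp)/eqP; rewrite (negPf pc).
Qed.

Lemma cofin_good i : cofin (good i).
Proof.
have mx0 : mR x0 by apply/xyP; exists 1, 0; ring.
have [p [a [Aa ap fE]] p0] := ld_val i x00.
by apply: cofinW (cofin_root p0) => c pc; exact: (chT_place (ch i) (chv i) mx0 fE Aa ap pc).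
Qed.

Definition points_apart (bad : 'I_r -> seq K) : Prop :=
  (forall i c, c \notin bad i -> free i c) /\
  (forall i j c c', i != j -> c \notin bad i -> c' \notin bad j -> apart (i, c) (j, c')).

(* A curve through general points of two different components would make the
   two valuations proportional on functions not vanishing there. *)
Lemma points_apart_ex :
  (forall i j, cofin (fun c => sep (Tc i c) (T j) \/ sep (T j) (Tc i c))) ->
  (forall i j, i != j -> exists f g, [/\ f != 0, g != 0 & (N i f * N j g != N i g * N j f)%N]) ->
  exists bad, points_apart bad.
Proof.
move=> sepTc dist.
have fex (ij : 'I_r * 'I_r) : exists f : R * R, [/\ f.1 != 0, f.2 != 0 &
    ij.1 != ij.2 -> (N ij.1 f.1 * N ij.2 f.2 != N ij.1 f.2 * N ij.2 f.1)%N].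
  have [eq|ne] := eqVneq ij.1 ij.2; first by exists (1, 1); rewrite oner_eq0.
  by have [f [g [f0 g0 fg]]] := dist _ _ ne; exists (f, g).
have [f fP] := choice fex.
have badex i : cofin (fun c => free i c /\
    forall ij, ~ pas i c (f ij).1 /\ ~ pas i c (f ij).2).
  apply: cofinI; first by apply: cofinI (cofin_good i) _; exact: cofin_all.
  apply: cofin_all => ij; have [f0 g0 _] := fP ij.
  by apply: cofinI; exact: cofin_notpas.
have [bad badP] := choice badex; exists bad; split.
  by move=> i c /badP[].
move=> i j c c' ij /badP[[gi _] fi] /badP[[gj _] fj] q qi /= pq pq'.
have [b b0 mb] := pas_mult gi qi pq; have [b' b'0 mb'] := pas_mult gj qi pq'.
have [f0 g0 /(_ ij) /=] := fP (i, j).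
have eqn h : h != 0 -> ~ pas i c h -> ~ pas j c' h -> (N i h * b = N j h * b')%N.
  move=> h0 ni nj; have d := not_divides gi (NM i) h0 pq ni.
  have [n qn] := inter_exists HR xyP x00 qi d.
  have [l [nE [_ l0]]] := inter_place HR xyP x00 gi qi pq mb d qn.
  have [l' [nE' [_ l0']]] := inter_place HR xyP x00 gj qi pq' mb' d qn.
  by move: nE; rewrite {1}nE' (l0 ni) (l0' nj) !addn0.
have e1 := eqn _ f0 (fi (i, j)).1 (fj (i, j)).1.
have e2 := eqn _ g0 (fi (i, j)).2 (fj (i, j)).2.
move=> /eqP; apply; apply/eqP; rewrite -(eqn_pmul2r (_ : 0 < b * b')%N) ?muln_gt0 ?b0 //.
by rewrite !(mulnACA _ _ b) e1 -e2 mulnC.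
Qed.

Variable bad : 'I_r -> seq K.
Hypothesis badP : points_apart bad.

Let bad_free i c : c \notin bad i -> free i c. Proof. exact: badP.1. Qed.
Let bad_good i c : c \notin bad i -> good i c. Proof. by case/bad_free. Qed.

Definition through i c q : Prop :=
  [/\ irreducible_elt q, pas i c q & forall j, N j q = N j (Q i)].

(** With t = u / w, the curve u - c w = 0 is t = c near a point where the strict transform of w does
    not pass. The equation of its irreducible factor through the point divides t - c, so this factor
    has multiplicity 1. *)
Lemma curve_through i : cofin (fun c => exists q, through i c q).
Proof.
have [u [w [w0 tw]]] := fracP (t i).
have [V [a [Aa aV wE]] V0] := ld_val i w0; set n := N i w in wE.
apply: cofinW (cofinI (cofin_notin (bad i)) (cofin_root V0)) => c [cb Vc].
have At := ch_t (ch i); have Ay := salg_A_t c (ch i); have sA := ch_alg (ch i).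
have fE : (u - iota c * w)%:F = x i ^+ n * (yc i c * a).
  by rewrite tofracB tofracM -tw wE kapE; ring.
have fld : ld i n (u - iota c * w) (('X - c%:P) * V).
  exists (yc i c * a); split=> //; first exact: (salgM sA).
  by apply: (leadM (ch i)) => //; exact: (lead_y (ch i)).
have lead0 : ('X - c%:P) * V != 0 by rewrite mulf_neq0 // polyXsubC_eq0.
have [f0 fN] := ld_neq0 fld lead0.
have pf : pas i c (u - iota c * w).
  by apply/pas_ld; [rewrite fN; exact: fld|rewrite hornerM hornerXsubC subrr mul0r].
have pl := bad_good cb; have [q [g [qi fqg pq]]] := extract_irreducible pl f0 pf.
exists q; split=> //.
have [b _ mb] := pas_mult pl qi pq.
suff b1 : b = 1%N by move=> j; rewrite (pas_value (bad_free cb) qi pq mb) b1 mul1n.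
apply: (mult1 pl pq mb) => _ [z [z' [Tz Tz' ->]]]; exists z => //.
rewrite [X in curve_eq _ _ _ _ X](_ : _ = yc i c * z'); last by ring.
have [q0 g0] : q != 0 /\ g != 0 by apply/andP; move: f0; rewrite fqg mulf_eq0 negb_or.
have [[sT _ _ _ _ _] _ x_0 _ _ _ _ _] := pl.
have a0 : a != 0.
  by apply: contraNneq w0 => a0; rewrite -tofrac_eq0 wE a0 mulr0.
exists (g%:F / x i ^+ N i g * a^-1 * z').
  apply: (salgM sT) => //; apply: (salgM sT); first exact: (strict_in pl).
  exact: (chT_unit_lead (ch i) Aa aV Vc).
have E : q%:F / x i ^+ N i q * (g%:F / x i ^+ N i g) = yc i c * a.
  rewrite mulf_div -tofracM -exprD -NM // -fqg fN fE.
  by rewrite [x i ^+ n * _]mulrC mulfK // expf_neq0.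
transitivity (yc i c * a * (a^-1 * z')); first by rewrite -!mulrA mulVKf.
by rewrite -E -!mulrA.
Qed.

(** Linear in f for fixed n, unlike [pas], which divides f by its exact power of x. *)
Definition vanish i n c f : Prop := exists2 p, ld i n f p & p.[c] = 0.

Lemma vanish_pas i c f : f != 0 -> vanish i (N i f) c f <-> pas i c f.
Proof.
move=> f0; split=> [[p fp pc]|pf]; first exact/(pas_ld c fp).
by have [p fp _] := ld_val i f0; exists p => //; exact/(pas_ld c fp).
Qed.

Lemma vanish_subsp i n c : subsp iota (vanish i n c).
Proof.
split; first by exists 0; [exact: ld0|rewrite horner0].
  move=> f g [p fp pc] [q gq qc]; exists (p + q); first exact: ldD.
  by rewrite hornerD pc qc addr0.
by move=> a f [p fp pc]; exists (a *: p); [exact: ldZ|rewrite hornerZ pc mulr0].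
Qed.

Definition atleast (m : 'I_r -> nat) : set R := [set f | forall j, exists p, ld j (m j) f p].

Lemma atleast_subsp m : subsp iota (atleast m).
Proof.
split; first by move=> j; exists 0; exact: ld0.
  by move=> f g fm gm j; have [p fp] := fm j; have [q gq] := gm j; exists (p + q); exact: ldD.
by move=> a f fm j; have [p fp] := fm j; exists (a *: p); exact: ldZ.
Qed.

Definition exactly (m : 'I_r -> nat) (f : R) : Prop := f != 0 /\ forall j, N j f = m j.

Lemma exactly_atleast m f : exactly m f -> atleast m f.
Proof. by move=> [f0 fm] j; apply: ld_ex; right; rewrite fm. Qed.

(** Along each component only one a can raise the order of the member of the pencil. *)
Lemma generic_exactly (i : 'I_r) m f g : atleast m f -> exactly m g ->
  cofin (fun a => exactly m (f - iota a * g)).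
Proof.
move=> fm [g0 gm].
have H j : cofin (fun a => f - iota a * g != 0 /\ N j (f - iota a * g) = m j).
  have [p' fp'] := fm j; have [p gp p0] := ld_val j g0; rewrite gm in gp.
  have [a0 a0P] := pencil_neq p' p0.
  apply: cofinW (cofin_neq a0) => a /a0P; exact: (ld_neq0 (ldB a fp' gp)).
apply: cofinW (cofin_all H) => a aP; split=> [|j]; last by case: (aP j).
by case: (aP i).
Qed.

Lemma generic_vanish i n f g p p' (s : seq K) : ld i n f p' -> ld i n g p -> p != 0 ->
  (forall a, p' <> a *: p) ->
  cofin (fun a => exists c, [/\ c \notin s, vanish i n c (f - iota a * g) & p.[c] != 0]).
Proof.
move=> fp' gp p0 np; have [s' s'P] := pencil_root s p0 np.
exists s' => a /s'P[c [cs hc pc]]; exists c; split=> //.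
by exists (p' - a *: p) => //; exact: ldB.
Qed.

Lemma through_apart i c c' q : c \notin bad i -> c' \notin bad i -> c != c' ->
  through i c q -> ~ pas i c' q.
Proof.
move=> cb cb' cc' [qi pq _] pq'.
exact: (apart_same (bad_good cb) (bad_good cb') cc' qi pq pq').
Qed.

Lemma peel2 i j c c' f : i != j -> c \notin bad i -> c' \notin bad j -> f != 0 ->
  pas i c f -> pas j c' f ->
  exists2 g, g != 0 & forall l, N l f = (N l g + N l (Q i) + N l (Q j))%N.
Proof.
move=> ij cb cb' f0 pf pf'.
have [||g g0 gE] := @peel [:: (i, c); (j, c')] f f0.
- split; last by split.
  by move=> p'; rewrite inE => /eqP ->; exact: badP.2.
- move=> p'; rewrite !inE => /orP[]/eqP -> /=; split=> //; exact: bad_free.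
by exists g => // l; rewrite gE !big_cons big_nil /=; lia.
Qed.

(* Two general curves through E_i cut out constant functions on the other
   components: otherwise some member of their pencil would pass through general
   points of both E_i and E_j, and - B^j would be a value. *)
Lemma through_const i j c c' q q' p p' : i != j -> c \notin bad i -> c' \notin bad i ->
  c != c' -> through i c q -> through i c' q' ->
  ld j (N j (Q i)) q p -> ld j (N j (Q i)) q' p' -> exists a, p' = a *: p.
Proof.
move=> ij cb cb' cc' tq tq' qp qp'; apply: contrapT => np.
have [qi pq Nq] := tq; have [qi' pq' Nq'] := tq'.
have [q0 _ _] := qi; have [q'0 _ _] := qi'.
have p0 : p != 0.
  by have [[_ //]|[]] := ld_cases q0 qp; rewrite Nq ltnn.
have [P qP P0] := ld_val i q0; have [P' qP' P'0] := ld_val i q'0.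
have Pc : P.[c] = 0 by exact/(pas_ld c qP).
have P'c : P'.[c] <> 0.
  by move/(pas_ld c qP'); apply: (through_apart cb' cb _ tq'); rewrite eq_sym.
rewrite Nq in qP; rewrite Nq' in qP'.
have nP a : P' <> a *: P by move=> e; apply: P'c; rewrite e hornerZ Pc mulr0.
have {}np a : p' <> a *: p by move=> e; apply: np; exists a.
have qe : exactly (fun l => N l (Q i)) q by [].
have qe' : atleast (fun l => N l (Q i)) q' by exact: exactly_atleast.
have [a [[[f0 fN] [d [db di _]]] [d' [db' dj _]]]] := cofin_ex (cofinI
  (cofinI (generic_exactly i qe' qe) (generic_vanish (bad i) qP' qP P0 nP))
  (generic_vanish (bad j) qp' qp p0 np)).
rewrite -fN in di; rewrite -fN in dj.
have [g _ gE] := peel2 ij db db' f0 ((vanish_pas i d f0).1 di) ((vanish_pas j d' f0).1 dj).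
have /eqP := gE j; rewrite fN addnAC -[X in X == _]add0n eqn_add2r eq_sym addn_eq0.
by rewrite andbC; case: (N j (Q j)) (QN j).
Qed.

Lemma exactlyM m n f g : exactly m f -> exactly n g ->
  exactly (fun j => m j + n j)%N (f * g).
Proof. by move=> [f0 fm] [g0 gn]; split=> [|j]; rewrite ?mulf_neq0 ?NM ?fm ?gn. Qed.

(* By through_const, the products h q with q a general curve through E_i are
   proportional along E_j, but two products of h' with curves through E_j vanish
   at different points there, so one of them, f, is not proportional to h q.
   Subtracting from f a suitable h qb and any a h qa with qa through c gives
   elements whose curves pass through the general point c of E_i; for general a
   they also pass through a general point of E_j. *)
Lemma subtract_both i j m h h' : i != j ->
  h != 0 -> (forall l, m l = N l h + N l (Q i))%N ->
  h' != 0 -> (forall l, m l = N l h' + N l (Q j))%N ->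
  exists2 g, g != 0 & forall l, m l = (N l g + N l (Q i) + N l (Q j))%N.
Proof.
move=> ij h0 hm h'0 h'm.
have [H hH H0] := ld_val i h0; have [Hj hHj Hj0] := ld_val j h0.
have [Hj' hHj' Hj'0] := ld_val j h'0.
have [c [[cb [qa ta]] Hc]] := cofin_ex
  (cofinI (cofinI (cofin_notin (bad i)) (curve_through i)) (cofin_root H0)).
have [c1 [[c1b [qb tb]] c1c]] := cofin_ex
  (cofinI (cofinI (cofin_notin (bad i)) (curve_through i)) (cofin_neq c)).
have [c2 [c2b [q2 t2]]] := cofin_ex (cofinI (cofin_notin (bad j)) (curve_through j)).
have [c3 [[c3b [q3 t3]] c32]] := cofin_ex
  (cofinI (cofinI (cofin_notin (bad j)) (curve_through j)) (cofin_neq c2)).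
have thr l d q : through l d q -> q != 0 /\ exactly (fun l' => N l' (Q l)) q.
  by move=> [[q0 _ _] _ Nq].
have [qa0 ea] := thr _ _ _ ta; have [qb0 eb] := thr _ _ _ tb.
have [q20 e2] := thr _ _ _ t2; have [q30 e3] := thr _ _ _ t3.
have exm f q : exactly (fun l => N l f + N l (Q i))%N q -> (forall l, m l = N l f + N l (Q i))%N ->
    exactly m q.
  by move=> [q0 Nq] mE; split=> // l; rewrite Nq mE.
have exm' f q : exactly (fun l => N l f + N l (Q j))%N q -> (forall l, m l = N l f + N l (Q j))%N ->
    exactly m q.
  by move=> [q0 Nq] mE; split=> // l; rewrite Nq mE.
have eh : exactly (fun l => N l h) h by []. have eh' : exactly (fun l => N l h') h' by [].
have ga : exactly m (h * qa) := exm h _ (exactlyM eh ea) hm.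
have gb : exactly m (h * qb) := exm h _ (exactlyM eh eb) hm.
have f2 : exactly m (h' * q2) := exm' h' _ (exactlyM eh' e2) h'm.
have f3 : exactly m (h' * q3) := exm' h' _ (exactlyM eh' e3) h'm.
have ldq l d q l' : through l d q -> exists2 p, ld l' (N l' (Q l)) q p & p != 0.
  by move=> /thr[q0 [_ Nq]]; have [p qp p0] := ld_val l' q0; exists p; rewrite -?Nq.
have [Pa qaP Pa0] := ldq _ _ _ j ta; have [Pb qbP Pb0] := ldq _ _ _ j tb.
have [P2 q2P P20] := ldq _ _ _ j t2; have [P3 q3P P30] := ldq _ _ _ j t3.
have [Ra qaR Ra0] := ldq _ _ _ i ta; have [Rb qbR Rb0] := ldq _ _ _ i tb.
have gaL : ld j (m j) (h * qa) (Hj * Pa) by rewrite hm; exact: ldM.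
have gbL : ld j (m j) (h * qb) (Hj * Pb) by rewrite hm; exact: ldM.
have f2L : ld j (m j) (h' * q2) (Hj' * P2) by rewrite h'm; exact: ldM.
have f3L : ld j (m j) (h' * q3) (Hj' * P3) by rewrite h'm; exact: ldM.
have p0 : Hj * Pa != 0 by rewrite mulf_neq0.
have [k PbE] : exists k, Pb = k *: Pa.
  by apply: (through_const ij cb c1b _ ta tb qaP qbP); rewrite eq_sym.
have P2c : P2.[c2] = 0.
  by case: (t2) => _ p2 N2; rewrite -N2 in q2P; exact/(pas_ld c2 q2P).
have P3c : P3.[c2] <> 0.
  case: (t3) => _ _ N3; rewrite -N3 in q3P.
  by move/(pas_ld c2 q3P); apply: (through_apart c3b c2b _ t3).
have [f [p' [ef fL np]]] : exists f p', [/\ exactly m f, ld j (m j) f p'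
    & forall a, p' <> a *: (Hj * Pa)].
  have [[a2 E2]|n2] := pselect (exists a, Hj' * P2 = a *: (Hj * Pa)); last first.
    by exists (h' * q2), (Hj' * P2); split=> // a e; apply: n2; exists a.
  exists (h' * q3), (Hj' * P3); split=> // a3 E3; apply: P3c.
  have a20 : a2 != 0.
    apply/eqP => a20; move: E2; rewrite a20 scale0r => /eqP.
    by rewrite mulf_eq0 (negPf Hj'0) (negPf P20).
  have E : P3 = (a3 / a2) *: P2.
    apply: (mulfI Hj'0); rewrite -scalerAr E2 E3 scalerA divfK //.
  by rewrite E hornerZ P2c mulr0.
have [fi fiL] : exists fi, ld i (m i) f fi by apply: exactly_atleast.
have gbLi : ld i (m i) (h * qb) (H * Rb) by rewrite hm; exact: ldM.
have gaLi : ld i (m i) (h * qa) (H * Ra) by rewrite hm; exact: ldM.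
have Rac : Ra.[c] = 0.
  by case: (ta) => _ pa Na; rewrite -Na in qaR; exact/(pas_ld c qaR).
have Rbc : Rb.[c] != 0.
  case: (tb) => _ _ Nb; rewrite -Nb in qbR; apply/eqP => /(pas_ld c qbR).
  exact: (through_apart c1b cb _ tb).
pose b := fi.[c] / (H * Rb).[c].
have HRb : (H * Rb).[c] != 0 by rewrite hornerM mulf_neq0.
have f1v : vanish i (m i) c (f - iota b * (h * qb)).
  by exists (fi - b *: (H * Rb)); [exact: ldB|rewrite hornerD hornerN hornerZ divfK // subrr].
have gav : vanish i (m i) c (h * qa).
  by exists (H * Ra) => //; rewrite hornerM Rac mulr0.
have f1L : ld j (m j) (f - iota b * (h * qb)) (p' - b *: (Hj * Pb)) := ldB b fL gbL.
have np1 a : p' - b *: (Hj * Pb) <> a *: (Hj * Pa).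
  move=> E; apply: (np (a + b * k)); rewrite scalerDl -E PbE -scalerAr scalerA.
  by rewrite subrK.
have f1m : atleast m (f - iota b * (h * qb)).
  have sm := atleast_subsp m; apply: (subspB sm); first exact: exactly_atleast.
  by case: sm => _ _; apply; exact: exactly_atleast.
have [a [[F0 FN] [d [db dj _]]]] := cofin_ex (cofinI (generic_exactly i f1m ga)
  (generic_vanish (bad j) f1L gaL p0 np1)).
have Fv : vanish i (m i) c (f - iota b * (h * qb) - iota a * (h * qa)).
  have sv := vanish_subsp i (m i) c; apply: (subspB sv) => //.
  by case: sv => _ _; exact.
rewrite -FN in Fv; rewrite -FN in dj.
have [g g0 gE] := peel2 ij cb db F0 ((vanish_pas i c F0).1 Fv) ((vanish_pas j d F0).1 dj).
by exists g => // l; rewrite -FN gE.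
Qed.

(** This is J(m + e_i), see [deeperE]. *)
Definition deeper i m : set R := [set f | atleast m f /\ ld i (m i) f 0].

Lemma deeper_subsp i m : subsp iota (deeper i m).
Proof.
have [s0 sD sZ] := atleast_subsp m; split; first by split=> //; exact: ld0.
  move=> f g [fm fL] [gm gL]; split; first exact: sD.
  by rewrite -[0]addr0; exact: ldD.
move=> a f [fm fL]; split; first exact: sZ.
by rewrite -(scaler0 _ a); exact: ldZ.
Qed.

Lemma ld_comb i n k (b : 'I_k -> R) (p : 'I_k -> {poly K}) c :
  (forall l, ld i n (b l) (p l)) -> ld i n (comb iota b c) (\sum_l c 0 l *: p l).
Proof.
move=> bp; apply: (big_ind2 (fun f q => ld i n f q)) => [|f q g q' fq gq'|l _].
- exact: ld0.
- exact: ldD.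
- exact: ldZ.
Qed.

Lemma through_prod (I : finType) (P : pred I) (c : I -> K) (q : I -> R) i :
  (forall l, through i (c l) (q l)) ->
  exactly (fun j => #|P| * N j (Q i))%N (\prod_(l | P l) q l) /\
  forall d, d \notin bad i -> pas i d (\prod_(l | P l) q l) -> exists2 l, P l & pas i d (q l).
Proof.
move=> tq; have q0 l : q l != 0 by case: (tq l) => -[].
rewrite -sum1_card; split.
  apply: (big_ind2 (fun f n => exactly (fun j => n * N j (Q i))%N f)).
  - split=> [|j]; first exact: oner_neq0.
    have := NM j (oner_neq0 R) (oner_neq0 R); rewrite mulr1 => e.
    by apply/eqP; rewrite -(eqn_add2l (N j 1)) mul0n addn0 -e.
  - move=> f n g m [f0 fn] [g0 gm]; split=> [|j]; first by rewrite mulf_neq0.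
    by rewrite NM // fn gm mulnDl.
  - by move=> l _; split=> // j; rewrite mul1n; case: (tq l).
move=> d db; have [] : \prod_(l | P l) q l != 0 /\ (pas i d (\prod_(l | P l) q l) ->
    exists2 l, P l & pas i d (q l)); last by [].
apply: (big_rec (fun f => f != 0 /\ (pas i d f -> exists2 l, P l & pas i d (q l)))).
  split=> [|p1]; first exact: oner_neq0.
  by have := passes_nonunit (bad_good db) (NM i) p1 (oner_neq0 R); rewrite unitr1.
move=> l f Pl [f0 fp]; split=> [|/(pasM (q0 l) f0)[pl|//]]; first by rewrite mulf_neq0.
by exists l.
Qed.

(** The restrictions to E_i behave like a Lagrange basis: b_l omits the curve through c_l, so it
    vanishes at the other chosen points but not at c_l. *)
Lemma independent_values i m k h : h != 0 ->
  (forall l, m l = N l h + k * N l (Q i))%N ->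
  exists b : 'I_k.+1 -> R, (forall l, exactly m (b l)) /\ lind iota (deeper i m) b.
Proof.
move=> h0 hm; have [H hH H0] := ld_val i h0.
have [s sP] := cofinI (cofinI (cofin_notin (bad i)) (curve_through i)) (cofin_root H0).
have [u [su uu us]] := distinct_ex k.+1 s.
pose c (l : 'I_k.+1) := nth 0 u l.
have cP l : ((c l \notin bad i) /\ exists q, through i (c l) q) /\ H.[c l] != 0.
  by apply/sP/us; rewrite mem_nth // su.
have c_inj l l' : l != l' -> c l != c l'.
  by rewrite /c nth_uniq ?su.
have [q qP] := choice (fun l => (cP l).1.2).
have [b bE] : exists b, forall l, b l = h * \prod_(l' | l' != l) q l' by exists (fun l =>
  h * \prod_(l' | l' != l) q l').
have bex l : exactly m (b l).
  have [[p0 pN] _] := through_prod (fun l' => l' != l) qP.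
  split=> [|j]; first by rewrite bE mulf_neq0.
  have cl : #|(fun l' : 'I_k.+1 => l' != l)| = k.
    by have := cardC1 l; rewrite card_ord.
  by rewrite bE NM // pN hm cl.
have q0 l : q l != 0 by case: (qP l) => -[].
have ldb l : exists p, ld i (m i) (b l) p /\ p.[c l] != 0 /\ forall l', l' != l -> p.[c l'] = 0.
  have [bl0 bN] := bex l; have [p bp _] := ld_val i bl0; exists p.
  rewrite -bN; split=> //; split.
    apply/eqP => /(pas_ld _ bp); rewrite bE.
    have [[p0 _] pex] := through_prod (fun l' => l' != l) qP.
    move=> /(pasM h0 p0)[/(pas_ld _ hH) Hc|/(pex _ (cP l).1.1)[l' l'l]].
      by have [_] := cP l; rewrite Hc eqxx.
    exact: (through_apart (cP l').1.1 (cP l).1.1 (c_inj _ _ l'l) (qP l')).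
  move=> l' l'l; apply/(pas_ld _ bp); rewrite bE (bigD1 l') //= mulrCA.
  have [_ pq _] := qP l'; apply: (passesM (bad_good (cP l').1.1) (NM i)) => //.
  by apply: mulf_neq0 => //; apply/prodf_neq0 => l'' _; exact: q0.
have [p pP] := choice ldb; exists b; split=> // d [_ dL].
have := ld_uniq (ld_comb d (fun l => (pP l).1)) dL => e.
apply/rowP => l; rewrite mxE; have := congr1 (fun p => p.[c l]) e.
rewrite horner_sum horner0 (bigD1 l) //= hornerZ big1 ?addr0 => [/eqP|l' l'l].
  by rewrite mulf_eq0 (negPf (pP l).2.1) orbF => /eqP.
by rewrite hornerZ (pP l').2.2 ?mulr0 // eq_sym.
Qed.

Definition addline (W : set R) (g : R) : set R := [set f | exists a, W (f - iota a * g)].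

(* Subtracting multiples of g0 makes all entries of b vanish at the point where
   one member b_0 - a g0 of a pencil vanishes; that member then replaces g0. *)
Lemma many_points i m k (b : 'I_k -> R) g0 (s : seq K) : exactly m g0 ->
  (forall l, atleast m (b l)) -> lind iota (addline (deeper i m) g0) b ->
  exists g (cs : seq K), [/\ exactly m g, size cs = k, uniq cs,
    forall c, c \in cs -> [/\ c \notin bad i, c \notin s & vanish i (m i) c g]
    & forall V, subsp iota V -> V g0 -> (forall l, V (b l)) -> V g].
Proof.
elim: k b g0 s => [|k IHk] b g0 s eg0 bm bfree.
  by exists g0, [::]; split.
have [W0 WD WZ] := deeper_subsp i m; have sm := atleast_subsp m.
have [p g0p p0] := ld_val i eg0.1; rewrite eg0.2 in g0p.
have [p' fp'] := bm ord0 i.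
have bcomb (c : 'rV[K]_k.+1) : comb iota b c = iota (c 0 ord0) * b ord0 +
    \sum_(l < k) iota (c 0 (lift ord0 l)) * b (lift ord0 l).
  by rewrite /comb big_ord_recl.
have g0m := exactly_atleast eg0.
have np a : p' <> a *: p.
  move=> e; have /rowP/(_ ord0) : (\row_j (j == ord0)%:R : 'rV[K]_k.+1) = 0.
    apply: bfree; exists a; rewrite bcomb mxE eqxx rmorph1 mul1r big1 => [|l _]; last first.
      by rewrite mxE rmorph0 mul0r.
    rewrite addr0; split; last by have := ldB a fp' g0p; rewrite e subrr.
    by apply: (subspB sm) => //; case: sm => _ _; apply.
  by rewrite !mxE eqxx => /eqP; rewrite oner_eq0.
have [a [eg1 [c [cbs cv pc]]]] := cofin_ex (cofinI (generic_exactly i (bm ord0) eg0)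
  (generic_vanish (bad i ++ s) fp' g0p p0 np)).
move: cbs; rewrite mem_cat negb_or => /andP[cb cs].
set g1 := b ord0 - iota a * g0 in eg1 cv.
have [P bP] := choice (fun l => bm l i).
pose kk l := (P l).[c] / p.[c].
pose b' (l : 'I_k) := b (lift ord0 l) - iota (kk (lift ord0 l)) * g0.
have [||g [cs' [eg sz un csP gV]]] := IHk b' g1 (c :: s) eg1.
- by move=> l; apply: (subspB sm) => //; case: sm => _ _; apply.
- move=> d [e We].
  pose d' : 'rV[K]_k.+1 := \row_j if unlift ord0 j is Some l then d 0 l else - e.
  have d'0 : d' = 0.
    apply: bfree; exists (\sum_l d 0 l * kk (lift ord0 l) - e * a).
    rewrite (_ : _ - _ = comb iota b' d - iota e * g1) //;
      rewrite bcomb mxE unlift_none rmorphN.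
    rewrite [\sum_(l < k) iota (d' _ _) * _](_ :
      _ = \sum_(l < k) iota (d 0 l) * b (lift ord0 l)); last first.
      by apply: eq_bigr => l _; rewrite mxE liftK.
    have -> : comb iota b' d = \sum_l (iota (d 0 l) * b (lift ord0 l) -
        iota (d 0 l * kk (lift ord0 l)) * g0).
      by rewrite /comb; apply: eq_bigr => l _; rewrite /b' mulrBr mulrA -rmorphM.
    rewrite sumrB -mulr_suml -rmorph_sum /g1 rmorphB rmorphM; ring.
  by apply/rowP => l; have /rowP/(_ (lift ord0 l)) := d'0; rewrite !mxE liftK.
exists g, (c :: cs'); split.
- by [].
- by rewrite /= sz.
- rewrite /= un andbT; apply/negP => /csP[_]; by rewrite inE eqxx.
- move=> d; rewrite inE => /orP[/eqP ->|/csP[db]]; last by rewrite inE negb_or => /andP[].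
  split=> //; apply: (gV _ (vanish_subsp i (m i) c)) => // l.
  exists (P (lift ord0 l) - kk (lift ord0 l) *: p); first exact: ldB.
  by rewrite hornerD hornerN hornerZ divfK // subrr.
- move=> V sV Vg0 Vb; have [_ _ VZ] := sV; apply: gV => // [|l]; apply: (subspB sV) => //;
  exact: VZ.
Qed.

Lemma all_apart_same i (cs : seq K) : uniq cs -> (forall c, c \in cs -> c \notin bad i) ->
  all_apart [seq (i, c) | c <- cs].
Proof.
elim: cs => //= c cs IHcs /andP[ccs ucs] cb; split; last first.
  by apply: IHcs => // d dcs; apply: cb; rewrite inE dcs orbT.
move=> _ /mapP[d dcs ->]; apply: apart_same.
- by apply: bad_good; apply: cb; rewrite mem_head.
- by apply: bad_good; apply: cb; rewrite inE dcs orbT.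
- by apply: contraNneq ccs => ->.
Qed.

(** The pencils start from an element of value exactly m. At most one of the k + 1 classes is lost
    modulo it; the other k give k points, to which [peel] applies. *)
Lemma independent_upper i m k (b : 'I_k.+1 -> R) g0 : exactly m g0 ->
  (forall l, atleast m (b l)) -> lind iota (deeper i m) b ->
  exists2 h, h != 0 & forall l, m l = (N l h + k * N l (Q i))%N.
Proof.
move=> eg0 bm bfree; have sW := deeper_subsp i m; have [W0 WD WZ] := sW.
pose ext (l0 : 'I_k.+1) (d : 'rV[K]_k) : 'rV[K]_k.+1 :=
  \row_j if unlift l0 j is Some l then d 0 l else 0.
have extE l0 d : comb iota b (ext l0 d) = comb iota (b \o lift l0) d.
  rewrite /comb (bigD1_ord l0) //= mxE unlift_none rmorph0 mul0r add0r.
  by apply: eq_bigr => l _; rewrite mxE liftK.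
have ext0 l0 d : ext l0 d = 0 -> d = 0.
  by move=> /rowP e; apply/rowP => l; have := e (lift l0 l); rewrite !mxE liftK.
(* A relation modulo g0 involves g0 itself, as b is independent. Dropping a b_l0 that occurs in it
   leaves no further relation. *)
have [l0 l0P] : exists l0, lind iota (addline (deeper i m) g0) (b \o lift l0).
  have [bf|] := pselect (lind iota (addline (deeper i m) g0) b).
    by exists ord0 => d; rewrite -extE => /bf/ext0.
  move=> nbf; have [c [[a Wc] c0]] : exists c, addline (deeper i m) g0 (comb iota b c) /\ c <> 0.
    apply: contrapT => nex; apply: nbf => c Wc; apply: contrapT => c0.
    by apply: nex; exists c.
  have [l0 cl0] : exists l0, c 0 l0 != 0.
    by have /eqP/rV0Pn := c0.
  have a0 : a != 0.
    apply/eqP => a0; move: Wc; rewrite a0 rmorph0 mul0r subr0 => /bfree; exact: c0.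
  exists l0 => d [e We].
  have e0 : ext l0 d - (e / a) *: c = 0.
    apply: bfree; rewrite combD combN combZ extE.
    have -> : comb iota (b \o lift l0) d - iota (e / a) * comb iota b c =
       (comb iota (b \o lift l0) d - iota e * g0) -
       iota (e / a) * (comb iota b c - iota a * g0).
      rewrite mulrBr mulrA -rmorphM divfK //; ring.
    by apply: (subspB sW) => //; exact: WZ.
  have ea0 : e / a = 0.
    have /rowP/(_ l0) := e0; rewrite !mxE unlift_none sub0r => /eqP.
    by rewrite oppr_eq0 mulf_eq0 (negPf cl0) orbF => /eqP.
  by apply: (ext0 l0); move: e0; rewrite ea0 scale0r subr0.
have [g [cs [[gn0 gm] sz un csP _]]] := many_points [::] eg0 (fun l => bm (lift l0 l)) l0P.
have [||h h0 hE] := @peel [seq (i, c) | c <- cs] g gn0.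
- by apply: all_apart_same => // c /csP[].
- move=> _ /mapP[c /csP[cb _ cv] ->] /=; split; first exact: bad_free.
  by apply/(vanish_pas i c gn0); rewrite gm.
exists h => // l; rewrite -gm hE big_map /= big_const_seq count_predT sz.
by rewrite iter_addn_0 mulnC.
Qed.

End ValueSemigroup.

(** * Decomposition *)

(** Independence comes from the uniqueness of the coordinates of 0. *)
Lemma quotient_dimE (K : fieldType) (R : idomainType) (iota : {rmorphism K -> R})
    (U W : set R) d : subsp iota U -> subsp iota W -> W `<=` U ->
  quotient_dim iota U W d <-> qdim iota U W d.
Proof.
move=> sU sW WU; have [U0 _ _] := sU; have [W0 _ _] := sW; split.
  move=> [b [Ub bu]]; exists b; split=> // [c Wc|g /bu[c [Wc _]]]; last by exists c.
  have [c0 [_ c0u]] := bu 0 U0.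
  have e0 : c0 = 0 by apply: c0u; rewrite -/(comb iota b 0) comb0 subr0.
  have e1 : c0 = - c by apply: c0u; rewrite -/(comb iota b (- c)) combN sub0r opprK.
  by apply/eqP; rewrite -oppr_eq0 -e1 e0.
move=> [b [Ub bfree bspan]]; exists b; split=> // g /bspan[c Wc]; exists c; split=> // c' Wc'.
apply/eqP; rewrite -subr_eq0; apply/eqP/bfree; rewrite combD combN.
have -> : comb iota b c - comb iota b c' = (g - comb iota b c') - (g - comb iota b c) by ring.
exact: (subspB sW Wc' Wc).
Qed.

Section Decomposition.
Variables (K : fieldType) (R : idomainType) (iota : {rmorphism K -> R}).
Variables (r : nat) (N : 'I_r -> R -> nat) (Q : 'I_r -> R).
Hypothesis NM : forall i f g, f != 0 -> g != 0 -> N i (f * g) = (N i f + N i g)%N.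
Hypothesis Q0 : forall i, Q i != 0.
Hypothesis QN : forall i, (0 < N i (Q i))%N.

Definition values_ge (m : 'I_r -> nat) : set R :=
  [set f | f = 0 \/ forall j, (m j <= N j f)%N].

Definition bump_value (i : 'I_r) (m : 'I_r -> nat) j : nat := (m j + (j == i))%N.

(** For m the value of h, this is the membership of m - k B^i in S_V, stated without subtraction
    ([summand_semigroup]). *)
Definition summand i k h : Prop :=
  exists2 g, g != 0 & forall l, (N l h = N l g + k * N l (Q i))%N.

Hypothesis ge_subsp : forall m, subsp iota (values_ge m).
Hypothesis lower : forall i m k h, h != 0 ->
  (forall l, m l = N l h + k * N l (Q i))%N ->
  exists b : 'I_k.+1 -> R, (forall l, values_ge m (b l)) /\
    lind iota (values_ge (bump_value i m)) b.
Hypothesis upper : forall i k h (b : 'I_k.+1 -> R), h != 0 ->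
  (forall l, values_ge (N^~ h) (b l)) -> lind iota (values_ge (bump_value i (N^~ h))) b ->
  summand i k h.
Hypothesis both : forall i j h, i != j -> h != 0 -> summand i 1 h -> summand j 1 h ->
  exists2 g, g != 0 & forall l, N l h = (N l g + N l (Q i) + N l (Q j))%N.

Lemma summand_decr i k h : summand i k.+1 h -> summand i k h.
Proof.
move=> [g g0 gN]; exists (g * Q i) => [|l]; first by rewrite mulf_neq0.
by rewrite gN NM // mulSn addnA.
Qed.

Lemma summand_le i k k' h : (k <= k')%N -> summand i k' h -> summand i k h.
Proof.
move=> kk'; rewrite -(subnKC kk'); elim: (k' - k)%N => [|n IHn]; first by rewrite addn0.
by rewrite addnS => /summand_decr.
Qed.

Lemma N_one l : N l 1 = 0%N.
Proof.
have := NM l (oner_neq0 R) (oner_neq0 R); rewrite mulr1 => e.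
by apply/eqP; rewrite -(eqn_add2l (N l 1)) addn0 -e.
Qed.

Lemma N_exp l f n : f != 0 -> N l (f ^+ n) = (n * N l f)%N.
Proof.
move=> f0; elim: n => [|n IHn]; first by rewrite expr0 N_one.
by rewrite exprS NM ?expf_neq0 // IHn mulSn.
Qed.

Lemma N_prod l (I : Type) (s : seq I) (P : pred I) (f : I -> R) : (forall j, f j != 0) ->
  \prod_(j <- s | P j) f j != 0 /\
  N l (\prod_(j <- s | P j) f j) = (\sum_(j <- s | P j) N l (f j))%N.
Proof.
move=> f0; apply: (big_ind2 (fun g n => g != 0 /\ N l g = n)) => [
  |g n g' n' [g0 gn] [g'0 gn']|//].
  by rewrite N_one oner_neq0.
by rewrite mulf_neq0 // NM // gn gn'.
Qed.

(** If B^i could be subtracted after adding B^j, then by [both] so could B^i + B^j, and B^i could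
    have been subtracted before. *)
Lemma summand_prod i (a : {ffun 'I_r -> nat}) (s : seq 'I_r) h :
  h != 0 -> ~ summand i 1 h -> i \notin s ->
  ~ summand i 1 (h * \prod_(j <- s) Q j ^+ a j).
Proof.
have step j g : g != 0 -> i != j -> ~ summand i 1 g -> ~ summand i 1 (g * Q j).
  move=> g0 ij ng sg; have gQ0 : g * Q j != 0 by rewrite mulf_neq0.
  have [|f f0 fN] := both ij gQ0 sg; first by exists g => // l; rewrite NM // mul1n.
  by apply: ng; exists f => // l; have := fN l; rewrite NM // => /addIn ->; rewrite mul1n.
have stepX j n g : g != 0 -> i != j -> ~ summand i 1 g -> ~ summand i 1 (g * Q j ^+ n).
  move=> g0 ij ng; elim: n => [|n IHn]; first by rewrite expr0 mulr1.
  by rewrite exprSr mulrA; apply: step => //; rewrite mulf_neq0 // expf_neq0.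
move=> h0 nh; elim: s => [|j s IHs]; first by rewrite big_nil mulr1.
rewrite inE negb_or => /andP[ij /IHs nis]; rewrite big_cons mulrCA [Q j ^+ _ * _]mulrC.
apply: stepX => //; rewrite mulf_neq0 //.
by have [] := N_prod i s predT (fun j => expf_neq0 (a j) (Q0 j)).
Qed.

Definition decomposes (a : {ffun 'I_r -> nat}) h h' : Prop :=
  [/\ h' != 0, forall l, N l h = (N l h' + \sum_i a i * N l (Q i))%N
    & forall i, ~ summand i 1 h'].

(** Curvette values are subtracted as long as possible; the sum of the values drops because each N i
    (Q i) is positive. *)
Lemma decomposes_ex h : h != 0 -> exists a h', decomposes a h h'.
Proof.
have [n] := ubnP (\sum_l N l h); elim: n h => // n IHn h hn h0.
have [nh|] := pselect (forall i, ~ summand i 1 h).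
  exists [ffun=> 0%N], h; split=> // l; rewrite big1 ?addn0 // => i _.
  by rewrite ffunE mul0n.
move=> /existsNP[i /contrapT[g g0 gN]].
have gn : (\sum_l N l g < n)%N.
  apply: (leq_trans _ (_ : \sum_l N l h <= n)%N) => //.
  rewrite (eq_bigr _ (fun l _ => gN l)) big_split /= -[X in (X < _)%N]addn0 ltn_add2l.
  by rewrite (bigD1 i) //= mul1n ltn_addr.
have [a [h' [h'0 h'N h'i]]] := IHn g gn g0.
exists [ffun j => (a j + (j == i))%N], h'; split=> // l.
rewrite gN h'N mul1n -addnA; congr (_ + _)%N; rewrite [in RHS](eq_bigr
  (fun j => a j * N l (Q j) + (j == i) * N l (Q j))%N); last first.
  by move=> j _; rewrite ffunE mulnDl.
rewrite big_split /=; congr (_ + _)%N.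
by rewrite (bigD1 i) //= eqxx mul1n big1 ?addn0 // => j /negPf ->.
Qed.

(** Split off a_i B^i alone: by [summand_prod] no further B^i can be subtracted from the rest. *)
Lemma decomposes_max a h h' i k : decomposes a h h' -> summand i k h <-> (k <= a i)%N.
Proof.
move=> [h'0 hN h'i].
pose g := h' * \prod_(j <- [seq j <- enum 'I_r | j != i]) Q j ^+ a j.
have Qa0 j : Q j ^+ a j != 0 by rewrite expf_neq0.
have g0 : g != 0.
  by apply: mulf_neq0 => //; case: (N_prod i [seq j <- enum 'I_r | j != i] predT Qa0).
have gN l : N l h = (N l g + a i * N l (Q i))%N.
  have [p0 pN] := N_prod l [seq j <- enum 'I_r | j != i] predT Qa0.
  rewrite hN NM // pN big_filter big_enum_cond [in LHS](bigD1 i) //= [(a i * _ + _)%N]addnC addnA.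
  by congr (_ + _ + _)%N; apply: eq_bigr => j _; rewrite N_exp.
have ng : ~ summand i 1 g by apply: summand_prod => //; rewrite mem_filter eqxx.
split=> [|ka]; last by apply: (summand_le ka); exists g.
move=> [f f0 fN]; rewrite leqNgt; apply/negP => ak; apply: ng.
apply: (@summand_le i _ (k - a i)); first by rewrite subn_gt0.
exists f => // l; apply/eqP; rewrite -(eqn_add2r (a i * N l (Q i))) -gN fN -addnA -mulnDl.
by rewrite subnK // ltnW.
Qed.

Lemma bump_sub i m : values_ge (bump_value i m) `<=` values_ge m.
Proof.
move=> f [->|fm]; first by left.
by right=> j; apply: leq_trans (fm j); exact: leq_addr.
Qed.

(** If the k + 1 classes from [lower] did not generate, one more independent class would allow a
    further B^i by [upper]. *)
Lemma graded_dim_max i k h : h != 0 -> summand i k h -> ~ summand i k.+1 h ->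
  qdim iota (values_ge (N^~ h)) (values_ge (bump_value i (N^~ h))) k.+1.
Proof.
move=> h0 [g g0 gN] nk; have [b [bm bfree]] := lower g0 gN.
exists b; split=> // f fm; apply: contrapT => nf; apply: nk.
apply: (upper h0 (b := fcons f b)); last exact: lind_fcons.
by move=> l; rewrite /fcons; case: unliftP.
Qed.

Lemma graded_dim1 i h :
  qdim iota (values_ge (N^~ h)) (values_ge (bump_value i (N^~ h))) 1 -> ~ summand i 1 h.
Proof.
move=> [e [em efree espan]] [g g0 gN]; have [b [bm bfree]] := lower g0 gN.
by have := steinitz (ge_subsp _) bm bfree espan.
Qed.

End Decomposition.

(** * From restrictions and natural orders to rows of integers *)

Section Filtration.
Variables (K : closedFieldType) (R : idomainType) (iota : {rmorphism K -> R}).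
Variables (r : nat) (N : 'I_r -> R -> nat).
Variables (A : 'I_r -> set {fraction R}) (x t : 'I_r -> {fraction R}).
Hypothesis ch : forall i, chart iota (A i) (x i) (t i).
Hypothesis chv : forall i, chart_val (A i) (x i) (N i).
Local Notation ld := (ld iota A x t).

Lemma ld_ge i n f : (exists p, ld i n f p) <-> f = 0 \/ (n <= N i f)%N.
Proof.
split=> [[p fp]|]; last exact: (ld_ex ch chv).
have [->|f0] := eqVneq f 0; first by left.
by right; have [[->]|[/ltnW]] := ld_cases ch chv f0 fp.
Qed.

Lemma atleastE m : atleast iota A x t m = values_ge N m.
Proof.
apply/seteqP; split=> f; last by case=> [->|fm] j; apply/ld_ge; [left|right].
move=> fm; have [->|f0] := eqVneq f 0; [by left|right=> j].
by have /ld_ge[/eqP|] := fm j; rewrite ?(negPf f0).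
Qed.

Lemma deeperE i m : deeper iota A x t i m = values_ge N (bump_value i m).
Proof.
apply/seteqP; split=> f; rewrite /deeper /= atleastE.
  move=> [fm fi]; have [->|f0] := eqVneq f 0; [by left|right=> j].
  have {}fm l : (m l <= N l f)%N by case: fm => // /eqP; rewrite (negPf f0).
  rewrite /bump_value; case: eqP => [->|_]; last by rewrite addn0.
  by rewrite addn1; have [[_ /eqP]|[]] := ld_cases ch chv f0 fi.
move=> fm; split; first exact: bump_sub fm.
case: fm => [->|fm]; first exact: (ld0 ch).
have [->|f0] := eqVneq f 0; first exact: (ld0 ch).
have := fm i; rewrite /bump_value eqxx addn1 => mi.
have /ld_ge[p fp] : f = 0 \/ (m i <= N i f)%N by right; exact: ltnW.
by have [[e]|[_ <-]] := ld_cases ch chv f0 fp; first by rewrite e ltnn in mi.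
Qed.

End Filtration.

Section Rows.
Variables (K : fieldType) (R : idomainType) (iota : {rmorphism K -> R}).
Variables (r : nat) (nu : 'I_r -> {fraction R} -> int).
Local Notation N := (fun i => ordv (nu i)).
Hypothesis nuE : forall i f, f != 0 -> nu i f%:F = (N i f)%:Z.

Lemma valueE h i : h != 0 -> value nu h 0 i = (N i h)%:Z.
Proof. by move=> h0; rewrite mxE nuE. Qed.

Lemma filtrationE (m : 'rV[int]_r) (n : 'I_r -> nat) :
  (forall l, m 0 l = (n l)%:Z) -> valuation_filtration nu m = values_ge N n.
Proof.
move=> mn; apply/seteqP; split=> f [->|fm]; try by left.
  have [->|f0] := eqVneq f 0; [by left|right=> j].
  by have := fm j; rewrite mn valueE // lez_nat.
have [->|f0] := eqVneq f 0; [by left|right=> j].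
by rewrite mn valueE // lez_nat.
Qed.

Lemma graded_dimE i h d : h != 0 -> (forall m, subsp iota (values_ge N m)) ->
  graded_dim iota nu i (value nu h) d <->
  qdim iota (values_ge N (N^~ h)) (values_ge N (bump_value i (N^~ h))) d.
Proof.
move=> h0 sN; rewrite -(quotient_dimE _ (sN _) (sN _) (@bump_sub _ _ _ _ _)).
rewrite /graded_dim (@filtrationE _ (N^~ h)) => [|l]; last by rewrite valueE.
rewrite (@filtrationE _ (bump_value i (N^~ h))) // => l.
by rewrite mxE valueE // mxE eqxx /= PoszD; congr (_ + _); case: eqP.
Qed.

Lemma summand_semigroup (Q : 'I_r -> R) i k h : h != 0 -> Q i != 0 ->
  value_semigroup nu (value nu h - value nu (Q i) *+ k) <-> summand N Q i k h.
Proof.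
move=> h0 Q0; split=> [[g g0 /rowP gE]|[g g0 gN]]; exists g => //; last first.
  apply/rowP => l; rewrite !mxE mulmxnE mxE !nuE // gN PoszD PoszM.
  by rewrite -[(k : int)]natz mulr_natl addrK.
move=> l; have := gE l; rewrite !mxE !nuE // mulmxnE mxE nuE // => e.
by apply/eqP; rewrite -eqz_nat PoszD PoszM -subr_eq -[(k : int)]natz mulr_natl e.
Qed.

End Rows.

(** Proportional valuations with value group Z agree up to sign, and opposite signs are excluded
    since both are nonnegative on R. *)
Lemma proportional_valuations (R : idomainType) (nu nu' : {fraction R} -> int) :
  discrete_valuation nu -> discrete_valuation nu' ->
  (forall f : R, f != 0 -> nu f%:F = (ordv nu f)%:Z) ->
  (forall f : R, f != 0 -> nu' f%:F = (ordv nu' f)%:Z) ->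
  (forall f g, f != 0 -> g != 0 -> (ordv nu f * ordv nu' g = ordv nu g * ordv nu' f)%N) ->
  forall z, z != 0 -> nu z = nu' z.
Proof.
move=> [nuM _ nuS] [nuM' _ nuS'] nuE nuE' prop.
have frac z : z != 0 -> exists p q : R, [/\ p != 0, q != 0,
    nu z = (ordv nu p)%:Z - (ordv nu q)%:Z & nu' z = (ordv nu' p)%:Z - (ordv nu' q)%:Z].
  move=> z0; have [p [q [q0 zE]]] := fracP z; have qF0 : q%:F != 0 by rewrite tofrac_eq0.
  have p0 : p != 0 by rewrite -tofrac_eq0 -zE mulf_neq0.
  exists p, q; split=> //; rewrite -?nuE -?nuE' // -zE ?nuM ?nuM' ?addrK //.
have bil z w : z != 0 -> w != 0 -> nu z * nu' w = nu w * nu' z.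
  move=> /frac[p [q [p0 q0 -> ->]]] /frac[p' [q' [p0' q0' -> ->]]].
  have := (prop p p' p0 p0', prop p q' p0 q0', prop q p' q0 p0', prop q q' q0 q0').
  move=> [[[]]]; lia.
have [z z0 nz] := nuS 1; have [w w0 nw] := nuS' 1.
have := bil z w z0 w0; rewrite nz nw mulr1 => e.
have /orP[/eqP z1|/eqP z1] := intUnitRing.unitzPl (esym e).
  by move=> u u0; have := bil z u z0 u0; rewrite nz z1 mul1r mulr1.
(* With opposite signs both valuations would be 0 on R, hence at z, whose value is 1. *)
have [p [q [p0 q0 np np']]] := frac z z0.
have opp f : f != 0 -> ordv nu f = 0%N.
  move=> f0; have fF0 : f%:F != 0 by rewrite tofrac_eq0.
  have := bil z f%:F z0 fF0; rewrite nz z1 nuE // nuE' //; lia.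
by move: np; rewrite nz !opp.
Qed.

(** All geometry is gathered here as statements on the orders of elements of R; the rest is
    combinatorics of these orders. *)
Lemma curvette_semigroup (K : closedFieldType) (R : idomainType)
    (iota : {rmorphism K -> R}) (r : nat) (nu : 'I_r -> {fraction R} -> int)
    (X : set (set {fraction R})) (C : 'I_r -> set {fraction R}) (Q : 'I_r -> R) :
  complete_regular_local_ring iota 2 ->
  (forall i, discrete_valuation (nu i)) -> pairwise_distinct nu -> modification X ->
  (forall i, component X (C i) /\ component_valuation (C i) (nu i)) ->
  (forall i, curvette X (C i) (Q i)) ->
  let N i := ordv (nu i) in
  [/\ (forall i, (0 < N i (Q i))%N) /\ (forall m, subsp iota (values_ge N m)),
      forall i m k h, h != 0 -> (forall l, m l = N l h + k * N l (Q i))%N ->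
        exists b : 'I_k.+1 -> R, (forall l, values_ge N m (b l)) /\
          lind iota (values_ge N (bump_value i m)) b,
      forall i k h (b : 'I_k.+1 -> R), h != 0 -> (forall l, values_ge N (N^~ h) (b l)) ->
        lind iota (values_ge N (bump_value i (N^~ h))) b -> summand N Q i k h
    & forall i j h, i != j -> h != 0 -> summand N Q i 1 h -> summand N Q j 1 h ->
        exists2 g, g != 0 & forall l, N l h = (N l g + N l (Q i) + N l (Q j))%N].
Proof.
move=> HR dv dist modX HC HQ N.
have [x0 [y0 xyP]] := mR_gen HR.
have y00 := y_neq0 HR xyP.
have yxP f : maxideal [set: R] f <-> exists a b, f = a * y0 + b * x0.
  by rewrite xyP; split=> -[a [b ->]]; exists b, a; rewrite addrC.
have x00 := y_neq0 HR yxP.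
have nuE i f : f != 0 -> nu i f%:F = (N i f)%:Z := ordvE (HC i).2.
have NM i f g : f != 0 -> g != 0 -> N i (f * g) = (N i f + N i g)%N.
  by apply: ordvM => // f'; exact: nuE.
have [_ I2 _] := modification_inv HR xyP x00 y00 modX.
have /choice[A /choice[x /choice[t chE]]] i :
  exists A x t, [/\ chart iota A x t, C i = chC A x &
  forall T, exceptional X T -> ~ isdiv iota T ->
    exists c0, forall c, c != c0 -> sepor (chT iota A x t c) T].
  exact: (component_good HR xyP x00 y00 modX (HC i).1).
have ch i : chart iota (A i) (x i) (t i) by case: (chE i).
have chv i : chart_val (A i) (x i) (N i).
  by apply: (component_chart_val (ch i)); case: (chE i) => _ <- _; exact: (HC i).2.
have /choice[T /choice[u /choice[w TP]]] i :=
  curvette_place HR xyP x00 y00 modX (HC i).1 (HC i).2 (dv i) (HQ i).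
have plT i : place iota (N i) (T i) (u i) (w i) by case: (TP i).
have Qirr i : irreducible_elt (Q i) by case: (HQ i).
have Qp i : passes (N i) (T i) (u i) (w i) (Q i) by case: (TP i) => _ _ _ _ [].
have Qm i : mult iota (N i) (T i) (u i) (Q i) 1 by case: (TP i) => _ _ _ _ [].
have neqN i j : i != j -> ~ forall f g, f != 0 -> g != 0 -> (N i f * N j g = N i g * N j f)%N.
  move=> ij prop; have [z z0] := dist i j ij; apply.
  by apply: proportional_valuations z0 => //; exact: nuE.
(* Distinct points of E are separated, and the two points differ because [transverse_same] would
   otherwise make the valuations agree on R. *)
have sepT i j : i != j -> sep (T i) (T j).
  move=> ij; have [tri eTi nTi _ _] := TP i; have [trj eTj _ _ _] := TP j.
  apply: I2 => // Tij; rewrite -Tij in trj; apply: (neqN i j ij) => f g f0 g0.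
  have same := transverse_same HR xyP x00 y00 modX (HC i).1 (HC j).1 tri trj (HC i).2 (HC j).2
    (dv i) (dv j).
  by rewrite /N (same f) // (same g) // mulnC.
have sepTc i j : cofin (fun c => sep (chT iota (A i) (x i) (t i) c) (T j) \/
    sep (T j) (chT iota (A i) (x i) (t i) c)).
  have [_ _ sepi] := chE i; have [_ eTj nTj _ _] := TP j.
  by have [c0 c0P] := sepi _ eTj nTj; apply: cofinW (cofin_neq c0) => c /c0P.
have dist' i j : i != j -> exists f g, [/\ f != 0, g != 0 & (N i f * N j g != N i g * N j f)%N].
  move=> /neqN nij; apply: contrapT => nex; apply: nij => f g f0 g0; apply/eqP.
  by apply: contraT => ne; case: nex; exists f, g.
have [bad badP] := points_apart_ex ch chv NM HR xyP x00 sepTc dist'.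
have gE m := atleastE ch chv m; have dE i m := deeperE ch chv i m.
split.
- split=> [i|m]; last by rewrite -gE; exact: (atleast_subsp ch).
  by apply: (nonunit_val (plT i)); case: (Qirr i).
- move=> i m k h h0 hm.
  have [b [bm bfree]] := independent_values ch chv NM HR xyP x00 Qirr plT Qp Qm sepT badP h0 hm.
  exists b; rewrite -dE; split=> // l; rewrite -gE.
  exact: (exactly_atleast ch chv (bm l)).
- move=> i k h b h0; rewrite -gE -dE => bm bfree.
  exact: (independent_upper ch chv NM HR xyP x00 Qirr plT Qp Qm sepT badP
    (conj h0 (fun=> erefl)) bm bfree).
- move=> i j h ij h0 [g g0 gN] [g' g0' gN'].
  apply: (subtract_both ch chv NM HR xyP x00 Qirr plT Qp Qm sepT badP ij g0 _ g0').
    by move=> l; rewrite gN mul1n.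
  by move=> l; rewrite gN' mul1n.
Qed.

Theorem theorem3 (K : closedFieldType) (R : idomainType)
    (iota : {rmorphism K -> R})
    (HR : complete_regular_local_ring iota 2)
    (r : nat) (r_gt0 : (0 < r)%N)
    (nu : 'I_r -> {fraction R} -> int)
    (nu_div : forall i, divisorial iota (nu i))
    (nu_distinct : pairwise_distinct nu)
    (X : set (set {fraction R})) (HX : minimal_resolution nu X)
    (C : 'I_r -> set {fraction R})
    (HC : forall i, component X (C i) /\ component_valuation (C i) (nu i))
    (Q : 'I_r -> R) (HQ : forall i, curvette X (C i) (Q i))
    (m : 'rV[int]_r) (Hm : value_semigroup nu m) :
  let B i := value nu (Q i) in
  let decomposition (a : {ffun 'I_r -> nat}) (n : 'rV[int]_r) :=
    [/\ value_semigroup nu n, m = n + \sum_i B i *+ a i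
      & forall i, graded_dim iota nu i n 1] in
  exists (a : {ffun 'I_r -> nat}) (n : 'rV[int]_r),
    [/\ decomposition a n,
        forall a' n', decomposition a' n' -> a' = a /\ n' = n,
        forall i, value_semigroup nu (m - B i *+ a i) /\
          forall k : nat, value_semigroup nu (m - B i *+ k) -> (k <= a i)%N
      & forall i, graded_dim iota nu i m (a i).+1].
Proof.
move=> B decomposition; set N := fun i => ordv (nu i).
have dv i : discrete_valuation (nu i) by case: (nu_div i).
have [[modX _] _] := HX.
have [[QN geN] lower upper both] := curvette_semigroup HR dv nu_distinct modX HC HQ.
have nuE i f : f != 0 -> nu i f%:F = (N i f)%:Z := ordvE (HC i).2.
have NM i f g : f != 0 -> g != 0 -> N i (f * g) = (N i f + N i g)%N.
  by apply: ordvM => // f'; exact: nuE.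
have Q0 i : Q i != 0 by case: (HQ i) => _ [].
have [h h0 mE] := Hm; have hE i : m 0 i = (N i h)%:Z by rewrite mE valueE.
have decE a h' : h' != 0 -> m = value nu h' + \sum_i B i *+ a i <->
    forall l, N l h = (N l h' + \sum_i a i * N l (Q i))%N.
  move=> h'0; have sumE l : (value nu h' + \sum_i B i *+ a i) 0 l =
      (N l h' + \sum_i a i * N l (Q i))%N%:Z.
    rewrite mxE valueE // summxE PoszD (big_morph Posz PoszD (erefl _)); congr (_ + _).
    by apply: eq_bigr => i _; rewrite mulmxnE valueE // PoszM -[(a i : int)]natz mulr_natl.
  split=> [me l|e]; last by apply/rowP => l; rewrite hE sumE e.
  by apply/eqP; rewrite -eqz_nat -hE me sumE.
have dec_of a n : decomposition a n -> exists2 h', n = value nu h' & decomposes N Q a h h'.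
  move=> [[h' h'0 ->] mdec dim1]; exists h' => //; split=> // [|i].
    exact/decE.
  by apply: (graded_dim1 geN lower); exact/(graded_dimE nuE).
have [a [h' dec]] := decomposes_ex (N := N) QN h0.
have maxP a' h'' i k : decomposes N Q a' h h'' -> summand N Q i k h <-> (k <= a' i)%N.
  exact: (decomposes_max NM Q0 both).
have semE i k : value_semigroup nu (m - B i *+ k) <-> (k <= a i)%N.
  by rewrite mE (summand_semigroup nuE) // (maxP _ _ _ _ dec).
exists a, (value nu h'); have [h'0 h'N h'i] := dec; split.
- split; first by exists h'.
    exact/decE.
  move=> i; apply/(graded_dimE nuE) => //.
  (* The case k = 0: no B^i can be subtracted from the value of h'. *)
  apply: (graded_dim_max geN lower upper) => //.
  by exists h' => // l; rewrite addn0.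
- move=> a' n' /dec_of[h'' -> dec'].
  (* In any decomposition the i-th coefficient is the largest k with m - k B^i in S_V. *)
  have aa' : a' = a.
    apply/ffunP => i; apply/eqP; rewrite eqn_leq; apply/andP; split.
      by apply/(maxP _ _ _ _ dec)/(maxP _ _ _ _ dec').
    by apply/(maxP _ _ _ _ dec')/(maxP _ _ _ _ dec).
  split=> //; apply/rowP => l; have [h''0 h''N _] := dec'.
  rewrite !valueE //; congr Posz; apply/eqP.
  by rewrite -(eqn_add2r (\sum_i a i * N l (Q i))) -h'N aa' in h''N *; rewrite -h''N.
- by move=> i; split; [exact/semE|move=> k /semE].
- move=> i; rewrite mE; apply/(graded_dimE nuE) => //.
  apply: (graded_dim_max geN lower upper) => //.
    exact/(maxP _ _ _ _ dec).
  by move=> /(maxP _ _ _ _ dec); rewrite ltnn.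
Qed.
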